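(* Let $g^B$ be a strongly convex coefficient. For any convex function $g^A$, the inf-convolution $g^A\square g^B$ is convex with quadratic growth (H3); so, in particular, this holds if $g^A$ satisfies (H3). In this case, the process $\widehat Z^B$ is in $BMO(\mathbb P)$, where, for a given $\xi_T\in L^\infty(\mathcal F_T)$, $Z$ is the second component of the maximal solution $(Y,Z)$ of the BSDE $(g^A\square g^B,-\xi_T)$ and $\widehat Z^B$ is a measurable process such that $$\widehat Z^B_t=\arg\min_x\{g^A(t,Z_t-x)+g^B(t,x)\}\qquad dt\times d\mathbb P\text{-a.s.}$$ (that is, $\widehat Z^B_t$ is a minimizer).
   Context: $W$ is a $d$-dimensional Brownian motion on $(\Omega,\mathcal F,\mathbb P)$ with completed natural filtration $(\mathcal F_t)$; $T>0$ is fixed. A coefficient is a map $g(\omega,t,z)$, $z\in\mathbb R^d$, progressively measurable in $(\omega,t)$; here $g^A$ and $g^B$ depend only on $(\omega,t,z)$, and convexity is with respect to $z$. Convex functions may take the value $+\infty$, but are understood to be not identically $+\infty$ and bounded from below by an affine function. $g^B$ is strongly convex if, for some constant $C>0$, $z\mapsto g^B(t,z)-\tfrac12C|z|^2$ is a convex function. (H3) (quadratic growth): $d\mathbb P\times dt$-a.s. $g(t,\cdot)$ is continuous and $|g(t,z)|\le k(1+|z|^2)$ for all $z$, for some constant $k$. $(g^A\square g^B)(t,z)=\inf_x\{g^A(t,z-x)+g^B(t,x)\}$. The BSDE $(g,\zeta)$ is $-dY_t=g(t,Z_t)dt-Z_tdW_t$, $Y_T=\zeta$, with $Y$ bounded and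 $\mathbb E\int_0^T|Z_s|^2ds<\infty$; its maximal solution is the one whose $Y$-component dominates that of every other solution. $BMO(\mathbb P)$ is the set of progressively measurable $\varphi$ with $\mathbb E\int_0^T|\varphi_s|^2ds<\infty$ such that for some constant $C'$, $\mathbb E[\int_t^T|\varphi_s|^2ds\,|\,\mathcal F_t]\le C'$ a.s. for all $t\le T$.
   Formalization: Added: g^A or g^B satisfies (H3); the bounds for ''not identically +∞'' and ''affine minorant'' of g^A and of g^B−½C|z|² are uniform in (ω,t); Ẑ^B is progressively measurable. Otherwise false: g^A=indicator of {0}, g^B=exp(|z|²)+|z|²; or g^A=0, g^B=|z−a_t|², a_t unbounded. *)

(* Defs.v *)
From HB Require Import structures.
From mathcomp Require Import all_boot all_order all_algebra.
From mathcomp Require Import all_classical all_reals all_analysis.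
From mathcomp Require Import measurable_realfun.

Set Implicit Arguments.
Unset Strict Implicit.
Unset Printing Implicit Defensive.

Import Order.TTheory GRing.Theory Num.Theory.
Import numFieldNormedType.Exports.

Local Open Scope classical_set_scope.
Local Open Scope ring_scope.

(* The library norm on 'rV[R]_d is the sup norm; the Euclidean structure of R^d
   is given by these two functions. *)
Definition dotv (R : realType) (d : nat) (x y : 'rV[R]_d) : R :=
  \sum_(i < d) x ord0 i * y ord0 i.

Definition sqnormv (R : realType) (d : nat) (x : 'rV[R]_d) : R := dotv x x.

Definition convex_ext (R : realType) (d : nat) (f : 'rV[R]_d -> \bar R) : Prop :=
  forall (x y : 'rV[R]_d) (l : R), 0 < l < 1 ->
    (f (l *: x + (1 - l) *: y)%R <= l%:E * f x + (1 - l)%:E * f y)%E.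

Definition inf_conv (R : realType) (Omega : Type) (d : nat)
    (gA gB : Omega -> R -> 'rV[R]_d -> \bar R) : Omega -> R -> 'rV[R]_d -> \bar R :=
  fun w t z => ereal_inf [set (gA w t (z - x)%R + gB w t x)%E | x in setT].

Definition ae_dPdt (R : realType) (dsp : measure_display)
    (Omega : measurableType dsp) (P : probability Omega R) (T : R)
    (Q : Omega -> R -> Prop) : Prop :=
  {ae (P \x @lebesgue_measure R)%E, forall p, 0 <= p.2 <= T -> Q p.1 p.2}.

(* Convexity in z, with values in ]-oo, +oo], not identically +oo, and bounded
   from below by an affine function.  As with the constant k of quadratic
   growth, K does not depend on (w, t): it bounds a point where g is finite,
   the value of g there, and the coefficients of the affine minorant. *)
Definition convex_coefficient (R : realType) (dsp : measure_display)
    (Omega : measurableType dsp) (P : probability Omega R) (T : R) (d : nat)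
    (g : Omega -> R -> 'rV[R]_d -> \bar R) : Prop :=
  exists K : R, ae_dPdt P T (fun w t =>
    [/\ convex_ext (g w t),
        exists2 z : 'rV[R]_d, sqnormv z <= K & (g w t z <= K%:E)%E
      & exists (a : 'rV[R]_d) (b : R), [/\ sqnormv a <= K, `|b| <= K
          & forall z, ((dotv a z + b)%:E <= g w t z)%E]]).

Definition strongly_convex (R : realType) (dsp : measure_display)
    (Omega : measurableType dsp) (P : probability Omega R) (T : R) (d : nat)
    (g : Omega -> R -> 'rV[R]_d -> \bar R) : Prop :=
  exists2 C : R, 0 < C &
    convex_coefficient P T (fun w t z => (g w t z - (C / 2 * sqnormv z)%:E)%E).

Definition quadratic_growth (R : realType) (dsp : measure_display)
    (Omega : measurableType dsp) (P : probability Omega R) (T : R) (d : nat)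
    (g : Omega -> R -> 'rV[R]_d -> \bar R) : Prop :=
  exists k : R, ae_dPdt P T (fun w t =>
    continuous (g w t) /\
    forall z, (`|g w t z| <= (k * (1 + sqnormv z))%:E)%E).

Definition natural_sigma (R : realType) (Omega : Type) (d : nat)
    (W : Omega -> R -> 'rV[R]_d) (t : R) : set (set Omega) :=
  <<s [set A | exists (s : R) (i : 'I_d) (B : set R),
        [/\ 0 <= s <= t, measurable B & A = [set w | B (W w s ord0 i)]]] >>.

(* When (Omega, P) is complete the measurable null sets are all the
   negligible sets, so this is the usual completion; in general it stays
   inside the sigma-algebra of Omega. *)
Definition completed_filtration (R : realType) (dsp : measure_display)
    (Omega : measurableType dsp) (P : probability Omega R) (d : nat)
    (W : Omega -> R -> 'rV[R]_d) (t : R) : set (set Omega) :=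
  <<s natural_sigma W t `|` [set N | measurable N /\ P N = 0%E] >>.

(* The third field says that W_t - W_s is independent of sigma(W_u, u <= s)
   and has law N(0, (t - s) I_d); normal_prob takes the standard deviation. *)
Record brownian_motion (R : realType) (dsp : measure_display)
    (Omega : measurableType dsp) (P : probability Omega R) (T : R) (d : nat)
    (W : Omega -> R -> 'rV[R]_d) : Prop := BrownianMotion {
  bm_measurable : forall (t : R) (i : 'I_d), 0 <= t <= T ->
    measurable_fun setT (fun w => W w t ord0 i) ;
  bm_zero : {ae P, forall w, W w 0 = 0} ;
  bm_increments : forall (s t : R) (A : set Omega) (B : 'I_d -> set R),
    0 <= s -> s < t -> t <= T -> natural_sigma W s A ->
    (forall i, measurable (B i)) ->
    P (A `&` [set w | forall i, B i (W w t ord0 i - W w s ord0 i)]) =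
      (P A * \prod_(i < d) normal_prob 0 (Num.sqrt (t - s)) (B i))%E ;
  bm_continuous : {ae P, forall w, {within `[0, T], continuous (W w)}}
}.

Definition measurable_wrt (dsp dsp' : measure_display)
    (Omega : measurableType dsp) (G : set (set Omega))
    (V : measurableType dsp') (X : Omega -> V) : Prop :=
  measurable_fun setT (X : g_sigma_algebraType G -> V).

Definition progressive (R : realType) (dsp dsp' : measure_display)
    (Omega : measurableType dsp) (T : R) (F : R -> set (set Omega))
    (V : measurableType dsp') (X : Omega -> R -> V) : Prop :=
  forall t : R, 0 <= t <= T ->
    measurable_fun (setT `*` `[0, t])
      (fun p : (g_sigma_algebraType (F t) * measurableTypeR R)%type => X p.1 p.2).

Definition progressive_vec (R : realType) (dsp : measure_display)
    (Omega : measurableType dsp) (T : R) (F : R -> set (set Omega)) (d : nat)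
    (X : Omega -> R -> 'rV[R]_d) : Prop :=
  forall i : 'I_d, progressive T F (fun w t => X w t ord0 i).

Definition coefficient (R : realType) (dsp : measure_display)
    (Omega : measurableType dsp) (T : R) (F : R -> set (set Omega)) (d : nat)
    (g : Omega -> R -> 'rV[R]_d -> \bar R) : Prop :=
  forall z : 'rV[R]_d, progressive T F (fun w t => g w t z).

(* E int_0^T |Z_s|^2 ds *)
Definition energy (R : realType) (dsp : measure_display)
    (Omega : measurableType dsp) (P : probability Omega R) (T : R) (d : nat)
    (Z : Omega -> R -> 'rV[R]_d) : \bar R :=
  (\int[P]_w \int[@lebesgue_measure R]_(s in `[0%R, T]) (sqnormv (Z w s))%:E)%E.

(* The process equal to sp_val i on ]sp_time i, sp_time i.+1], i < sp_size. *)
Record simple_process (R : realType) (Omega : Type) (d : nat) := SimpleProcess {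
  sp_size : nat ;
  sp_time : nat -> R ;
  sp_val : nat -> Omega -> 'rV[R]_d
}.

Definition simple_adapted (R : realType) (dsp : measure_display)
    (Omega : measurableType dsp) (T : R) (F : R -> set (set Omega)) (d : nat)
    (S : simple_process R Omega d) : Prop :=
  [/\ sp_time S 0%N = 0, sp_time S (sp_size S) = T,
      forall i, (i < sp_size S)%N -> sp_time S i <= sp_time S i.+1,
      forall i (j : 'I_d), (i < sp_size S)%N ->
        measurable_wrt (F (sp_time S i)) (fun w => sp_val S i w ord0 j)
    & exists M : R, forall i w (j : 'I_d), (i < sp_size S)%N ->
        `|sp_val S i w ord0 j| <= M].

Definition simple_eval (R : realType) (Omega : Type) (d : nat)
    (S : simple_process R Omega d) (w : Omega) (s : R) : 'rV[R]_d :=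
  \sum_(i < sp_size S)
    (if sp_time S i < s <= sp_time S i.+1 then sp_val S i w else 0).

Definition simple_integral (R : realType) (Omega : Type) (d : nat)
    (W : Omega -> R -> 'rV[R]_d) (S : simple_process R Omega d)
    (w : Omega) (t : R) : R :=
  \sum_(i < sp_size S)
    dotv (sp_val S i w)
         (W w (Num.min (sp_time S i.+1) t) - W w (Num.min (sp_time S i) t)).

(* I is a continuous version of the Ito integral int_0^. Z_s dW_s on [0, T]:
   the L^2 limit of integrals of simple processes converging to Z in
   L^2(dP x dt). *)
Definition ito_integral (R : realType) (dsp : measure_display)
    (Omega : measurableType dsp) (P : probability Omega R) (T : R) (d : nat)
    (W : Omega -> R -> 'rV[R]_d) (Z : Omega -> R -> 'rV[R]_d)
    (I : Omega -> R -> R) : Prop :=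
  [/\ forall t, 0 <= t <= T ->
        measurable_wrt (completed_filtration P W t) (fun w => I w t),
      {ae P, forall w, {within `[0, T], continuous (I w)}}
    & exists S : nat -> simple_process R Omega d,
      [/\ forall n, simple_adapted T (completed_filtration P W) (S n),
          (fun n => energy P T (fun w s => (Z w s - simple_eval (S n) w s)%R))
            @ \oo --> 0%E
        & forall t, 0 <= t <= T ->
          (fun n => \int[P]_w ((I w t - simple_integral W (S n) w t) ^+ 2)%R%:E)%E
            @ \oo --> 0%E]].

(* Solutions of - dY_t = g(t, Z_t) dt - Z_t dW_t, Y_T = zeta; the stochastic
   integral of Z over [t, T] is I_T - I_t. *)
Definition bsde_solution (R : realType) (dsp : measure_display)
    (Omega : measurableType dsp) (P : probability Omega R) (T : R) (d : nat)
    (W : Omega -> R -> 'rV[R]_d) (g : Omega -> R -> 'rV[R]_d -> \bar R)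
    (zeta : Omega -> R) (Y : Omega -> R -> R) (Z : Omega -> R -> 'rV[R]_d)
    : Prop :=
  [/\ progressive T (completed_filtration P W) Y,
      exists M : R, {ae P, forall w, forall t, 0 <= t <= T -> `|Y w t| <= M},
      progressive_vec T (completed_filtration P W) Z,
      (energy P T Z < +oo)%E
    & exists2 I : Omega -> R -> R, ito_integral P T W Z I &
      {ae P, forall w,
        (@lebesgue_measure R).-integrable `[0, T] (fun s => g w s (Z w s)) /\
        forall t, 0 <= t <= T ->
          (Y w t)%:E = ((zeta w)%:E
            + \int[@lebesgue_measure R]_(s in `[t, T]) g w s (Z w s)
            - (I w T - I w t)%:E)%E}].

Definition bsde_maximal_solution (R : realType) (dsp : measure_display)
    (Omega : measurableType dsp) (P : probability Omega R) (T : R) (d : nat)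
    (W : Omega -> R -> 'rV[R]_d) (g : Omega -> R -> 'rV[R]_d -> \bar R)
    (zeta : Omega -> R) (Y : Omega -> R -> R) (Z : Omega -> R -> 'rV[R]_d)
    : Prop :=
  bsde_solution P T W g zeta Y Z /\
  forall Y' Z', bsde_solution P T W g zeta Y' Z' ->
    {ae P, forall w, forall t, 0 <= t <= T -> Y' w t <= Y w t}.

Definition cond_expectation (R : realType) (dsp : measure_display)
    (Omega : measurableType dsp) (P : probability Omega R)
    (G : set (set Omega)) (X V : Omega -> \bar R) : Prop :=
  [/\ measurable_wrt G V, P.-integrable setT V
    & forall A, G A -> (\int[P]_(w in A) V w = \int[P]_(w in A) X w)%E].

Definition BMO (R : realType) (dsp : measure_display)
    (Omega : measurableType dsp) (P : probability Omega R) (T : R) (d : nat)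
    (F : R -> set (set Omega)) (phi : Omega -> R -> 'rV[R]_d) : Prop :=
  [/\ progressive_vec T F phi, (energy P T phi < +oo)%E
    & exists C : R, forall t, 0 <= t <= T ->
      exists2 V : Omega -> \bar R,
        cond_expectation P (F t)
          (fun w => \int[@lebesgue_measure R]_(s in `[t, T])
                      (sqnormv (phi w s))%:E)%E V
        & {ae P, forall w, (V w <= C%:E)%E}].

Definition Linfty (R : realType) (dsp : measure_display)
    (Omega : measurableType dsp) (P : probability Omega R)
    (G : set (set Omega)) (X : Omega -> R) : Prop :=
  measurable_wrt G X /\ exists M : R, {ae P, forall w, `|X w| <= M}.

(* Main.v *)
(* Convexity and growth are pointwise in (w, t): an affine minorant of g^A and a
   quadratic one of g^B bound the inf-convolution from below, while evaluating
   the infimum at the point where one of the two is known to be finite transfers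
   the quadratic growth of the other.  The same minorants bound the value at the
   minimizer:
     (g^A [] g^B)(t, Z) >= kap |ZB|^2 - c sqrt(1 + |Z|^2).
   For |Y| <= M put U = Y - M, so that -2M <= U <= 0; since the driver f is at
   least -m with m = c sqrt(1 + |Z|^2), Ito's formula for U^2 gives
     int |Z|^2 <= U_T^2 - U_t^2 - 2 int U Z dW + 4 M int m,
   and m grows only linearly in |Z|, so the last term is absorbed: Z is in BMO.
   Integrating the equation and using the lower bound again, ZB is in BMO.

   Ito's formula is replaced by discrete sums over uniform partitions: the
   squares of the integrals of f over the steps tend to 0, and the only facts
   needed about I = int Z dW are E[psi (I_u - I_s)] = 0 and
   E[psi int_s^u |Z|^2] <= 32 E[psi (I_u - I_s)^2] for bounded nonnegative
   F_s-measurable psi.  Both pass to the limit from simple integrands, and the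
   lossy constant avoids computing fourth moments or exact second moments of the
   normal law. *)
Require Import Defs.
From HB Require Import structures.
From mathcomp Require Import all_boot all_order all_algebra.
From mathcomp Require Import all_classical all_reals all_analysis.
From mathcomp Require Import measurable_realfun ring lra.

Set Implicit Arguments.
Unset Strict Implicit.
Unset Printing Implicit Defensive.

Import Order.TTheory GRing.Theory Num.Theory.
Import numFieldNormedType.Exports.

Local Open Scope classical_set_scope.
Local Open Scope ring_scope.

(** * Euclidean geometry and inf-convolutions *)

(** The squared integrals of the driver over the steps must vanish in expectation, not only along
    paths, although f is bounded only from below by terms under control. Domination comes from that
    lower bound: |f| <= f + 2 m, so int |f| <= int f + 2 int m, and int f over [0, T] is a
    difference of values of Y plus an increment of I, hence square integrable. The sign U <= 0 is
    what turns f >= -m into an upper bound for U f.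

    Conditional estimates are carried as inequalities against a weight psi with values in [0, 1],
    known at the initial time, with right-hand sides linear in E psi; psi = 1_A then yields the
    conditional bound.

    Origin of the constants: N(0, s^2) puts mass at least 1/2 outside ]-s/2, s/2[, whence E X^2 >=
    s^2 / 8; two doublings in the passage from simple integrands turn 8 into 32. The weight 1/128
    given to |Z|^2 in the pathwise inequality makes the term to absorb 64/128 = 1/2 of the left-hand
    side, and absorption is legitimate because the energy of Z is finite. *)

Section euclidean.
Context {R : realType} {d : nat}.
Implicit Types (x y z a : 'rV[R]_d) (l : R).

Lemma dotvC x y : dotv x y = dotv y x.
Proof. by apply: eq_bigr => i _; rewrite mulrC. Qed.

Lemma dotvDr x y z : dotv x (y + z) = dotv x y + dotv x z.
Proof. by rewrite -big_split; apply: eq_bigr => i _; rewrite mxE mulrDr. Qed.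

Lemma dotvZr l x y : dotv x (l *: y) = l * dotv x y.
Proof. by rewrite mulr_sumr; apply: eq_bigr => i _; rewrite mxE mulrCA. Qed.

Lemma dotvNr x y : dotv x (- y) = - dotv x y.
Proof. by rewrite -scaleN1r dotvZr mulN1r. Qed.

Lemma dotv0r x : dotv x 0 = 0.
Proof. by rewrite -(scale0r 0) dotvZr mul0r. Qed.

Lemma dotvBr x y z : dotv x (y - z) = dotv x y - dotv x z.
Proof. by rewrite dotvDr dotvNr. Qed.

Lemma sqnormvD x y : sqnormv (x + y) = sqnormv x + 2 * dotv x y + sqnormv y.
Proof.
rewrite /sqnormv dotvDr dotvC dotvDr (dotvC (x + y)) dotvDr (dotvC y x); ring.
Qed.

Lemma sqnormvZ l x : sqnormv (l *: x) = l ^+ 2 * sqnormv x.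
Proof. by rewrite /sqnormv dotvZr dotvC dotvZr; ring. Qed.

Lemma sqnormvN x : sqnormv (- x) = sqnormv x.
Proof. by rewrite -scaleN1r sqnormvZ sqrrN expr1n mul1r. Qed.

Lemma sqnormv_ge0 x : 0 <= sqnormv x.
Proof. by apply: sumr_ge0 => i _; rewrite -expr2 sqr_ge0. Qed.

Lemma sqnormvB x y : sqnormv (x - y) = sqnormv x - 2 * dotv x y + sqnormv y.
Proof. by rewrite sqnormvD sqnormvN dotvNr mulrN. Qed.

Lemma sqnormvD_le x y : sqnormv (x + y) <= 2 * sqnormv x + 2 * sqnormv y.
Proof.
by have := sqnormv_ge0 (x - y); rewrite sqnormvB sqnormvD; lra.
Qed.

Lemma sqnormvB_le x y : sqnormv (x - y) <= 2 * sqnormv x + 2 * sqnormv y.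
Proof. by rewrite -(sqnormvN y) sqnormvD_le. Qed.

(** Expansion of |l x - y|^2 >= 0. The sign of [l] is free: the minorants below take it negative to
    bound a scalar product from below. *)
Lemma dotv_young l x y : 2 * l * dotv x y <= l ^+ 2 * sqnormv x + sqnormv y.
Proof.
have := sqnormv_ge0 (l *: x - y).
by rewrite sqnormvB sqnormvZ dotvC dotvZr dotvC; lra.
Qed.

(** The topology of row vectors is that of the sup norm, whereas growth is measured by the Euclidean
    norm; continuity needs this comparison. *)
Lemma sqnormv_le_norm x : sqnormv x <= d%:R * `|x| ^+ 2.
Proof.
rewrite /sqnormv /dotv; apply: (@le_trans _ _ (\sum_(i < d) `|x| ^+ 2)); last first.
  by rewrite sumr_const card_ord mulr_natl.
apply: ler_sum => i _; rewrite -expr2 -real_normK ?num_real//.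
rewrite lerXn2r ?nnegrE//.
rewrite {2}/Num.norm/= mx_normrE.
exact: (le_bigmax _ (fun i : 'I_1 * 'I_d => `|x i.1 i.2|) (ord0, i)).
Qed.

End euclidean.

Section inf_convolution.
Context {R : realType} {d : nat}.
Implicit Types (f g : 'rV[R]_d -> \bar R) (x y z a : 'rV[R]_d) (K C : R).

Let conv f g z := ereal_inf [set (f (z - x)%R + g x)%E | x in setT].

Lemma ereal_inf_conv_le f g z x : (conv f g z <= f (z - x)%R + g x)%E.
Proof. by apply: ereal_inf_lbound; exists x. Qed.

(** If u and v are nearly optimal at x and y, then l u + (1 - l) v is a competitor at l x + (1 - l)
    y. Excluding [-oo] keeps the sums of extended reals meaningful. *)
Lemma convex_ext_inf_conv f g : (forall x, f x != -oo%E) ->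
  (forall x, g x != -oo%E) -> (forall z, conv f g z != -oo%E) ->
  convex_ext f -> convex_ext g -> convex_ext (conv f g).
Proof.
move=> f_y g_y h_y cf cg x y l /andP[l0 l1].
have l1' : 0 < 1 - l by rewrite subr_gt0.
(* Strict upper bounds r, s provide near-minimizers, so the infima need not be attained. *)
have key (r s : R) : (conv f g x < r%:E)%E -> (conv f g y < s%:E)%E ->
    (conv f g (l *: x + (1 - l) *: y)%R <= (l * r + (1 - l) * s)%:E)%E.
  move=> /ereal_inf_lt[_ [u _ <-] fgu] /ereal_inf_lt[_ [v _ <-] fgv].
  apply: (le_trans (ereal_inf_conv_le _ _ _ (l *: u + (1 - l) *: v))).
  have -> : l *: x + (1 - l) *: y - (l *: u + (1 - l) *: v) =
      l *: (x - u) + (1 - l) *: (y - v).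
    by rewrite !scalerBr opprD addrACA.
  have l01 : 0 < l < 1 by rewrite l0 l1.
  move: (cf (x - u) (y - v) l l01) (cg u v l l01).
  move: fgu fgv (f_y (x - u)) (g_y u) (f_y (y - v)) (g_y v).
  case: (f (x - u)) => [fu| |]//; case: (g u) => [gu| |]//.
  case: (f (y - v)) => [fv| |]//; case: (g v) => [gv| |]//.
  rewrite -!EFinD !lte_fin => fgu fgv _ _ _ _ cfu cgu.
  apply: (le_trans (leeD cfu cgu)).
  rewrite -EFinD lee_fin.
  have : l * (fu + gu) <= l * r by rewrite ler_pM2l// ltW.
  have : (1 - l) * (fv + gv) <= (1 - l) * s by rewrite ler_pM2l// ltW.
  lra.
(* If one of the two values is [+oo], so is the right-hand side, since both weights are positive. *)
have := h_y x; have := h_y y; move: (key).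
case: (conv f g x) => [a| |]//; case: (conv f g y) => [b| |]//; last 3 first.
- by move=> _ _ _; rewrite mulry gtr0_sg// mul1e -EFinM addey// leey.
- by move=> _ _ _; rewrite mulry gtr0_sg// mul1e -EFinM addye// leey.
- by move=> _ _ _; rewrite !gt0_muley ?lte_fin// leey.
move=> {}key _ _.
have -> : (l%:E * a%:E + (1 - l)%:E * b%:E = (l * a + (1 - l) * b)%:E)%E by [].
apply/lee_addgt0Pr => e e0; rewrite -EFinD.
apply: (le_trans (key (a + e) (b + e) _ _)).
- by rewrite lte_fin ltrDl.
- by rewrite lte_fin ltrDl.
- by rewrite lee_fin; lra.
Qed.

(** The sum of the two minorants is a.z + b + b' + (a' - a).x + C/2 |x|^2; minimizing over x costs
    |a' - a|^2 / (2 C), which is at most 2 K / C because |a' - a|^2 <= 4 K. *)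
Lemma ereal_inf_conv_affine_minorant f g a a' (b b' C K : R) : 0 < C ->
  sqnormv a <= K -> sqnormv a' <= K ->
  (forall z, (dotv a z + b)%:E <= f z)%E ->
  (forall z, (C / 2 * sqnormv z + (dotv a' z + b'))%:E <= g z)%E ->
  forall z, ((dotv a z + (b + b' - 2 * K / C))%:E <= conv f g z)%E.
Proof.
move=> C0 aK a'K fa ga z; apply: le_ereal_inf_tmp => _ [x _ <-].
apply: le_trans (leeD (fa _) (ga _)); rewrite -EFinD lee_fin dotvBr.
have := dotv_young (- C^-1) (a' - a) x.
have := sqnormvB_le a' a.
rewrite (dotvC (a' - a)) dotvBr !(dotvC x) => h1 h2.
have {h2} : C / 2 * (2 * - C^-1 * (dotv a' x - dotv a x)) <=
    C / 2 * ((- C^-1) ^+ 2 * (4 * K) + sqnormv x).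
  rewrite ler_pM2l; last by rewrite divr_gt0.
  apply: (le_trans h2); rewrite lerD2r ler_wpM2l ?sqr_ge0//; lra.
have -> : C / 2 * (2 * - C^-1 * (dotv a' x - dotv a x)) =
    - (dotv a' x - dotv a x) by field; rewrite gt_eqF.
have -> : C / 2 * ((- C^-1) ^+ 2 * (4 * K) + sqnormv x) =
    2 * K / C + C / 2 * sqnormv x by field; rewrite gt_eqF.
lra.
Qed.

(** Half of the curvature C/2 |x|^2 is kept, and the other half absorbs (a' - a).x at the price 4 K
    / C. The remaining terms are affine in z, hence at most a multiple of sqrt(1 + |z|^2), which is
    at least 1. *)
Lemma split_quadratic_minorant f g a a' (b b' C K : R) z x : 0 < C -> 0 <= K ->
  sqnormv a <= K -> sqnormv a' <= K -> `|b| <= K -> `|b'| <= K ->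
  (forall z, (dotv a z + b)%:E <= f z)%E ->
  (forall z, (C / 2 * sqnormv z + (dotv a' z + b'))%:E <= g z)%E ->
  ((C / 4 * sqnormv x - (3 * K + 1 + 4 * K / C) * Num.sqrt (1 + sqnormv z))%:E
     <= f (z - x)%R + g x)%E.
Proof.
move=> C0 K0 aK a'K bK b'K fa ga.
apply: le_trans (leeD (fa _) (ga _)); rewrite -EFinD lee_fin dotvBr.
have := dotv_young (- 2 / C) (a' - a) x.
have := sqnormvB_le a' a.
rewrite (dotvC (a' - a)) dotvBr !(dotvC x) => h1 h2.
have {h2} : C / 4 * (2 * (- 2 / C) * (dotv a' x - dotv a x)) <=
    C / 4 * ((- 2 / C) ^+ 2 * (4 * K) + sqnormv x).
  rewrite ler_pM2l; last by rewrite divr_gt0.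
  apply: (le_trans h2); rewrite lerD2r ler_wpM2l ?sqr_ge0//; lra.
have -> : C / 4 * (2 * (- 2 / C) * (dotv a' x - dotv a x)) =
    - (dotv a' x - dotv a x) by field; rewrite gt_eqF.
have -> : C / 4 * ((- 2 / C) ^+ 2 * (4 * K) + sqnormv x) =
    4 * K / C + C / 4 * sqnormv x by field; rewrite gt_eqF.
set q := 4 * K / C; have q0 : 0 <= q by rewrite divr_ge0 ?mulr_ge0// ltW.
set s := Num.sqrt _.
have s2 : s ^+ 2 = 1 + sqnormv z.
  by rewrite sqr_sqrtr// addr_ge0// sqnormv_ge0.
have s1 : 1 <= s.
  by rewrite -sqrtr1 ler_wsqrtr// lerDl sqnormv_ge0.
have s0 : 0 < s by rewrite (lt_le_trans _ s1).
(* Young's inequality with parameter -s, then |a|^2 <= K, |z|^2 <= s^2 and division by 2 s. *)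
have h3 : - dotv a z <= s * (K + 1) / 2.
  have := dotv_young (- s) a z; rewrite sqrrN => h4.
  have {}h4 : s * (2 * - dotv a z) <= s * (s * (K + 1)).
    have -> : s * (2 * - dotv a z) = 2 * - s * dotv a z by ring.
    apply: (le_trans h4).
    have : s ^+ 2 * sqnormv a <= s ^+ 2 * K by rewrite ler_wpM2l// sqr_ge0.
    by rewrite !expr2; lra.
  by move: h4; rewrite ler_pM2l//; lra.
move: bK b'K; rewrite !ler_norml => /andP[bK _] /andP[b'K _].
have : (2 * K + q) * 1 <= (2 * K + q) * s by rewrite ler_wpM2l//; lra.
have : 0 <= K * s by rewrite mulr_ge0// ltW.
by move: h3; lra.
Qed.

(** A convex function bounded by M on a ball of radius 2 is Lipschitz with constant 2 M near the
    centre. *)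
Lemma convex_quadratic_growth_continuous f (k : R) : convex_ext f ->
  (forall z, `|f z| <= (k * (1 + sqnormv z))%:E)%E -> continuous f.
Proof.
move=> cf fk.
have ffin z : f z = (fine (f z))%:E.
  rewrite fineK// fin_num_abs; apply: (le_lt_trans (fk z)); exact: ltry.
pose fr z := fine (f z).
have k0 : 0 <= k.
  have := fk 0; rewrite /sqnormv dotv0r addr0 mulr1 ffin lee_fin.
  exact: le_trans.
have cfr x y l : 0 < l < 1 ->
    fr (l *: x + (1 - l) *: y) <= l * fr x + (1 - l) * fr y.
  by move=> l01; have := cf x y l l01; rewrite ffin (ffin x) (ffin y) lee_fin.
suff cfr' : continuous fr.
  move=> x; rewrite /continuous_at (ffin x).
  apply: (@cvg_EFin R _ (nbhs x) (nbhs_filter x) f (fr x)); last exact: cfr'.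
  by apply: (@filterE _ _ (nbhs_filter x)) => z; rewrite ffin.
move=> x.
pose M := k * (1 + d%:R * (`|x| + 2) ^+ 2).
have frM u : `|u - x| <= 2 -> `|fr u| <= M.
  move=> ux; rewrite -lee_fin -abse_EFin -ffin; apply: (le_trans (fk u)).
  rewrite lee_fin ler_wpM2l// lerD2l (le_trans (sqnormv_le_norm _))//.
  rewrite ler_wpM2l// lerXn2r ?nnegrE ?addr_ge0//.
  by rewrite -[u](subrK x) (le_trans (ler_normD _ _))// addrC lerD2l.
have M0 : 0 <= M by apply: le_trans (frM x _); rewrite ?subrr ?normr0.
have half u v : `|u - x| <= 1 -> `|v - u| < 1 -> fr v - fr u <= 2 * M * `|v - u|.
  move=> ux; have [->|vu] := eqVneq v u.
    by rewrite !subrr normr0 mulr0.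
  set e := `|v - u| => e1.
  have e0 : 0 < e by rewrite normr_gt0 subr_eq0.
  (* [w] prolongs the segment from u through v to distance 1 from u, so that v = e w + (1 - e) u and
     convexity gives f v - f u <= e (f w - f u) <= 2 M e. *)
  pose w := u + e^-1 *: (v - u).
  have -> : v = e *: w + (1 - e) *: u.
    rewrite scalerDr scalerA divff ?gt_eqF// scale1r scalerBl scale1r.
    by rewrite addrC addrA subrK addrC subrK.
  have wx : `|w - x| <= 2.
    rewrite /w addrAC (le_trans (ler_normD _ _))// normrZ ger0_norm ?invr_ge0 ?(ltW e0)//.
    by rewrite mulVf ?gt_eqF//; lra.
  have e01 : 0 < e < 1 by rewrite e0.
  have := cfr w u e e01.
  have := frM _ wx; rewrite ler_norml => /andP[_ wM].
  have := frM u (le_trans ux _); rewrite ler_norml => /(_ _)/andP[|uM _]; first by lra.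
  have : e * (fr w - fr u) <= e * (2 * M) by rewrite ler_pM2l//; lra.
  by lra.
apply/(@cvgrPdist_le _ _ _ (nbhs x) (nbhs_filter x)) => e e0.
have N0 : 0 < 2 * M + 1 by lra.
apply/nbhs_ballP; exists (Num.min 1 (e / (2 * M + 1))) => /=.
  by rewrite lt_min ltr01 divr_gt0.
move=> y; rewrite -ball_normE/= lt_min => /andP[yx yxe].
have {}yxe : 2 * M * `|x - y| <= e.
  apply: (@le_trans _ _ ((2 * M + 1) * `|x - y|)).
    by rewrite ler_wpM2r// lerDl.
  by rewrite mulrC -ler_pdivlMr// ltW.
have h1 := half y x; have h2 := half x y.
rewrite ler_norml; apply/andP; split.
  rewrite -(distrC x y) subrr normr0 ler01 in h2.
  by have := h2 isT yx; lra.
rewrite -(distrC x y) in h1.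
by have := h1 (ltW yx) yx; lra.
Qed.

End inf_convolution.

(** * Brownian increments *)

Section normal_moments.
Context {R : realType}.
Local Notation mu := (@lebesgue_measure R).
Implicit Types s : R.

(** Change of variables with the Radon-Nikodym derivative, which is almost everywhere [normal_pdf]
    because both have the same integral over every measurable set. *)
Lemma ge0_integral_normal_prob s (f : R -> \bar R) : measurable_fun setT f ->
  (forall x, 0 <= f x)%E ->
  (\int[normal_prob 0 s]_x f x = \int[mu]_x (f x * (normal_pdf 0 s x)%:E))%E.
Proof.
move=> mf f0.
have dom := @normal_prob_dominates R 0 s.
rewrite -(Radon_Nikodym_SigmaFinite.change_of_variables dom f0 measurableT mf).
apply: ae_eq_integral => //.
- apply: emeasurable_funM => //.
  exact: (measurable_int mu (Radon_Nikodym_SigmaFinite.f_integrable dom)).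
- apply: emeasurable_funM => //; apply/measurable_EFinP.
  exact: measurable_normal_pdf.
- apply: ae_eqe_mul2l.
  apply: integral_ae_eq => //.
  + exact: Radon_Nikodym_SigmaFinite.f_integrable.
  + by apply/measurable_EFinP; exact: measurable_normal_pdf.
  + move=> E _ mE; rewrite -(Radon_Nikodym_SigmaFinite.f_integral dom mE)//.
Qed.

(** Symmetry of the density. Stated for positive and negative parts, it expresses the zero mean
    without any integrability. *)
Lemma normal_prob_pos_neg_part s : s != 0 ->
  (\int[normal_prob 0 s]_x (Num.max x 0)%:E =
   \int[normal_prob 0 s]_x (Num.max (- x) 0)%:E)%E.
Proof.
move=> s0.
have mmax (F : R -> R) : continuous F -> measurable_fun setT (fun x => Num.max (F x) 0).
  by move=> cF; apply: measurable_maxr => //; exact: continuous_measurable_fun.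
have cmax (F : R -> R) : continuous F -> continuous (fun x => Num.max (F x) 0).
  by move=> cF x; apply: continuous_max; [exact: cF|exact: cst_continuous].
have cN : continuous (@GRing.opp R) by move=> x; exact: oppr_continuous.
have cid : continuous (@idfun R) by move=> x; exact: cvg_id.
rewrite !ge0_integral_normal_prob//; last first.
- by move=> x; rewrite lee_fin le_max lexx orbT.
- by apply/measurable_EFinP; exact: (mmax idfun).
- by move=> x; rewrite lee_fin le_max lexx orbT.
- by apply/measurable_EFinP; exact: (mmax -%R).
have E (A : set R) F : (forall x, ~ A x -> F x <= 0) ->
    (\int[mu]_x ((Num.max (F x) 0)%:E * (normal_pdf 0 s x)%:E) =
     \int[mu]_(x in A) ((Num.max (F x) 0 * normal_pdf 0 s x)%:E))%E.
  move=> AF; rewrite [RHS]integral_mkcond; apply: eq_integral => x _.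
  rewrite patchE; case: ifPn => // /negP; rewrite inE => /AF Fx.
  by rewrite max_r// mul0e.
rewrite (E `[0, +oo[%classic); last first.
  by move=> x /=; rewrite in_itv/= andbT => /negP; rewrite -ltNge => /ltW.
(* The bound is written [- 0] to fit the substitution x |-> -x between the two half-lines. *)
rewrite (E `]-oo, (- 0)]%classic -%R); last first.
  by move=> x /=; rewrite in_itv/= oppr0 => /negP; rewrite -ltNge oppr_le0 => /ltW.
rewrite ge0_integration_by_substitutionNy/=.
- apply: eq_integral => x _; rewrite /= opprK normal_pdfE//.
  by rewrite /normal_fun !subr0 sqrrN.
- apply: continuous_subspaceT => x; apply: cvgM.
    exact: (cmax -%R cN).
  exact: continuous_normal_pdf.
- move=> x _; rewrite mulr_ge0 ?normal_pdf_ge0//.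
  by rewrite le_max lexx orbT.
Qed.

(** With y = x^2 / (4 s^2), y exp(-y) <= 1 gives x^2 exp(-2 y) <= 4 s^2 exp(-y), and exp(-y) is, up
    to the ratio of peaks, the density with standard deviation s sqrt 2. *)
Lemma normal_prob_sqr_lty s : 0 < s ->
  (\int[normal_prob 0 s]_x (x ^+ 2)%:E < +oo)%E.
Proof.
move=> s0.
have q0 : 0 < Num.sqrt 2 :> R by rewrite sqrtr_gt0.
have sq0 : s * Num.sqrt 2 != 0 by rewrite gt_eqF// mulr_gt0.
rewrite ge0_integral_normal_prob//; last 2 first.
- by apply/measurable_EFinP; exact: measurable_funX.
- by move=> x; rewrite lee_fin sqr_ge0.
pose c := 4 * s ^+ 2 * normal_peak s / normal_peak (s * Num.sqrt 2).
have c0 : 0 <= c.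
  rewrite divr_ge0 ?normal_peak_ge0// mulr_ge0 ?normal_peak_ge0//.
  by rewrite mulr_ge0 ?sqr_ge0.
apply: (@le_lt_trans _ _ (\int[mu]_x (c%:E * (normal_pdf 0 (s * Num.sqrt 2) x)%:E))%E).
  apply: ge0_le_integral => //.
  - by move=> x _; rewrite -EFinM lee_fin mulr_ge0 ?sqr_ge0 ?normal_pdf_ge0.
  - apply/measurable_EFinP; apply: measurable_funM; first exact: measurable_funX.
    exact: measurable_normal_pdf.
  - apply: emeasurable_funM => //; apply/measurable_EFinP; exact: measurable_normal_pdf.
  move=> x _; rewrite -!EFinM lee_fin normal_pdfE ?gt_eqF//.
  rewrite normal_pdfE// [leRHS]mulrA /c divfK ?gt_eqF ?normal_peak_gt0//.
  rewrite mulrCA [in leRHS]mulrAC [leRHS]mulrC ler_wpM2l ?normal_peak_ge0//.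
  rewrite /normal_fun subr0 exprMn sqr_sqrtr//.
  set y := x ^+ 2 / (4 * s ^+ 2).
  have xy : x ^+ 2 = 4 * s ^+ 2 * y.
    by rewrite /y mulrC divfK// gt_eqF// mulr_gt0// exprn_gt0.
  have -> : - x ^+ 2 / (s ^+ 2 *+ 2) = - y + - y.
    by rewrite xy -mulr_natr; field; rewrite gt_eqF.
  have -> : - x ^+ 2 / (s ^+ 2 * 2 *+ 2) = - y.
    by rewrite xy -mulr_natr; field; rewrite gt_eqF.
  have ye : y * expR (- y) <= 1.
    rewrite -(expRxMexpNx_1 y) ler_wpM2r ?expR_ge0//.
    by have := expR_ge1Dx y; lra.
  rewrite xy expRD.
  rewrite (_ : 4 * s ^+ 2 * y * _ = 4 * s ^+ 2 * expR (- y) * (y * expR (- y))).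
    by rewrite ler_piMr// mulr_ge0 ?expR_ge0// mulr_ge0 ?sqr_ge0.
  by ring.
rewrite integralZl//; last exact: integrable_normal_pdf.
by rewrite integral_normal_pdf mule1 ltry.
Qed.

(** The density is at most its peak, so ]-s/2, s/2[ has mass at most 1 / sqrt(2 pi) <= 1/2; outside
    it, where at least half the mass lies, x^2 >= (s/2)^2. *)
Lemma normal_prob_sqr_ge s : 0 < s ->
  ((s ^+ 2 / 8)%:E <= \int[normal_prob 0 s]_x (x ^+ 2)%:E)%E.
Proof.
move=> s0; have sn0 : s != 0 by rewrite gt_eqF.
pose B : set R := `](- (s / 2)), (s / 2)[%classic.
have mB : measurable B by exact: measurable_itv.
have PB : (normal_prob 0 s B <= (1 / 2)%:E)%E.
  apply: (@le_trans _ _ (\int[mu]_(x in B) (normal_peak s)%:E))%E.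
    apply: ge0_le_integral => //.
    - by move=> x _; rewrite lee_fin normal_pdf_ge0.
    - by apply/measurable_EFinP/measurable_funTS; exact: measurable_normal_pdf.
    - by move=> x _; rewrite lee_fin normal_pdf_ub.
  rewrite integral_cst//= /B lebesgue_measure_itv/= lte_fin ifT; last lra.
  rewrite -EFinB -EFinM lee_fin opprK -splitr.
  rewrite /normal_peak -mulrnAr sqrtrM ?sqr_ge0// sqrtr_sqr gtr0_norm//.
  rewrite invfM mulrAC mulVf// mul1r div1r lef_pV2 ?posrE ?sqrtr_gt0//.
  - rewrite (_ : 2 = Num.sqrt (2 ^+ 2)); last by rewrite sqrtr_sqr ger0_norm.
    by rewrite ler_wsqrtr// -mulr_natr; have := pi_ge2 R; lra.
  - by rewrite mulrn_wgt0// pi_gt0.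
have PBc : ((1 / 2)%:E <= normal_prob 0 s (~` B))%E.
  rewrite probability_setC// leeBrDr; last exact: fin_num_measure.
  apply: (le_trans (leeD2l _ PB)); rewrite -EFinD lee_fin; lra.
apply: (@le_trans _ _ (\int[normal_prob 0 s]_(x in ~` B) ((s / 2) ^+ 2)%:E))%E.
  rewrite integral_cst; last exact: measurableC.
  apply: le_trans (lee_wpmul2l _ PBc); last by rewrite lee_fin sqr_ge0.
  by rewrite -EFinM lee_fin; lra.
apply: (@le_trans _ _ (\int[normal_prob 0 s]_(x in ~` B) (x ^+ 2)%:E))%E.
  apply: ge0_le_integral => //.
  - exact: measurableC.
  - by move=> x _; rewrite lee_fin sqr_ge0.
  - by apply/measurable_EFinP; exact: measurable_funX.
  - move=> x /= /negP; rewrite in_itv/= -[x ^+ 2]real_normK ?num_real// => h.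
    rewrite lee_fin lerXn2r ?nnegrE//; first by lra.
    rewrite leNgt; apply/negP; rewrite ltr_norml; exact/negP.
apply: ge0_subset_integral => //; first exact: measurableC.
- by apply/measurable_EFinP; exact: measurable_funX.
- by move=> x _; rewrite lee_fin sqr_ge0.
Qed.

End normal_moments.

Section sub_sigma_algebra.
Context {dsp : measure_display} {T : measurableType dsp}.
Implicit Types G H : set (set T).

Lemma g_sigma_sub G H : G `<=` <<s H >> -> <<s G >> `<=` <<s H >>.
Proof. by move=> GH; apply: smallest_sub => //; exact: smallest_sigma_algebra. Qed.

Lemma g_sigma_measurable G : G `<=` measurable -> <<s G >> `<=` measurable.
Proof.
by move=> Gm; apply: smallest_sub => //; exact: sigma_algebra_measurable.
Qed.

Lemma measurable_wrt_sub d' (V : measurableType d') G H (X : T -> V) :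
  G `<=` <<s H >> -> measurable_wrt G X -> measurable_wrt H X.
Proof.
by move=> GH mX _ B mB; have := mX measurableT B mB; apply: (g_sigma_sub GH).
Qed.

Lemma measurable_wrt_measurable d' (V : measurableType d') G (X : T -> V) :
  G `<=` measurable -> measurable_wrt G X -> measurable_fun setT X.
Proof.
by move=> Gm mX _ B mB; have := mX measurableT B mB; apply: (g_sigma_measurable Gm).
Qed.

Lemma measurable_wrt_indic {R : realType} G (A : set T) :
  G A -> measurable_wrt G (\1_A : T -> R).
Proof.
by move=> GA; apply: (@measurable_indic _ (g_sigma_algebraType G)); exact: sub_sigma_algebra.
Qed.

End sub_sigma_algebra.

(** * Independence tested on a generating pi-system *)

Section independence.
Context {dsp : measure_display} {T : measurableType dsp} {R : realType}.
Variables (P : probability T R) (G : set (set T)) (X : T -> R).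
Variable N : probability (measurableTypeR R) R.
Hypotheses (Gm : G `<=` measurable) (GI : setI_closed G) (GT : G setT).
Hypothesis mX : measurable_fun setT X.
Hypothesis indep : forall A B, G A -> measurable B ->
  (P (A `&` X @^-1` B) = P A * N B)%E.

(** Both sides are finite measures in A that agree on the pi-system [G], hence on the sigma-algebra
    that it generates. *)
Lemma indep_g_sigma (A : set T) (B : set R) : <<s G >> A -> measurable B ->
  (P (A `&` X @^-1` B) = P A * N B)%E.
Proof.
move=> GA mB.
have mXB : measurable (X @^-1` B) by rewrite -[X in measurable X]setTI; exact: mX.
have NB0 : 0 <= fine (N B) by rewrite fine_ge0.
have NBE : N B = (fine (N B))%:E by rewrite fineK// fin_num_measure.
suff : mrestr P mXB A = mscale (NngNum NB0) P A.
  by rewrite /mrestr /mscale /= muleC => ->; rewrite [in RHS]NBE.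
apply: (@g_sigma_algebra_measure_unique _ R T G Gm (fun=> setT)) => //.
- by rewrite bigcup_const.
- move=> A1 GA1; change (P (A1 `&` X @^-1` B) = (fine (N B))%:E * P A1)%E.
  by rewrite -NBE muleC indep.
- move=> _; change (P (setT `&` X @^-1` B) < +oo)%E; rewrite setTI.
  exact: le_lt_trans (probability_le1 _ mXB) (ltry 1).
Qed.

(** The joint law of the identity, read in the sigma-algebra of [G], and of [X] is the product of P
    restricted to that sigma-algebra and [N]; Tonelli's theorem then separates the factors. *)
Lemma ge0_integral_indep (f : T -> \bar R) (h : R -> \bar R) :
  measurable_wrt G f -> measurable_fun setT h ->
  (forall w, 0 <= f w)%E -> (forall x, 0 <= h x)%E ->
  (\int[P]_w (f w * h (X w)) = (\int[P]_w f w) * \int[N]_x h x)%E.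
Proof.
move=> mf mh f0 h0.
have mid : measurable_fun setT (idfun : T -> g_sigma_algebraType G).
  by move=> _ B mB; rewrite setTI; exact: (g_sigma_measurable Gm mB).
have mphi : measurable_fun setT
    (fun w => (w, X w) : g_sigma_algebraType G * measurableTypeR R).
  exact: measurable_fun_pair.
pose id' : {mfun T >-> g_sigma_algebraType G} := mfun_Sub (mem_set mid).
pose phi : {mfun T >-> (g_sigma_algebraType G * measurableTypeR R)%type} :=
  mfun_Sub (mem_set mphi).
pose F (z : g_sigma_algebraType G * measurableTypeR R) := (f z.1 * h z.2)%E.
have mF : measurable_fun setT F.
  apply: emeasurable_funM.
    by apply: (measurableT_comp mf); exact: measurable_fst.
  by apply: (measurableT_comp mh); exact: measurable_snd.
have F0 z : (0 <= F z)%E by rewrite /F mule_ge0.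
have -> : (\int[P]_w (f w * h (X w)) = \int[distribution P phi]_z F z)%E.
  by rewrite ge0_integral_distribution.
transitivity (\int[(distribution P id' \x N)%E]_z F z)%E.
  apply: eq_measure_integral => A mA _; apply/esym.
  apply: product_measure_unique => // A' B' mA' mB'.
  rewrite /distribution /pushforward /=.
  by rewrite -indep_g_sigma.
rewrite (fubini_tonelli1 F)//.
rewrite /fubini_F /F /=.
under eq_integral do rewrite ge0_integralZl//.
rewrite ge0_integralZr//; last exact: integral_ge0.
by congr (_ * _)%E; rewrite ge0_integral_distribution.
Qed.

End independence.

Section normal_independence.
Context {dsp : measure_display} {T : measurableType dsp} {R : realType}.
Variables (P : probability T R) (G : set (set T)) (X : T -> R) (s : R).
Hypotheses (Gm : G `<=` measurable) (GI : setI_closed G) (GT : G setT).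
Hypotheses (mX : measurable_fun setT X) (s0 : 0 < s).
Hypothesis indep : forall A B, G A -> measurable B ->
  (P (A `&` X @^-1` B) = P A * normal_prob 0 s B)%E.

Let ge0_indep := ge0_integral_indep Gm GI GT mX indep.

(** Writes the positive part of a product as a sum of products of nonnegative factors, to each of
    which the factorization of nonnegative integrals applies. *)
Lemma max_mulr_split (a b : R) : Num.max (a * b) 0 =
  Num.max a 0 * Num.max b 0 + Num.max (- a) 0 * Num.max (- b) 0.
Proof.
have [a0|a0] : 0 <= a \/ a < 0 by case: (leP 0 a); [left|right].
  all: have [b0|b0] : 0 <= b \/ b < 0 by case: (leP 0 b); [left|right].
- rewrite (max_l a0) (max_l b0) (max_l (mulr_ge0 a0 b0)).
  by rewrite (@max_r _ _ (- a)) ?oppr_le0// mul0r addr0.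
- rewrite (max_l a0) (max_r (ltW b0)) mulr0 (@max_r _ _ (- a)) ?oppr_le0//.
  by rewrite mul0r addr0 max_r// mulr_ge0_le0// ltW.
- rewrite (max_r (ltW a0)) mul0r (@max_r _ _ (- b)) ?oppr_le0// mulr0 addr0.
  by rewrite max_r// mulr_le0_ge0// ltW.
- rewrite (max_r (ltW a0)) mul0r add0r !max_l ?mulrNN ?oppr_ge0 ?(ltW a0) ?(ltW b0)//.
  by rewrite nmulr_lge0// ltW.
Qed.

Lemma integrable_indep_normal (f : T -> R) : measurable_wrt G f ->
  P.-integrable setT (EFin \o f) ->
  P.-integrable setT (EFin \o (fun w => f w * X w)).
Proof.
move=> mf /integrableP[mf' intf]; apply/integrableP; split.
  by apply/measurable_EFinP; apply: measurable_funM => //; apply/measurable_EFinP.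
under eq_integral do rewrite /= normrM EFinM.
rewrite (ge0_indep (f := fun w => (`|f w|)%:E) (h := fun x => (`|x|)%:E)) //.
- apply: lte_mul_pinfty => //; first exact: integral_ge0.
  + by rewrite ge0_fin_numE//; exact: integral_ge0.
  (* The first absolute moment is finite because |x| <= 1 + x^2. *)
  + apply: (@le_lt_trans _ _ (\int[normal_prob 0 s]_x (1 + (x ^+ 2)%:E))%E).
      apply: ge0_le_integral => //.
      * by apply/measurable_EFinP; exact: normr_measurable.
      * by apply: emeasurable_funD => //; apply/measurable_EFinP; exact: measurable_funX.
      * move=> x _; rewrite -EFinD lee_fin -[x ^+ 2]real_normK ?num_real//.
        by have := sqr_ge0 (`|x| - 1); have := normr_ge0 x; rewrite sqrrB1; lra.
    rewrite ge0_integralD//; last 2 first.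
    * by move=> x _; rewrite lee_fin sqr_ge0.
    * by apply/measurable_EFinP; exact: measurable_funX.
    rewrite lte_add_pinfty//; last exact: normal_prob_sqr_lty.
    by rewrite integral_cst// mul1e; apply: le_lt_trans (probability_le1 _ _) (ltry 1).
- by apply/measurable_EFinP; apply: (measurableT_comp _ mf).
- by apply/measurable_EFinP; exact: normr_measurable.
Qed.

(** As E X^+ = E X^- = a, the positive part of f X has expectation (E f^+ + E f^-) a. This is
    unchanged when f is replaced by -f, so the positive and negative parts of f X cancel. *)
Lemma integral_indep_normal (f : T -> R) : measurable_wrt G f ->
  P.-integrable setT (EFin \o f) -> \int[P]_w (f w * X w) = 0.
Proof.
move=> mf intf; have intfX := integrable_indep_normal mf intf.
have mf' : measurable_fun setT f by exact: measurable_wrt_measurable mf.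
have s_neq0 : s != 0 by rewrite gt_eqF.
have mmax (dU : measure_display) (U : measurableType dU) (g : U -> R) :
    measurable_fun setT g -> measurable_fun setT (fun x => (Num.max (g x) 0)%:E).
  by move=> mg; apply/measurable_EFinP; exact: measurable_maxr.
have max0 (x : R) : (0 <= (Num.max x 0)%:E)%E by rewrite lee_fin le_max lexx orbT.
pose a := (\int[normal_prob 0 s]_x (Num.max x 0)%:E)%E.
have aE : (\int[normal_prob 0 s]_x (Num.max (- x) 0)%:E)%E = a.
  by rewrite /a normal_prob_pos_neg_part.
pose p g := (\int[P]_w (Num.max (g w) 0)%:E)%E.
have pM (g : T -> R) (h : R -> R) : measurable_wrt G g -> measurable_fun setT h ->
  (\int[P]_w (Num.max (g w) 0 * Num.max (h (X w)) 0)%:E =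
   p g * \int[normal_prob 0 s]_x (Num.max (h x) 0)%:E)%E.
  move=> mg mh.
  by rewrite -(ge0_indep (f := fun w => (Num.max (g w) 0)%:E)
    (h := fun x => (Num.max (h x) 0)%:E))//; [exact: mmax|exact: mmax].
have pos (g : T -> R) : measurable_wrt G g ->
    (\int[P]_w (Num.max (g w * X w) 0)%:E = p g * a + p (fun w => (- g w)%R) * a)%E.
  move=> mg.
  have mg' : measurable_wrt G (fun w => - g w) by exact: measurable_funN.
  have e1 := pM _ id mg (@measurable_id _ _ _).
  have e2 := pM _ -%R mg' (@oppr_measurable _ _).
  rewrite -{2}aE -e1 -e2.
  have mgg : measurable_fun setT g by exact: measurable_wrt_measurable mg.
  rewrite -ge0_integralD//.
  - by apply: eq_integral => w _; rewrite max_mulr_split EFinD.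
  - by move=> w _; rewrite EFinM mule_ge0.
  - by apply/measurable_EFinP; apply: measurable_funM; exact: measurable_maxr.
  - by move=> w _; rewrite EFinM mule_ge0.
  - apply/measurable_EFinP; apply: measurable_funM; apply: measurable_maxr => //.
      exact: measurable_funN.
    exact: measurable_funN.
rewrite /Rintegral integralE.
have -> : (\int[P]_w (fun w => (f w * X w)%:E)^\+ w =
    \int[P]_w (Num.max (f w * X w) 0)%:E)%E.
  by apply: eq_integral => w _; rewrite funeposE -EFin_max.
have -> : (\int[P]_w (fun w => (f w * X w)%:E)^\- w =
    \int[P]_w (Num.max (- f w * X w) 0)%:E)%E.
  by apply: eq_integral => w _; rewrite funenegE -EFinN -EFin_max mulNr.
rewrite (pos f)// (pos (fun w => - f w))//; last exact: measurable_funN.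
rewrite /p; under [X in (_ - (_ + X * _))%E]eq_integral do rewrite opprK.
rewrite [X in (_ - X)%E]addeC subee//.
rewrite -/(p f) -/(p (fun w => - f w)) -pos//.
have := integrable_pos_fin_num measurableT intfX.
congr (_ \is a fin_num).
by apply: eq_integral => w _; rewrite funeposE -EFin_max.
Qed.

Lemma ge0_integral_indep_normal_sqr (f : T -> R) : measurable_wrt G f ->
  (forall w, 0 <= f w) ->
  P.-integrable setT (EFin \o f) ->
  P.-integrable setT (EFin \o (fun w => f w * X w ^+ 2)) /\
  s ^+ 2 / 8 * \int[P]_w f w <= \int[P]_w (f w * X w ^+ 2).
Proof.
move=> mf f0 /integrableP[mf' intf].
have E : (\int[P]_w (f w * X w ^+ 2)%:E =
    (\int[P]_w (f w)%:E) * \int[normal_prob 0 s]_x (x ^+ 2)%:E)%E.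
  under eq_integral do rewrite EFinM.
  apply: (ge0_indep (f := fun w => (f w)%:E) (h := fun x => (x ^+ 2)%:E)) => //.
  - by apply/measurable_EFinP.
  - by apply/measurable_EFinP; exact: measurable_funX.
  - by move=> x; rewrite lee_fin sqr_ge0.
have f0' : (0 <= \int[P]_w (f w)%:E)%E by apply: integral_ge0 => w _; rewrite lee_fin.
have x0' : (0 <= \int[normal_prob 0 s]_x (x ^+ 2)%:E)%E.
  by apply: integral_ge0 => w _; rewrite lee_fin sqr_ge0.
have ffin : (\int[P]_w (f w)%:E)%E \is a fin_num.
  rewrite ge0_fin_numE//; apply: le_lt_trans intf.
  rewrite le_eqVlt; apply/orP; left; apply/eqP.
  by apply: eq_integral => w _; rewrite /= ger0_norm.
have xfin : (\int[normal_prob 0 s]_x (x ^+ 2)%:E)%E \is a fin_num.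
  by rewrite ge0_fin_numE// normal_prob_sqr_lty.
split.
  apply/integrableP; split.
    apply/measurable_EFinP; apply: measurable_funM; last exact: measurable_funX.
    exact/measurable_EFinP.
  rewrite (eq_integral (fun w => (f w * X w ^+ 2)%:E)); last first.
    by move=> w _; rewrite /= ger0_norm// mulr_ge0// sqr_ge0.
  by rewrite E ltey_eq fin_numM.
rewrite /Rintegral E fineM// mulrC ler_wpM2l ?fine_ge0//.
by rewrite -lee_fin fineK// normal_prob_sqr_ge.
Qed.

End normal_independence.

Section negligible_difference.
Context {dsp : measure_display} {T : measurableType dsp} {R : realType}.
Variable P : probability T R.

(** Equality up to a negligible set: the completed filtration contains all measurable null sets, and
    independence must be insensitive to them. *)
Definition eq_mod_null (A B : set T) :=
  P.-negligible ((A `\` B) `|` (B `\` A)).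

Lemma eq_mod_null_measure (A B : set T) : measurable A -> measurable B ->
  eq_mod_null A B -> P A = P B.
Proof.
move=> mA mB AB.
have nAB : P (A `\` B) = 0%E.
  apply: measure_negligible; first exact: measurableD.
  by apply: negligibleS AB => x; left.
have nBA : P (B `\` A) = 0%E.
  apply: measure_negligible; first exact: measurableD.
  by apply: negligibleS AB => x; right.
rewrite (measureDI P mA mB) (measureDI P mB mA) [X in (_ = X + _)%E]nBA.
by rewrite [X in (X + _ = _)%E]nAB setIC.
Qed.

Lemma eq_mod_nullI (A B A' B' : set T) :
  eq_mod_null A A' -> eq_mod_null B B' -> eq_mod_null (A `&` B) (A' `&` B').
Proof.
move=> hA hB; apply: negligibleS (negligibleU hA hB) => x.
case=> -[[h1 h2] h3].
- have [A'x|A'x] := pselect (A' x); last by left; left.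
  by right; left; split=> // B'x; apply: h3.
- have [Ax|Ax] := pselect (A x); last by left; right.
  by right; right; split=> // Bx; apply: h3.
Qed.

Lemma eq_mod_null_refl (A : set T) : eq_mod_null A A.
Proof. by rewrite /eq_mod_null setDv setU0; exact: negligible_set0. Qed.

End negligible_difference.

(** * Moments of Brownian increments against variables known at the earlier time *)

Section brownian_increments.
Context {R : realType} {dsp : measure_display} {Omega : measurableType dsp}.
Variables (P : probability Omega R) (T : R) (d : nat).
Variable W : Omega -> R -> 'rV[R]_d.
Hypothesis W_bm : brownian_motion P T W.

Local Notation F := (completed_filtration P W).

Lemma natural_sigma_measurable t : t <= T -> natural_sigma W t `<=` measurable.
Proof.
move=> tT; apply: g_sigma_measurable => _ [s [i [B [/andP[s0 st] mB ->]]]].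
have := bm_measurable W_bm i (_ : 0 <= s <= T).
rewrite s0 (le_trans st tT) => /(_ isT) /(_ measurableT B mB).
by rewrite setTI.
Qed.

Lemma natural_sigma_mono s t : s <= t -> natural_sigma W s `<=` natural_sigma W t.
Proof.
move=> st; apply: g_sigma_sub => _ [u [i [B [/andP[u0 us] mB ->]]]].
apply: sub_sigma_algebra; exists u, i, B; split => //.
by rewrite u0 (le_trans us).
Qed.

Lemma filtration_generators_measurable t : t <= T ->
  natural_sigma W t `|` [set N | measurable N /\ P N = 0%E] `<=` measurable.
Proof. by move=> tT A [/(natural_sigma_measurable tT)|[]]. Qed.

Lemma filtration_measurable t : t <= T -> F t `<=` measurable.
Proof.
by move=> tT; apply: g_sigma_measurable; exact: filtration_generators_measurable.
Qed.

Lemma filtration_mono s t : s <= t -> F s `<=` <<s F t >>.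
Proof.
move=> st; rewrite sigma_algebra_id; last exact: smallest_sigma_algebra.
apply: g_sigma_sub => A [/(natural_sigma_mono st) h|h]; apply: sub_sigma_algebra.
  by left.
by right.
Qed.

Lemma filtration_id t : <<s F t >> = F t.
Proof. by rewrite sigma_algebra_id//; exact: smallest_sigma_algebra. Qed.

Lemma bm_measurable_wrt t i : 0 <= t -> measurable_wrt (F t) (fun w => W w t ord0 i).
Proof.
move=> t0 _ B mB; rewrite setTI /= [X in X _]filtration_id.
apply: sub_sigma_algebra; left; apply: sub_sigma_algebra.
by exists t, i, B; split => //; rewrite t0 lexx.
Qed.

Section one_increment.
Variables (s t : R) (j : 'I_d).
Hypotheses (s0 : 0 <= s) (st : s < t) (tT : t <= T).

Let X i w := W w t ord0 i - W w s ord0 i.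

(* The pi-system generating the sigma-algebra of the past at time s, the null
   sets and the other coordinates of the increment. *)
Let Pi := [set A : set Omega | measurable A /\
  exists (A' : set Omega) (B : 'I_d -> set R),
    [/\ natural_sigma W s A', forall i, measurable (B i), B j = setT &
      eq_mod_null P A (A' `&` [set w | forall i, B i (X i w)])]].

Let mX i : measurable_fun setT (X i).
Proof.
apply: measurable_funB; apply: (bm_measurable W_bm).
- by rewrite tT (le_trans s0 (ltW st)).
- by rewrite s0 (le_trans (ltW st) tT).
Qed.

Let mXB i B : measurable B -> measurable (X i @^-1` B).
Proof. by move=> mB; rewrite -[X in measurable X]setTI; exact: mX. Qed.

Let mXs (B : 'I_d -> set R) : (forall i, measurable (B i)) ->
  measurable [set w | forall i, B i (X i w)].
Proof.
move=> mB; rewrite (_ : [set w | _] = \bigcap_(i in [set: 'I_d]) (X i @^-1` B i)).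
  by apply: fin_bigcap_measurable => // i _; exact: mXB.
by apply/seteqP; split => [w h i _|w h i]; exact: h.
Qed.

Let sT : s <= T. Proof. exact: le_trans (ltW st) tT. Qed.

Let PiT : Pi setT.
Proof.
split=> //; exists setT, (fun=> setT); split => //.
  exact: (@measurableT _ (g_sigma_algebraType _)).
rewrite (_ : [set w | _] = setT) ?setIT; last by apply/seteqP.
exact: eq_mod_null_refl.
Qed.

Let Pi_measurable : Pi `<=` measurable. Proof. by move=> A []. Qed.

Let PiI : setI_closed Pi.
Proof.
move=> A1 A2 [mA1 [A1' [B1 [sA1 mB1 B1j h1]]]] [mA2 [A2' [B2 [sA2 mB2 B2j h2]]]].
split; first exact: measurableI.
exists (A1' `&` A2'), (fun i => B1 i `&` B2 i); split.
- by apply: (@measurableI _ (g_sigma_algebraType _)).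
- by move=> i; apply: measurableI.
- by rewrite B1j B2j setIT.
- rewrite (_ : A1' `&` A2' `&` _ = A1' `&` [set w | forall i, B1 i (X i w)] `&`
      (A2' `&` [set w | forall i, B2 i (X i w)])); first exact: eq_mod_nullI.
  apply/seteqP; split => [w [[a1 a2] b]|w [[a1 b1] [a2 b2]]]; split => //.
    by split=> // i; have [] := b i.
  by split=> // i; have [] := b i.
Qed.

(** [A] is replaced by its representative; the latter leaves coordinate j unconstrained, so [B] can
    be put in that slot and [bm_increments] applied with and without it. The quotient of the two
    products is the factor for [B]. *)
Let Pi_indep A B : Pi A -> measurable B ->
  (P (A `&` X j @^-1` B) = P A * normal_prob 0 (Num.sqrt (t - s)) B)%E.
Proof.
move=> [mA [A' [C [sA mC Cj AC]]]] mB.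
have mA' : measurable A' by exact: natural_sigma_measurable sA.
have mA'C : measurable (A' `&` [set w | forall i, C i (X i w)]).
  by apply: measurableI => //; exact: mXs.
rewrite (eq_mod_null_measure _ _ (eq_mod_nullI AC (eq_mod_null_refl P (X j @^-1` B)))).
- rewrite (eq_mod_null_measure mA mA'C AC).
  pose C' i := if i == j then B else C i.
  have -> : A' `&` [set w | forall i, C i (X i w)] `&` X j @^-1` B =
      A' `&` [set w | forall i, C' i (X i w)].
    apply/seteqP; split => [w [[a c] b]|w [a c']].
      split=> // i; rewrite /C'; case: eqP => [->//|_]; exact: c.
    split; last by have := c' j; rewrite /C' eqxx.
    split=> // i; have := c' i; rewrite /C'; case: eqP => // ->.
    by rewrite Cj.
  rewrite !(bm_increments W_bm)//; last first.
    by move=> i; rewrite /C'; case: ifP.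
  rewrite -muleA; congr (_ * _)%E.
  rewrite (bigD1 j)//= [in RHS](bigD1 j)//= Cj /C' eqxx probability_setT mul1e.
  rewrite muleC; congr (_ * _)%E.
  by apply: eq_bigr => i /negbTE ->.
- by apply: measurableI => //; exact: mXB.
- by apply: measurableI => //; exact: mXB.
Qed.

Let F_sub_Pi : F s `<=` <<s Pi >>.
Proof.
apply: g_sigma_sub => A [sA|[mN N0]]; apply: sub_sigma_algebra.
- split; first exact: natural_sigma_measurable sA.
  exists A, (fun=> setT); split => //.
  rewrite (_ : [set w | _] = setT) ?setIT; last by apply/seteqP.
  exact: eq_mod_null_refl.
(* A null set is represented by the empty set. *)
- split=> //; exists set0, (fun=> setT); split => //.
    exact: (@measurable0 _ (g_sigma_algebraType _)).
  rewrite set0I /eq_mod_null setD0 set0D setU0.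
  exact/negligibleP.
Qed.

(** The other coordinates of the increment count as past relative to coordinate j. *)
Let X_Pi i : i != j -> measurable_wrt Pi (X i).
Proof.
move=> ij _ B mB; rewrite setTI; apply: sub_sigma_algebra.
split; first exact: mXB.
exists setT, (fun k => if k == i then B else setT); split => //.
- exact: (@measurableT _ (g_sigma_algebraType _)).
- by move=> k; case: ifP.
- by rewrite eq_sym (negbTE ij).
- rewrite (_ : _ `&` _ = X i @^-1` B); first exact: eq_mod_null_refl.
  apply/seteqP; split => [w [_ /(_ i)]|w h]; first by rewrite eqxx.
  by split=> // k; case: eqP => // ->.
Qed.

Let sqrt0 : 0 < Num.sqrt (t - s). Proof. by rewrite sqrtr_gt0 subr_gt0. Qed.

Lemma bm_increment_mean (f : Omega -> R) : measurable_wrt (F s) f ->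
  P.-integrable setT (EFin \o f) ->
  P.-integrable setT (EFin \o (fun w => f w * (W w t ord0 j - W w s ord0 j))) /\
  \int[P]_w (f w * (W w t ord0 j - W w s ord0 j)) = 0.
Proof.
move=> mf intf; have mf' := measurable_wrt_sub F_sub_Pi mf.
split.
  exact: (integrable_indep_normal Pi_measurable PiI PiT (mX j) sqrt0 Pi_indep).
exact: (integral_indep_normal Pi_measurable PiI PiT (mX j) sqrt0 Pi_indep).
Qed.

Lemma bm_increment_sqr (f : Omega -> R) : measurable_wrt (F s) f ->
  (forall w, 0 <= f w) -> P.-integrable setT (EFin \o f) ->
  P.-integrable setT (EFin \o (fun w => f w * (W w t ord0 j - W w s ord0 j) ^+ 2)) /\
  (t - s) / 8 * \int[P]_w f w <=
    \int[P]_w (f w * (W w t ord0 j - W w s ord0 j) ^+ 2).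
Proof.
move=> mf f0 intf; have mf' := measurable_wrt_sub F_sub_Pi mf.
have := ge0_integral_indep_normal_sqr Pi_measurable PiI PiT (mX j) sqrt0 Pi_indep
  mf' f0 intf.
by rewrite sqr_sqrtr// subr_ge0 ltW.
Qed.

(** The product of [f] and the i-th coordinate is measurable for the enlarged past, which is
    independent of the j-th coordinate, so this is again a zero-mean statement. *)
Lemma bm_increment_cross_aux i (f : Omega -> R) : i != j ->
  measurable_wrt (F s) f ->
  P.-integrable setT (EFin \o (fun w => f w * (W w t ord0 i - W w s ord0 i))) ->
  P.-integrable setT (EFin \o (fun w => f w * (W w t ord0 i - W w s ord0 i) *
    (W w t ord0 j - W w s ord0 j))) /\
  \int[P]_w (f w * (W w t ord0 i - W w s ord0 i) *
    (W w t ord0 j - W w s ord0 j)) = 0.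
Proof.
move=> ij mf intf; have mf' := measurable_wrt_sub F_sub_Pi mf.
have mfX : measurable_wrt Pi (fun w => f w * X i w).
  by apply: measurable_funM => //; exact: X_Pi.
split.
  exact: (integrable_indep_normal Pi_measurable PiI PiT (mX j) sqrt0 Pi_indep mfX).
exact: (integral_indep_normal Pi_measurable PiI PiT (mX j) sqrt0 Pi_indep mfX).
Qed.

End one_increment.

Lemma bm_increment_cross s t i j (f : Omega -> R) :
  0 <= s -> s < t -> t <= T -> i != j -> measurable_wrt (F s) f ->
  P.-integrable setT (EFin \o f) ->
  P.-integrable setT (EFin \o (fun w => f w * (W w t ord0 i - W w s ord0 i) *
    (W w t ord0 j - W w s ord0 j))) /\
  \int[P]_w (f w * (W w t ord0 i - W w s ord0 i) *
    (W w t ord0 j - W w s ord0 j)) = 0.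
Proof.
move=> s0 st tT ij mf intf; apply: bm_increment_cross_aux => //.
by have [] := bm_increment_mean i s0 st tT mf intf.
Qed.

End brownian_increments.

(** * The Ito integral *)

Section square_integrable.
Context {dsp : measure_display} {Omega : measurableType dsp} {R : realType}.
Variable P : probability Omega R.
Implicit Types f g : Omega -> R.

Definition sqintegrable f :=
  measurable_fun setT f /\ P.-integrable setT (EFin \o (fun w => f w ^+ 2)).

Lemma Rintegral_sum (I : Type) (r : seq I) (f : I -> Omega -> R) :
  (forall i, P.-integrable setT (EFin \o f i)) ->
  P.-integrable setT (EFin \o (fun w => \sum_(i <- r) f i w)) /\
  \int[P]_w (\sum_(i <- r) f i w) = \sum_(i <- r) \int[P]_w f i w.
Proof.
move=> intf; elim: r => [|i r [IH1 IH2]].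
  rewrite big_nil; split.
    rewrite (_ : _ \o _ = cst 0%E); first exact: integrable0.
    by apply/funext => w /=; rewrite big_nil.
  rewrite (eq_Rintegral P (g := fun=> 0)); last by move=> w _; rewrite big_nil.
  by rewrite Rintegral_cst// mul0r.
have -> : (fun w => \sum_(i0 <- i :: r) f i0 w) =
    (fun w => f i w + \sum_(i0 <- r) f i0 w).
  by apply/funext => w; rewrite big_cons.
split.
  by apply: (integrableD measurableT (intf i) IH1).
by rewrite [RHS]big_cons -IH2 -RintegralD.
Qed.

Lemma le_integrable_real f g : measurable_fun setT f ->
  (forall w, `|f w| <= g w) -> P.-integrable setT (EFin \o g) ->
  P.-integrable setT (EFin \o f).
Proof.
move=> mf fg intg; apply: (le_integrable measurableT _ _ intg).
  exact/measurable_EFinP.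
by move=> w _; rewrite /= lee_fin (le_trans (fg w))// ler_norm.
Qed.

Lemma integrable_bounded f (M : R) : measurable_fun setT f ->
  (forall w, `|f w| <= M) -> P.-integrable setT (EFin \o f).
Proof.
move=> mf fM; apply: (le_integrable_real mf fM).
exact: (finite_measure_integrable_cst P M).
Qed.

Lemma integrable_mul_bounded f g (M : R) : measurable_fun setT f ->
  (forall w, `|f w| <= M) -> P.-integrable setT (EFin \o g) ->
  P.-integrable setT (EFin \o (fun w => f w * g w)).
Proof.
move=> mf fM intg; have mg : measurable_fun setT g.
  by apply/measurable_EFinP; exact: measurable_int intg.
apply: (le_integrable_real (g := fun w => M * `|g w|)).
- exact: measurable_funM.
- by move=> w; rewrite normrM ler_wpM2r.
- rewrite (_ : _ \o _ = fun w => (M%:E * (`|g w|)%:E)%E)//.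
  by apply: integrableZl => //; exact: integrable_norm.
Qed.

Lemma sqintegrable_mul f g : sqintegrable f -> sqintegrable g ->
  P.-integrable setT (EFin \o (fun w => f w * g w)).
Proof.
move=> [mf f2] [mg g2].
apply: (le_integrable_real (g := fun w => f w ^+ 2 + g w ^+ 2)).
- exact: measurable_funM.
- move=> w; rewrite normrM -(real_normK (num_real (f w))) -(real_normK (num_real (g w))).
  have := sqr_ge0 (`|f w| - `|g w|); rewrite sqrrB.
  by have := mulr_ge0 (normr_ge0 (f w)) (normr_ge0 (g w)); lra.
- exact: (integrableD measurableT f2 g2).
Qed.

Lemma sqintegrable_bounded f (M : R) : measurable_fun setT f ->
  (forall w, `|f w| <= M) -> sqintegrable f.
Proof.
move=> mf fM; split => //; apply: (@integrable_bounded _ (M ^+ 2)).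
  exact: measurable_funX.
move=> w; rewrite normrX lerXn2r ?nnegrE//.
exact: le_trans (fM w).
Qed.

Lemma sqintegrable_integrable f : sqintegrable f -> P.-integrable setT (EFin \o f).
Proof.
move=> f2; have h : sqintegrable (fun=> 1).
  by apply: (@sqintegrable_bounded _ 1) => // w; rewrite normr1.
have := sqintegrable_mul f2 h; rewrite (_ : (fun w => f w * 1) = f)//.
by apply/funext => w; rewrite mulr1.
Qed.

Lemma sqintegrable_mul_bounded f g (M : R) : measurable_fun setT f ->
  (forall w, `|f w| <= M) -> sqintegrable g -> sqintegrable (fun w => f w * g w).
Proof.
move=> mf fM [mg g2]; split; first exact: measurable_funM.
rewrite (_ : (fun w => (f w * g w) ^+ 2) = (fun w => f w ^+ 2 * g w ^+ 2)).
  apply: (@integrable_mul_bounded _ _ (M ^+ 2)) => //.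
    exact: measurable_funX.
  by move=> w; rewrite normrX lerXn2r ?nnegrE//; exact: le_trans (fM w).
by apply/funext => w; rewrite exprMn.
Qed.

Lemma sqintegrableD f g : sqintegrable f -> sqintegrable g ->
  sqintegrable (fun w => f w + g w).
Proof.
move=> hf hg; have [mf f2] := hf; have [mg g2] := hg.
split; first exact: measurable_funD.
apply: (le_integrable_real (g := fun w => 2 * f w ^+ 2 + 2 * g w ^+ 2)).
- by apply: measurable_funX; exact: measurable_funD.
- move=> w; rewrite ger0_norm ?sqr_ge0// sqrrD.
  by have := sqr_ge0 (f w - g w); rewrite sqrrB; lra.
- exact: (integrableD measurableT (integrableZl measurableT 2 f2)
    (integrableZl measurableT 2 g2)).
Qed.

Lemma sqintegrableN f : sqintegrable f -> sqintegrable (fun w => - f w).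
Proof.
move=> [mf f2]; split; first exact: measurable_funN.
by rewrite (_ : (fun w => (- f w) ^+ 2) = (fun w => f w ^+ 2))//; apply/funext => w; rewrite sqrrN.
Qed.

Lemma sqintegrableB f g : sqintegrable f -> sqintegrable g ->
  sqintegrable (fun w => f w - g w).
Proof. by move=> hf hg; apply: sqintegrableD => //; exact: sqintegrableN. Qed.

End square_integrable.

Section increment.
Context {R : realType} {dsp : measure_display} {Omega : measurableType dsp}.
Variables (P : probability Omega R) (T : R) (d : nat).
Variable W : Omega -> R -> 'rV[R]_d.
Hypothesis W_bm : brownian_motion P T W.
Local Notation F := (completed_filtration P W).

Variables (a b : R) (v : Omega -> 'rV[R]_d) (M : R).
Hypotheses (a0 : 0 <= a) (ab : a <= b) (bT : b <= T).
Hypothesis vM : a < b -> forall w j, `|v w ord0 j| <= M.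
(** Assumed only for a < b: when a step of a simple process is clamped to a single point, its value
    need not be known at that time, and the increment is then 0. *)
Hypothesis mv : a < b -> forall j, measurable_wrt (F a) (fun w => v w ord0 j).

Let aT : a <= T. Proof. exact: le_trans bT. Qed.
Let D w := dotv (v w) (W w b - W w a).

Let DE w : D w = \sum_(j < d) v w ord0 j * (W w b ord0 j - W w a ord0 j).
Proof. by apply: eq_bigr => j _; rewrite !mxE. Qed.

Let D0 : a = b -> D = fun=> 0.
Proof. by move=> e; apply/funext => w; rewrite /D e subrr dotv0r. Qed.

Let meas (f : Omega -> R) : measurable_wrt (F a) f -> measurable_fun setT f.
Proof. by apply: measurable_wrt_measurable; exact: (filtration_measurable W_bm aT). Qed.

Lemma increment_measurable_wrt : measurable_wrt (F b) D.
Proof.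
have [e|ab'] : a = b \/ a < b by move: ab; rewrite le_eqVlt => /predU1P.
  by rewrite (D0 e); exact: measurable_cst.
rewrite (_ : D = fun w => \sum_(j < d) v w ord0 j * (W w b ord0 j - W w a ord0 j)).
  apply: measurable_sum => j; apply: measurable_funM.
    exact: measurable_wrt_sub (filtration_mono ab) (mv ab' j).
  apply: measurable_funB; first exact: bm_measurable_wrt (le_trans a0 ab).
  have h : measurable_wrt (F b) (fun w => W w a ord0 j).
    exact: measurable_wrt_sub (filtration_mono ab) (bm_measurable_wrt _ a0).
  exact: h.
by apply/funext => w; rewrite DE.
Qed.

Lemma increment_mean psi : measurable_wrt (F a) psi -> sqintegrable P psi ->
  P.-integrable setT (EFin \o (fun w => psi w * D w)) /\
  \int[P]_w (psi w * D w) = 0.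
Proof.
move=> mpsi psi2; have [e|ab'] : a = b \/ a < b.
    by move: ab; rewrite le_eqVlt => /predU1P.
  rewrite (D0 e) (_ : (fun w => psi w * 0) = cst 0); last first.
    by apply/funext => w; rewrite mulr0.
  by split; [exact: integrable0|rewrite Rintegral_cst// mul0r].
have h j : P.-integrable setT (EFin \o (fun w => psi w * v w ord0 j)).
  under eq_fun do rewrite mulrC.
  apply: (integrable_mul_bounded (M := M)); [exact: meas (mv ab' j)|by move=> w; exact: vM|].
  exact: sqintegrable_integrable.
have hj j := bm_increment_mean W_bm j a0 ab' bT
  (measurable_funM mpsi (mv ab' j)) (h j).
have -> : (fun w => psi w * D w) = fun w =>
    \sum_(j < d) psi w * v w ord0 j * (W w b ord0 j - W w a ord0 j).
  apply/funext => w; rewrite DE mulr_sumr; apply: eq_bigr => j _.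
  by rewrite mulrA.
have [I1 I2] := Rintegral_sum (index_enum 'I_d) (fun j => (hj j).1).
by split=> //; rewrite I2 big1// => j _; exact: (hj j).2.
Qed.

(** In the double sum expanding D^2 the off-diagonal terms have expectation 0, and each diagonal
    term is bounded below by the second-moment estimate with factor (b - a) / 8. *)
Lemma increment_sqr (psi : Omega -> R) K : measurable_wrt (F a) psi ->
  (forall w, 0 <= psi w) -> (forall w, `|psi w| <= K) ->
  sqintegrable P D /\
  (b - a) / 8 * \int[P]_w (psi w * sqnormv (v w)) <= \int[P]_w (psi w * D w ^+ 2).
Proof.
move=> mpsi psi0 psiK; have [e|ab'] : a = b \/ a < b.
    by move: ab; rewrite le_eqVlt => /predU1P.
  rewrite (D0 e); split.
    by apply: (@sqintegrable_bounded _ _ _ _ _ 0) => // w; rewrite normr0.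
  rewrite -e subrr !mul0r (_ : (fun w => psi w * 0 ^+ 2) = cst 0).
    by rewrite Rintegral_cst// mul0r.
  by apply/funext => w; rewrite expr0n mulr0.
have M0 (j : 'I_d) (w : Omega) : 0 <= M by exact: le_trans (normr_ge0 _) (vM ab' w j).
(* Used for [psi], and for the constant 1 to obtain the square integrability of [D]. *)
have key (phi : Omega -> R) L : measurable_wrt (F a) phi ->
    (forall w, 0 <= phi w) -> (forall w, `|phi w| <= L) ->
    P.-integrable setT (EFin \o (fun w => phi w * D w ^+ 2)) /\
    (b - a) / 8 * \int[P]_w (phi w * sqnormv (v w)) <= \int[P]_w (phi w * D w ^+ 2).
  move=> mphi phi0 phiL.
  have mp i j : measurable_wrt (F a) (fun w => phi w * v w ord0 i * v w ord0 j).
    by apply: measurable_funM (mv ab' j); apply: measurable_funM (mv ab' i).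
  have ip i j : P.-integrable setT (EFin \o (fun w => phi w * v w ord0 i * v w ord0 j)).
    apply: (@integrable_bounded _ _ _ _ _ (L * M * M)); first exact: meas.
    move=> w; rewrite !normrM ler_pM// ?mulr_ge0//; last exact: vM.
    by rewrite ler_pM//; exact: vM.
  pose dW j w := W w b ord0 j - W w a ord0 j.
  have cross i j : i != j ->
      P.-integrable setT (EFin \o (fun w => phi w * v w ord0 i * v w ord0 j * dW i w * dW j w)) /\
      \int[P]_w (phi w * v w ord0 i * v w ord0 j * dW i w * dW j w) = 0.
    by move=> ij; exact: (bm_increment_cross W_bm a0 ab' bT ij (mp i j) (ip i j)).
  have diag j : P.-integrable setT
        (EFin \o (fun w => phi w * v w ord0 j * v w ord0 j * dW j w * dW j w)) /\
      (b - a) / 8 * \int[P]_w (phi w * v w ord0 j * v w ord0 j) <=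
      \int[P]_w (phi w * v w ord0 j * v w ord0 j * dW j w * dW j w).
    have := bm_increment_sqr W_bm j a0 ab' bT (mp j j) _ (ip j j).
    rewrite (_ : (fun w => _ * _ ^+ 2) =
      (fun w => phi w * v w ord0 j * v w ord0 j * dW j w * dW j w)).
      by apply => w; rewrite -mulrA mulr_ge0// -expr2 sqr_ge0.
    by apply/funext => w; rewrite expr2 mulrA.
  pose t (p : 'I_d * 'I_d) w := phi w * v w ord0 p.1 * v w ord0 p.2 * dW p.1 w * dW p.2 w.
  have it p : P.-integrable setT (EFin \o t p).
    rewrite /t; case: p => i j /=; have [->|ij] := eqVneq i j.
      exact: (diag j).1.
    exact: (cross _ _ ij).1.
  have tE : (fun w => phi w * D w ^+ 2) = (fun w => \sum_p t p w).
    apply/funext => w; rewrite DE expr2 mulr_suml mulr_sumr.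
    rewrite -(pair_bigA _ (fun i j => t (i, j) w))/=; apply: eq_bigr => i _.
    rewrite mulr_sumr mulr_sumr; apply: eq_bigr => j _; rewrite /t /dW /=; ring.
  have [I1 I2] := Rintegral_sum (index_enum ('I_d * 'I_d)%type) it.
  rewrite tE; split=> //; rewrite I2.
  rewrite -(pair_bigA _ (fun i j => \int[P]_w t (i, j) w))/=.
  have nE : (fun w => phi w * sqnormv (v w)) =
      (fun w => \sum_(j < d) phi w * v w ord0 j * v w ord0 j).
    apply/funext => w; rewrite /sqnormv /dotv mulr_sumr.
    by apply: eq_bigr => j _; rewrite mulrA.
  have [_ J2] := Rintegral_sum (index_enum 'I_d) (fun j => ip j j).
  rewrite nE J2 mulr_sumr; apply: ler_sum => i _.
  rewrite (bigD1 i)//= big1 ?addr0; first exact: (diag i).2.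
  by move=> j ji; rewrite (cross i j _).2// eq_sym.
split; last exact: (key psi K mpsi psi0 psiK).2.
split.
  exact: measurable_wrt_measurable (filtration_measurable W_bm bT) increment_measurable_wrt.
have [] := key (fun=> 1) 1 => //.
- exact: measurable_cst.
- by move=> w; rewrite normr1.
- by under eq_fun do rewrite mul1r.
Qed.

End increment.

(** * Integrals of simple processes *)

Section simple_integrals.
Context {R : realType} {dsp : measure_display} {Omega : measurableType dsp}.
Variables (P : probability Omega R) (T : R) (d : nat).
Variable W : Omega -> R -> 'rV[R]_d.
Hypothesis W_bm : brownian_motion P T W.
Local Notation F := (completed_filtration P W).

Variable S : simple_process R Omega d.
Hypothesis S_adapted : simple_adapted T F S.
Variables s u : R.
Hypotheses (s0 : 0 <= s) (su : s <= u) (uT : u <= T).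

Local Notation n := (sp_size S).
Local Notation v := (sp_val S).
(** Projection onto [s, u]: the integral over [s, u] becomes a sum over all steps of [S], those
    outside [s, u] being degenerate. *)
Definition clamp_time x := Num.max s (Num.min x u).
Let a k := clamp_time (sp_time S k).
Let D k w := dotv (v k w) (W w (a k.+1) - W w (a k)).

Let clampE x : clamp_time x = if x <= s then s else if x <= u then x else u.
Proof.
rewrite /clamp_time; have [xs|sx] := leP x s.
  by rewrite (min_l (le_trans xs su)) max_l.
have [xu|ux] := leP x u; first by rewrite max_r// ltW.
by rewrite max_r.
Qed.

Let clamp_ge x : s <= clamp_time x. Proof. by rewrite le_max lexx. Qed.

Let clamp_le x : clamp_time x <= u.
Proof. by rewrite ge_max su ge_min lexx orbT. Qed.

Let clamp_mono x y : x <= y -> clamp_time x <= clamp_time y.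
Proof.
move=> xy; rewrite /clamp_time ge_max !le_max lexx/=; apply/orP; right.
by rewrite le_min !ge_min xy lexx orbT.
Qed.

(** The inequality x <= clamp x fails only for x > u, where the clamped step is degenerate. On a
    nondegenerate step a value known at time x is thus known at the clamped time. *)
Let clamp_lt x y : clamp_time x < clamp_time y -> x <= clamp_time x.
Proof.
rewrite [X in X < _]clampE [X in _ -> _ <= X]clampE.
case: ifPn => // xs; case: ifPn => // xu uy.
by have := lt_le_trans uy (clamp_le y); rewrite ltxx.
Qed.

Let time_le k : (k < n)%N -> a k <= a k.+1.
Proof. by move=> kn; apply: clamp_mono; case: S_adapted => _ _ h _ _; exact: h. Qed.

Let a_ge0 k : 0 <= a k. Proof. exact: le_trans (clamp_ge _). Qed.

Let a_leT k : a k <= T. Proof. exact: le_trans (clamp_le _) uT. Qed.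

Lemma simple_integral_increment w :
  simple_integral W S w u - simple_integral W S w s = \sum_(k < n) D k w.
Proof.
have WE x : W w (Num.min x u) - W w (Num.min x s) = W w (clamp_time x) - W w s.
  rewrite clampE; have [xs|sx] := leP x s.
    by rewrite (min_l (le_trans xs su)) !subrr.
  by have [xu|ux] := leP x u.
rewrite /simple_integral -sumrB; apply: eq_bigr => k _.
rewrite -dotvBr /D; congr dotv.
by rewrite opprD addrACA -opprD !WE opprB addrA subrK.
Qed.

Let v_meas k : (k < n)%N -> a k < a k.+1 ->
  forall j, measurable_wrt (F (a k)) (fun w => v k w ord0 j).
Proof.
move=> kn ak j; case: S_adapted => _ _ _ mv _.
by apply: measurable_wrt_sub (mv k j kn); apply: filtration_mono; exact: clamp_lt ak.
Qed.

Let v_bounded : exists M : R, forall k, (k < n)%N -> forall w j, `|v k w ord0 j| <= M.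
Proof.
by case: S_adapted => _ _ _ _ [M h]; exists M => k kn w j; exact: h.
Qed.

(** The four assertions are proved in one induction: squaring N + D produces the cross term 2 psi N
    D, and its vanishing requires that the partial sum N be square integrable and known at the left
    end of the new step. *)
Lemma simple_partial_sum k : (k <= n)%N -> 
  [/\ measurable_wrt (F (a k)) (fun w => \sum_(i < k) D i w),
    sqintegrable P (fun w => \sum_(i < k) D i w),
    forall (psi : Omega -> R) (M : R), measurable_wrt (F s) psi -> (forall w, `|psi w| <= M) ->
      \int[P]_w (psi w * \sum_(i < k) D i w) = 0 &
    forall (psi : Omega -> R) (M : R), measurable_wrt (F s) psi -> (forall w, 0 <= psi w) ->
      (forall w, `|psi w| <= M) ->
      \sum_(i < k) (a i.+1 - a i) / 8 * \int[P]_w (psi w * sqnormv (v i w)) <=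
      \int[P]_w (psi w * (\sum_(i < k) D i w) ^+ 2) ].
Proof.
have [Mv vM] := v_bounded.
elim: k => [_|k IH kn].
  have E : (fun w => \sum_(i < 0) D i w) = cst 0.
    by apply/funext => w; rewrite big_ord0.
  split.
  - by rewrite E; exact: measurable_cst.
  - by rewrite E; apply: (@sqintegrable_bounded _ _ _ _ _ 0) => // w; rewrite normr0.
  - move=> psi M _ _; rewrite (eq_Rintegral P (g := fun=> 0)).
      by rewrite Rintegral_cst// mul0r.
    by move=> w _; rewrite big_ord0 mulr0.
  - move=> psi M _ psi0 _; rewrite big_ord0 Rintegral_ge0// => w _.
    by rewrite mulr_ge0// sqr_ge0.
have [mN N2 IHm IHs] := IH (ltnW kn).
set N := fun w => \sum_(i < k) D i w in mN N2 IHm IHs.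
have E : (fun w => \sum_(i < k.+1) D i w) = (fun w => N w + D k w).
  by apply/funext => w; rewrite big_ord_recr.
have ak := time_le kn.
have mD : measurable_wrt (F (a k.+1)) (D k).
  exact: (increment_measurable_wrt (a_ge0 k) ak (v_meas kn)).
have Dmean := increment_mean W_bm (a_ge0 k) ak (a_leT k.+1) (fun _ => vM k kn) (v_meas kn).
have Dsqr := increment_sqr W_bm (a_ge0 k) ak (a_leT k.+1) (fun _ => vM k kn) (v_meas kn).
have D2 : sqintegrable P (D k).
  have := Dsqr (fun=> 1) 1 (measurable_cst _) (fun=> ler01) _.
  by case=> // w; rewrite normr1.
have FsFa (psi : Omega -> R) : measurable_wrt (F s) psi -> measurable_wrt (F (a k)) psi.
  by apply: measurable_wrt_sub; apply: filtration_mono; exact: clamp_ge.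
have meas (psi : Omega -> R) : measurable_wrt (F (a k)) psi -> measurable_fun setT psi.
  by apply: measurable_wrt_measurable; exact: (filtration_measurable W_bm (a_leT k)).
split.
- rewrite E; apply: measurable_funD => //.
  exact: measurable_wrt_sub (filtration_mono ak) mN.
- by rewrite E; exact: sqintegrableD.
- move=> psi M mpsi psiM.
  have mpsi' := meas _ (FsFa _ mpsi).
  have psi2 : sqintegrable P psi by exact: sqintegrable_bounded psiM.
  rewrite (eq_Rintegral P (g := fun w => psi w * N w + psi w * D k w)); last first.
    by move=> w _; rewrite big_ord_recr/= mulrDr.
  have [I1 I2] := Dmean _ (FsFa _ mpsi) psi2.
  rewrite RintegralD//; last exact: sqintegrable_mul.
  by rewrite I2 addr0 (IHm _ M).
- move=> psi M mpsi psi0 psiM.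
  have mpsi' := meas _ (FsFa _ mpsi).
  rewrite (eq_Rintegral P (g := fun w => psi w * N w ^+ 2 +
      (2 * (psi w * N w * D k w) + psi w * D k w ^+ 2))); last first.
    move=> w _; rewrite big_ord_recr/= -/(N w) sqrrD mulr2n; ring.
  have psiN2 : sqintegrable P (fun w => psi w * N w).
    exact: sqintegrable_mul_bounded psiM N2.
  have mpsiN : measurable_wrt (F (a k)) (fun w => psi w * N w).
    by apply: measurable_funM (FsFa _ mpsi) mN.
  (* The weight psi N is in general unbounded, which is why the zero-mean lemma is stated for
     square-integrable weights. *)
  have [I1 I2] := Dmean _ mpsiN psiN2.
  have [_ J] := Dsqr psi M (FsFa _ mpsi) psi0 psiM.
  have iN : P.-integrable setT (EFin \o (fun w => psi w * N w ^+ 2)).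
    by apply: (integrable_mul_bounded mpsi' psiM); exact: N2.2.
  have iD : P.-integrable setT (EFin \o (fun w => psi w * D k w ^+ 2)).
    by apply: (integrable_mul_bounded mpsi' psiM); exact: D2.2.
  have i2 := integrableZl measurableT 2 I1.
  rewrite RintegralD//; last exact: (integrableD measurableT i2 iD).
  rewrite RintegralD// RintegralZl// I2 mulr0 add0r big_ord_recr/=.
  by rewrite lerD// (IHs _ M).
Qed.

Lemma simple_integral_sqintegrable :
  sqintegrable P (fun w => simple_integral W S w u - simple_integral W S w s).
Proof.
rewrite (_ : (fun w => _) = (fun w => \sum_(k < n) D k w)).
  by have [] := simple_partial_sum (leqnn n).
by apply/funext => w; exact: simple_integral_increment.
Qed.

Lemma simple_integral_mean (psi : Omega -> R) (M : R) : measurable_wrt (F s) psi ->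
  (forall w, `|psi w| <= M) ->
  \int[P]_w (psi w * (simple_integral W S w u - simple_integral W S w s)) = 0.
Proof.
move=> mpsi psiM.
rewrite (eq_Rintegral P (g := fun w => psi w * \sum_(k < n) D k w)).
  by have [_ _ h _] := simple_partial_sum (leqnn n); exact: h psiM.
by move=> w _; rewrite simple_integral_increment.
Qed.

Let time_mono i j : (i <= j)%N -> (j <= n)%N -> sp_time S i <= sp_time S j.
Proof.
move=> ij; elim: j ij => [|j IH]; first by rewrite leqn0 => /eqP ->.
rewrite leq_eqVlt => /predU1P[->//|]; rewrite ltnS => ij jn.
apply: (le_trans (IH ij (ltnW jn))); case: S_adapted => _ _ h _ _; exact: h.
Qed.

(** The intervals of a simple process are disjoint, so at most one summand is active at time r and
    no cross terms appear. *)
Lemma sqnormv_simple_eval w r : sqnormv (simple_eval S w r) =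
  \sum_(k < n) (if sp_time S k < r <= sp_time S k.+1 then sqnormv (v k w) else 0).
Proof.
rewrite /simple_eval.
have [[k rk]|no] := pselect (exists k : 'I_n, sp_time S k < r <= sp_time S k.+1).
  have other (j : 'I_n) : j != k -> (sp_time S j < r <= sp_time S j.+1) = false.
    move=> jk; apply/negbTE/negP => /andP[j1 j2]; move/andP: rk => [k1 k2].
    move: jk; rewrite -(inj_eq val_inj)/= neq_ltn => /orP[lt|lt].
      have := time_mono lt (ltnW (ltn_ord k)).
      by rewrite leNgt (lt_le_trans k1 j2).
    have := time_mono lt (ltnW (ltn_ord j)).
    by rewrite leNgt (lt_le_trans j1 k2).
  rewrite (bigD1 k)//= rk big1 ?addr0; last by move=> j /other ->.
  by rewrite (bigD1 k)//= rk big1 ?addr0// => j /other ->.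
have other (j : 'I_n) : (sp_time S j < r <= sp_time S j.+1) = false.
  by apply/negbTE/negP => h; apply: no; exists j.
rewrite big1; last by move=> j _; rewrite other.
rewrite big1; last by move=> j _; rewrite other.
by rewrite /sqnormv dotv0r.
Qed.

Local Notation mu := (@lebesgue_measure R).

(** Length of the part of the k-th interval inside [s, u]; it is at most the length of the clamped
    step. *)
Let time_measure k := fine (mu (`]sp_time S k, sp_time S k.+1]%classic `&` `[s, u]%classic)).

Let time_measureE k :
  mu (`]sp_time S k, sp_time S k.+1]%classic `&` `[s, u]%classic) = (time_measure k)%:E.
Proof.
rewrite fineK// ge0_fin_numE//.
apply: (@le_lt_trans _ _ (mu `[s, u]%classic)).
  by apply: le_measure; rewrite ?inE//; apply: measurableI.
by rewrite lebesgue_measure_itv/=; case: ifP => // _; rewrite ltry.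
Qed.

Let time_measure_le k : (k < n)%N -> 0 <= time_measure k <= a k.+1 - a k.
Proof.
move=> kn; rewrite fine_ge0//= -lee_fin -time_measureE.
apply: (@le_trans _ _ (mu `[a k, a k.+1]%classic)).
  apply: le_measure; rewrite ?inE//; first exact: measurableI.
  move=> r [/=]; rewrite !in_itv/= => /andP[r1 r2] /andP[r3 r4].
  by rewrite /a /clamp_time ge_max r3 ge_min (ltW r1)/= le_max le_min r2 r4 orbT.
rewrite lebesgue_measure_itv/= lte_fin; case: ifP => // _.
by rewrite lee_fin subr_ge0 time_le.
Qed.

Let integral_sqnormv_simple_eval w :
  (\int[mu]_(r in `[s, u]) (sqnormv (simple_eval S w r))%:E =
   (\sum_(k < n) time_measure k * sqnormv (v k w))%:E)%E.
Proof.
under eq_integral do rewrite sqnormv_simple_eval -sumEFin.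
rewrite ge0_integral_sum//; last 2 first.
- move=> k; apply/measurable_EFinP.
  rewrite (_ : (fun _ => _) = (fun r => sqnormv (v k w) *
      \1_(`]sp_time S k, sp_time S k.+1]%classic) r)).
    by apply: measurable_funM => //; exact: measurable_indic.
  apply/funext => r; rewrite indicE mem_setE in_itv/=.
  by case: ifP; rewrite ?mulr1 ?mulr0.
- by move=> k r _; case: ifP => //; rewrite lee_fin ?sqnormv_ge0.
rewrite -sumEFin; apply: eq_bigr => k _.
transitivity (\int[mu]_(r in `[s, u]) ((sqnormv (v k w))%:E *
    (\1_(`]sp_time S k, sp_time S k.+1]%classic) r)%:E))%E.
  apply: eq_integral => r _; rewrite indicE mem_setE in_itv/= -EFinM.
  by case: ifP; rewrite ?mulr1 ?mulr0.
rewrite ge0_integralZl//; last 2 first.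
- by apply/measurable_EFinP; exact: measurable_indic.
- by rewrite lee_fin sqnormv_ge0.
by rewrite integral_indic//= time_measureE EFinM muleC.
Qed.

(** The left-hand side is a finite sum of terms [time_measure k] times E[psi |v_k|^2]; the factor 8
    undoes the 1/8 of the second-moment estimate. *)
Lemma simple_isometry_ge (psi : Omega -> R) (M : R) : measurable_wrt (F s) psi ->
  (forall w, 0 <= psi w) -> (forall w, `|psi w| <= M) ->
  (\int[P]_w ((psi w)%:E *
     \int[mu]_(r in `[s, u]) (sqnormv (simple_eval S w r))%:E) <=
   (8 * \int[P]_w (psi w *
     (simple_integral W S w u - simple_integral W S w s) ^+ 2))%:E)%E.
Proof.
move=> mpsi psi0 psiM.
have [Mv vM] := v_bounded.
have mpsi' : measurable_fun setT psi.
  apply: measurable_wrt_measurable mpsi; apply: (filtration_measurable W_bm).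
  exact: le_trans su uT.
have vmeas (k : 'I_n) j : measurable_fun setT (fun w => v k w ord0 j).
  case: S_adapted => _ tn _ mv _; apply: measurable_wrt_measurable (mv k j (ltn_ord k)).
  apply: (filtration_measurable W_bm); rewrite -tn.
  by apply: time_mono => //; exact: ltnW (ltn_ord k).
have iv (k : 'I_n) : P.-integrable setT (EFin \o (fun w => psi w * sqnormv (v k w))).
  apply: (@integrable_mul_bounded _ _ _ _ _ _ M) => //.
  apply: (@integrable_bounded _ _ _ _ _ (\sum_(j < d) Mv ^+ 2)).
    by apply: measurable_sum => j; exact: measurable_funM.
  move=> w; rewrite ger0_norm ?sqnormv_ge0//; apply: ler_sum => j _.
  rewrite -expr2 -real_normK ?num_real// lerXn2r ?nnegrE ?vM//.
  exact: le_trans (normr_ge0 _) (vM k (ltn_ord k) w j).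
pose h (k : 'I_n) w := time_measure k * (psi w * sqnormv (v k w)).
have ih k : P.-integrable setT (EFin \o h k).
  exact: (integrableZl measurableT _ (iv k)).
have [I1 I2] := Rintegral_sum (index_enum 'I_n) ih.
rewrite (eq_integral (fun w => (\sum_(k < n) h k w)%:E)); last first.
  move=> w _; rewrite integral_sqnormv_simple_eval -EFinM mulr_sumr.
  by congr EFin; apply: eq_bigr => k _; rewrite /h mulrCA.
rewrite -[X in (X <= _)%E]fineK; last exact: (integrable_fin_num measurableT I1).
rewrite lee_fin -/(Rintegral _ _ _) I2.
have [_ _ _ /(_ psi M mpsi psi0 psiM)] := simple_partial_sum (leqnn n).
rewrite (eq_Rintegral P (g := fun w => psi w *
    (simple_integral W S w u - simple_integral W S w s) ^+ 2)); last first.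
  by move=> w _; rewrite simple_integral_increment.
set X := Rintegral _ _ _ => XE.
apply: (@le_trans _ _ (8 * \sum_(i < n) (a i.+1 - a i) / 8 *
    \int[P]_w (psi w * sqnormv (v i w)))); last by rewrite ler_pM2l.
rewrite mulr_sumr; apply: ler_sum => k _.
rewrite RintegralZl// mulrA (mulrC 8) divfK// ler_wpM2r//.
  by apply: Rintegral_ge0 => w _; rewrite mulr_ge0// sqnormv_ge0.
by have /andP[] := time_measure_le (ltn_ord k).
Qed.

End simple_integrals.

(** * Joint measurability in (w, t) *)

Section joint_measurability.
Context {R : realType} {dsp : measure_display} {Omega : measurableType dsp}.
Variable T : R.
Local Notation mu := (@lebesgue_measure R).
Implicit Types X Y : Omega -> R -> R.

Definition jointly_measurable X :=
  measurable_fun (setT `*` `[0, T]%classic)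
    (fun p : Omega * measurableTypeR R => X p.1 p.2).

Let mdom : measurable (setT `*` `[0, T]%classic : set (Omega * measurableTypeR R)).
Proof. by apply: measurableX => //; exact: measurable_itv. Qed.

Lemma progressive_jointly_measurable (F : R -> set (set Omega)) X : 0 <= T ->
  F T `<=` measurable -> progressive T F X -> jointly_measurable X.
Proof.
move=> T0 FT pX; have := pX T; rewrite T0 lexx => /(_ isT) mX.
have mid : measurable_fun (setT `*` `[0, T]%classic)
    (fun p : Omega * measurableTypeR R =>
      (p.1, p.2) : g_sigma_algebraType (F T) * measurableTypeR R).
  apply: measurable_funTS; apply: measurable_fun_pair => //.
  have mid0 : measurable_fun setT (idfun : Omega -> g_sigma_algebraType (F T)).
    by move=> _ B mB; rewrite setTI; exact: (g_sigma_measurable FT mB).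
  exact: (measurableT_comp mid0 measurable_fst).
apply: (measurable_comp _ _ mX mid).
  by apply: measurableX => //; exact: measurable_itv.
by move=> _ [p [_ p2] <-]; split.
Qed.

Variables s u : R.
Hypotheses (s0 : 0 <= s) (uT : u <= T).

Let sub_itv r : s <= r <= u -> 0 <= r <= T.
Proof. by move=> /andP[sr ru]; rewrite (le_trans s0)//= (le_trans ru). Qed.

Lemma jointly_measurable_section X w : jointly_measurable X ->
  measurable_fun `[s, u]%classic (X w).
Proof.
move=> mX.
apply: (@measurable_comp _ _ _ _ _ _ (setT `*` `[0, T]%classic)
  (fun p : Omega * measurableTypeR R => X p.1 p.2) _ (fun r => (w, r))) => //.
- by move=> _ [r /= rsu <-]; split => //=; rewrite in_itv/=; apply: sub_itv.
- by apply: measurable_funTS; exact: pair1_measurable.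
Qed.

(** Extending [X] by 0 outside the strip [s, u] makes it measurable on the whole product, where
    Tonelli's theorem gives measurability in w. *)
Lemma jointly_measurable_integral X : (forall w r, 0 <= X w r) ->
  jointly_measurable X ->
  measurable_fun setT (fun w => \int[mu]_(r in `[s, u]) (X w r)%:E)%E.
Proof.
move=> X0 mX.
pose f (p : Omega * measurableTypeR R) :=
  ((EFin \o (fun p : Omega * measurableTypeR R => X p.1 p.2)) \_ (setT `*` `[s, u]%classic)) p.
have mD : measurable (setT `*` `[s, u]%classic : set (Omega * measurableTypeR R)).
  by apply: measurableX => //; exact: measurable_itv.
have mf : measurable_fun setT f.
  apply/(measurable_restrictT _ mD); apply/measurable_EFinP.
  apply: measurable_funS mX => // p [_ /= h]; split => //.
  by move: h; rewrite /= !in_itv/=; exact: sub_itv.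
have f0 p : (0 <= f p)%E.
  by rewrite /f patchE; case: ifP => // _; rewrite lee_fin.
rewrite (_ : (fun w => _) = fubini_F mu f).
  exact: measurable_fun_fubini_tonelli_F.
apply/funext => w; rewrite /fubini_F [LHS]integral_mkcond; apply: eq_integral => r _.
rewrite /f !patchE; congr (if _ then _ else _).
by apply/idP/idP; rewrite !inE; [split|case].
Qed.

End joint_measurability.

Section ito.
Context {R : realType} {dsp : measure_display} {Omega : measurableType dsp}.
Variables (P : probability Omega R) (T : R) (d : nat).
Variable W : Omega -> R -> 'rV[R]_d.
Hypotheses (T0 : 0 <= T) (W_bm : brownian_motion P T W).
Local Notation F := (completed_filtration P W).
Local Notation mu := (@lebesgue_measure R).

Lemma progressive_vec_sqnormv_measurable (Z : Omega -> R -> 'rV[R]_d) :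
  progressive_vec T F Z -> jointly_measurable T (fun w r => sqnormv (Z w r)).
Proof.
move=> pZ; apply: measurable_sum => i.
have mZ := progressive_jointly_measurable T0 (filtration_measurable W_bm (lexx T)) (pZ i).
exact: measurable_funM.
Qed.

Lemma simple_eval_measurable (S : simple_process R Omega d) (Z : Omega -> R -> 'rV[R]_d) :
  simple_adapted T F S -> progressive_vec T F Z ->
  jointly_measurable T (fun w r => sqnormv (Z w r - simple_eval S w r)).
Proof.
move=> [t0 tn tm mv _] pZ; apply: measurable_sum => i.
have mZ := progressive_jointly_measurable T0 (filtration_measurable W_bm (lexx T)) (pZ i).
have tT j : (j <= sp_size S)%N -> sp_time S j <= T.
  move=> jn; rewrite -tn; elim: (sp_size S) jn tm => [|m IH jm tm].
    by rewrite leqn0 => /eqP ->.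
  move: jm; rewrite leq_eqVlt => /predU1P[->//|]; rewrite ltnS => jm.
  apply: (le_trans (IH jm _)) (tm m _) => //.
  by move=> k km; apply: tm; exact: ltnW.
have mS : measurable_fun (setT `*` `[0, T]%classic)
    (fun p : Omega * measurableTypeR R => simple_eval S p.1 p.2 ord0 i).
  apply: measurable_funTS.
  rewrite (_ : (fun _ => _) = (fun p : Omega * measurableTypeR R =>
    \sum_(k < sp_size S) (sp_val S k p.1 ord0 i *
      \1_(`]sp_time S k, sp_time S k.+1]%classic) p.2))).
    apply: measurable_sum => k; apply: measurable_funM.
      apply: (@measurableT_comp _ _ _ _ _ _ (fun w => sp_val S k w ord0 i));
        last exact: measurable_fst.
      apply: measurable_wrt_measurable (mv k i (ltn_ord k)).
      by apply: (filtration_measurable W_bm); apply: tT; exact: ltnW (ltn_ord k).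
    have mI : measurable_fun [set: measurableTypeR R]
        (\1_(`]sp_time S k, sp_time S k.+1]%classic) : R -> R).
      by apply: measurable_indic; exact: measurable_itv.
    exact: (measurableT_comp mI measurable_snd).
  apply/funext => p; rewrite /simple_eval summxE; apply: eq_bigr => k _.
  rewrite indicE mem_setE in_itv/=; case: ifP => _; first by rewrite mulr1.
  by rewrite mxE mulr0.
have mB : measurable_fun (setT `*` `[0, T]%classic)
    (fun p : Omega * measurableTypeR R => Z p.1 p.2 ord0 i - simple_eval S p.1 p.2 ord0 i).
  exact: measurable_funB.
rewrite (_ : (fun _ => _) = (fun p : Omega * measurableTypeR R =>
  (Z p.1 p.2 ord0 i - simple_eval S p.1 p.2 ord0 i) *
  (Z p.1 p.2 ord0 i - simple_eval S p.1 p.2 ord0 i))).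
  exact: measurable_funM.
by apply/funext => p; rewrite !mxE.
Qed.

End ito.

(** * From simple integrands to Z *)

Section ito_isometry.
Context {R : realType} {dsp : measure_display} {Omega : measurableType dsp}.
Variables (P : probability Omega R) (T : R) (d : nat).
Variable W : Omega -> R -> 'rV[R]_d.
Hypotheses (T0 : 0 <= T) (W_bm : brownian_motion P T W).
Local Notation F := (completed_filtration P W).
Local Notation mu := (@lebesgue_measure R).
Variables (Z : Omega -> R -> 'rV[R]_d) (I : Omega -> R -> R).
Hypotheses (pZ : progressive_vec T F Z) (hI : ito_integral P T W Z I).

Lemma sqrB_le (p q : R) : (p - q) ^+ 2 <= 2 * p ^+ 2 + 2 * q ^+ 2.
Proof. by have := sqr_ge0 (p + q); rewrite sqrrB sqrrD; lra. Qed.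

Lemma cvge0_near (a : nat -> \bar R) (e : R) : 0 < e -> a @ \oo --> 0%E ->
  \forall n \near \oo, (a n < e%:E)%E.
Proof.
move=> e0 a0; apply: (a0 (fun y => (y < e%:E)%E)).
apply/nbhs_EFin; have := lt_nbhsl e0.
by apply: filterS => x; rewrite lte_fin.
Qed.

Lemma sqintegrable_lty (f : Omega -> R) : measurable_fun setT f ->
  (\int[P]_w (f w ^+ 2)%:E < +oo)%E -> sqintegrable P f.
Proof.
move=> mf f2; split=> //; apply/integrableP; split.
  by apply/measurable_EFinP; exact: measurable_funX.
by under eq_integral do rewrite /= ger0_norm ?sqr_ge0//.
Qed.

Lemma sqintegrable_EFin (f : Omega -> R) : sqintegrable P f ->
  ((\int[P]_w (f w ^+ 2))%:E = \int[P]_w (f w ^+ 2)%:E)%E.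
Proof.
move=> [_ f2]; rewrite fineK//; exact: (integrable_fin_num measurableT f2).
Qed.

(** One simple process serves both endpoints: [x] is the error at u minus the error at s, each of
    second moment below e/4, so that E x^2 <= 2 (e/4) + 2 (e/4) = e. *)
Lemma ito_approx s u (e : R) : 0 <= s -> s <= u -> u <= T -> 0 < e ->
  exists S : simple_process R Omega d, exists x : Omega -> R,
  [/\ simple_adapted T F S,
    (energy P T (fun w r => (Z w r - simple_eval S w r)%R) <= e%:E)%E,
    sqintegrable P x,
    \int[P]_w (x w ^+ 2) <= e &
    forall w, I w u - I w s =
      simple_integral W S w u - simple_integral W S w s + x w].
Proof.
move=> s0 su uT e0; have [mI _ [S [aS cZ cI]]] := hI.
have u0 : 0 <= u by exact: le_trans su.
have sT : s <= T by exact: le_trans uT.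
have e40 : 0 < e / 4 by rewrite divr_gt0.
have e4 : 2 * (e / 4) + 2 * (e / 4) <= e by lra.
have su01 : 0 <= s <= T by rewrite s0.
have uu01 : 0 <= u <= T by rewrite u0.
have [n [cZn [cun csn]]] : exists n,
  (energy P T (fun w r => (Z w r - simple_eval (S n) w r)%R) < e%:E)%E /\
  ((\int[P]_w ((I w u - simple_integral W (S n) w u) ^+ 2)%R%:E < (e / 4)%:E)%E /\
  (\int[P]_w ((I w s - simple_integral W (S n) w s) ^+ 2)%R%:E < (e / 4)%:E)%E).
  have h1 := cvge0_near e0 cZ.
  have h2 := cvge0_near e40 (cI u uu01).
  have h3 := cvge0_near e40 (cI s su01).
  have [n _ hn] := filterI h1 (filterI h2 h3).
  have [h1n [h2n h3n]] := hn n (leqnn n).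
  by exists n; split; [exact: h1n|split; [exact: h2n|exact: h3n]].
pose J t w := simple_integral W (S n) w t.
(* Since the simple integral vanishes at time 0, its value at t is the increment over [0, t]. *)
have J2 t : 0 <= t <= T -> sqintegrable P (J t).
  move=> /andP[t0 tT].
  rewrite (_ : J t = (fun w => J t w - J 0 w)).
    exact: (simple_integral_sqintegrable W_bm (aS n) (lexx 0) t0 tT).
  apply/funext => w; rewrite [J 0 w]big1 ?subr0// => i _.
  have [tau0 taun taum _ _] := aS n.
  have tau_ge0 k : (k <= sp_size (S n))%N -> 0 <= sp_time (S n) k.
    elim: k => [|k IH kn]; first by rewrite tau0.
    exact: le_trans (IH (ltnW kn)) (taum k kn).
  rewrite !min_r ?tau_ge0 ?subrr ?dotv0r//.
  exact: ltnW.
(* [I] is known only through its approximations: the error is square integrable because its second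
   moment was just bounded. *)
have dI2 t : 0 <= t <= T ->
    (\int[P]_w ((I w t - simple_integral W (S n) w t) ^+ 2)%R%:E < (e / 4)%:E)%E ->
    sqintegrable P (fun w => I w t - J t w).
  move=> t01 h; apply: sqintegrable_lty; last exact: lt_trans h (ltry _).
  apply: measurable_funB; last by have [] := J2 t t01.
  apply: measurable_wrt_measurable (mI t t01).
  by apply: (filtration_measurable W_bm); have /andP[] := t01.
have xu := dI2 u uu01 cun; have xs := dI2 s su01 csn.
exists (S n), (fun w => (I w u - J u w) - (I w s - J s w)); split => //.
- exact: ltW.
- exact: sqintegrableB.
- have hu : \int[P]_w ((I w u - J u w) ^+ 2) <= e / 4.
    by rewrite -lee_fin (sqintegrable_EFin xu); exact: ltW cun.
  have hs : \int[P]_w ((I w s - J s w) ^+ 2) <= e / 4.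
    by rewrite -lee_fin (sqintegrable_EFin xs); exact: ltW csn.
  apply: (@le_trans _ _ (\int[P]_w (2 * (I w u - J u w) ^+ 2 + 2 * (I w s - J s w) ^+ 2))).
    apply: le_Rintegral => //; first by have [] := sqintegrableB xu xs.
      exact: (integrableD measurableT (integrableZl measurableT 2 xu.2)
        (integrableZl measurableT 2 xs.2)).
    by move=> w _; exact: sqrB_le.
  rewrite RintegralD//; [|exact: (integrableZl measurableT 2 xu.2)
    |exact: (integrableZl measurableT 2 xs.2)].
  rewrite RintegralZl//; last exact: xu.2.
  rewrite RintegralZl//; last exact: xs.2.
  apply: (@le_trans _ _ (2 * (e / 4) + 2 * (e / 4))); last exact: e4.
  apply: lerD; apply: ler_wpM2l; [exact: ler0n|exact: hu|exact: ler0n|exact: hs].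
- by move=> w; rewrite /J; lra.
Qed.

Lemma ito_sqintegrable s u : 0 <= s -> s <= u -> u <= T ->
  sqintegrable P (fun w => I w u - I w s).
Proof.
move=> s0 su uT; have [S [x [aS _ x2 _ E]]] := ito_approx s0 su uT ltr01.
rewrite (_ : (fun w => _) = (fun w => simple_integral W S w u -
  simple_integral W S w s + x w)); last by apply/funext => w; rewrite E.
apply: sqintegrableD => //; exact: (simple_integral_sqintegrable W_bm aS s0 su uT).
Qed.

Variables (s u : R).
Hypotheses (s0 : 0 <= s) (su : s <= u) (uT : u <= T).
Variables (psi : Omega -> R) (M : R).
Hypotheses (mpsi : measurable_wrt (F s) psi) (psiM : forall w, `|psi w| <= M).

Let mpsi' : measurable_fun setT psi.
Proof.
apply: measurable_wrt_measurable mpsi; apply: (filtration_measurable W_bm).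
exact: le_trans su uT.
Qed.

Let M0 : 0 <= M.
Proof. exact: le_trans (normr_ge0 _) (psiM point). Qed.

(** Exact for simple integrands; the error contributes |E[psi x]| <= M E|x|, which is made
    arbitrarily small. *)
Lemma ito_mean : \int[P]_w (psi w * (I w u - I w s)) = 0.
Proof.
have dI2 := ito_sqintegrable s0 su uT.
suff small (e : R) : 0 < e -> `|\int[P]_w (psi w * (I w u - I w s))| <= M * e.
  apply/eqP; rewrite -normr_le0; apply/ler_addgt0Pr => e e0; rewrite add0r.
  have M1 : 0 < M + 1 by rewrite ltr_wpDl.
  apply: (le_trans (small (e / (M + 1)) (divr_gt0 e0 M1))).
  by rewrite mulrCA ger_pMr// ler_pdivrMr// mul1r lerDl.
(* With E x^2 <= e^2, the inequality |x| <= (e + x^2 / e) / 2 gives E|x| <= e. *)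
move=> e0; have [S [x [aS _ x2 xe E]]] := ito_approx s0 su uT (exprn_gt0 2 e0).
have J2 := simple_integral_sqintegrable W_bm aS s0 su uT.
have intJ : P.-integrable setT (EFin \o (fun w => psi w *
    (simple_integral W S w u - simple_integral W S w s))).
  by apply: (integrable_mul_bounded mpsi' psiM); exact: sqintegrable_integrable.
have intx : P.-integrable setT (EFin \o (fun w => psi w * x w)).
  by apply: (integrable_mul_bounded mpsi' psiM); exact: sqintegrable_integrable.
rewrite (eq_Rintegral P (g := fun w => psi w *
    (simple_integral W S w u - simple_integral W S w s) + psi w * x w)); last first.
  by move=> w _; rewrite E mulrDr.
rewrite RintegralD//.
rewrite (simple_integral_mean W_bm aS s0 su uT mpsi psiM) add0r.
apply: (le_trans (le_normr_Rintegral measurableT intx)).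
have i1 : P.-integrable setT (EFin \o (fun w => x w ^+ 2 / e)).
  rewrite (_ : (fun w => _) = (fun w => e^-1 * x w ^+ 2)).
    exact: (integrableZl measurableT _ x2.2).
  by apply/funext => w; rewrite mulrC.
have i2 : P.-integrable setT (EFin \o (fun=> e : R)) :=
  finite_measure_integrable_cst P e measurableT.
have i3 := integrableD measurableT i2 i1.
apply: (@le_trans _ _ (\int[P]_w (M / 2 * (e + x w ^+ 2 / e)))).
  apply: le_Rintegral => //.
  - exact: integrable_norm.
  - exact: (integrableZl measurableT _ i3).
  move=> w _; rewrite normrM.
  apply: (le_trans (ler_wpM2r (normr_ge0 _) (psiM w))).
  rewrite -mulrA ler_wpM2l// -(@ler_pM2l _ (2 * e)) ?mulr_gt0//.
  have -> : 2 * e * (2^-1 * (e + x w ^+ 2 / e)) = e ^+ 2 + x w ^+ 2.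
    by field; rewrite gt_eqF.
  rewrite -[x w ^+ 2]real_normK ?num_real//.
  by have := sqr_ge0 (e - `|x w|); rewrite sqrrB; lra.
rewrite RintegralZl// RintegralD// Rintegral_cst//= probability_setT mulr1.
rewrite (eq_Rintegral P (g := fun w => e^-1 * x w ^+ 2)); last first.
  by move=> w _; rewrite mulrC.
rewrite RintegralZl//; last exact: x2.2.
have h : e^-1 * \int[P]_w (x w ^+ 2) <= e.
  by rewrite mulrC ler_pdivrMr// -expr2.
have : M / 2 * (e + e^-1 * \int[P]_w (x w ^+ 2)) <= M / 2 * (e + e).
  by rewrite ler_wpM2l ?divr_ge0// lerD2l.
by move=> /le_trans; apply; lra.
Qed.

Hypothesis psi0 : forall w, 0 <= psi w.

(** The simple estimate has factor 8; |Z|^2 <= 2 |S|^2 + 2 |Z - S|^2 and dJ^2 <= 2 dI^2 + 2 x^2 give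
    2 * 8 * 2 = 32. The errors add up to 32 M e from x and 2 M e from Z - S, hence 34 M e. *)
Lemma ito_isometry_ge :
  (\int[P]_w ((psi w)%:E * \int[mu]_(r in `[s, u]) (sqnormv (Z w r))%:E) <=
   (32 * \int[P]_w (psi w * (I w u - I w s) ^+ 2))%:E)%E.
Proof.
have dI2 := ito_sqintegrable s0 su uT.
have idI : P.-integrable setT (EFin \o (fun w => psi w * (I w u - I w s) ^+ 2)).
  by apply: (integrable_mul_bounded mpsi' psiM); exact: dI2.2.
suff small (e : R) : 0 < e ->
    (\int[P]_w ((psi w)%:E * \int[mu]_(r in `[s, u]) (sqnormv (Z w r))%:E) <=
   (32 * \int[P]_w (psi w * (I w u - I w s) ^+ 2) + M * 34 * e)%:E)%E.
  apply/lee_addgt0Pr => e e0; rewrite -EFinD.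
  have M1 : 0 < M * 34 + 1 by rewrite ltr_wpDl// mulr_ge0.
  apply: (le_trans (small (e / (M * 34 + 1)) (divr_gt0 e0 M1))).
  by rewrite lee_fin lerD2l mulrCA ger_pMr// ler_pdivrMr// mul1r lerDl.
move=> e0; have [S [x [aS Ze x2 xe E]]] := ito_approx s0 su uT e0.
have J2 := simple_integral_sqintegrable W_bm aS s0 su uT.
have iso := simple_isometry_ge W_bm aS s0 su uT mpsi psi0 psiM.
set dJ := fun w => simple_integral W S w u - simple_integral W S w s in J2 iso E.
have jZ := progressive_vec_sqnormv_measurable T0 W_bm pZ.
have jZS := simple_eval_measurable T0 W_bm aS pZ.
have jS : jointly_measurable T (fun w r => sqnormv (simple_eval S w r)).
  have := simple_eval_measurable T0 W_bm aS (Z := fun _ _ => 0) _.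
  rewrite (_ : (fun w r => sqnormv (0 - simple_eval S w r)) =
    (fun w r => sqnormv (simple_eval S w r))).
    by apply=> i t _; exact: measurable_cst.
  by apply/funext => w; apply/funext => r; rewrite sub0r sqnormvN.
have iE (X : Omega -> R -> 'rV[R]_d) w :
    (0 <= \int[mu]_(r in `[s, u]) (sqnormv (X w r))%:E)%E.
  by apply: integral_ge0 => r _; rewrite lee_fin sqnormv_ge0.
have mi (X : Omega -> R -> 'rV[R]_d) :
    jointly_measurable T (fun w r => sqnormv (X w r)) ->
    measurable_fun setT (fun w => \int[mu]_(r in `[s, u]) (sqnormv (X w r))%:E)%E.
  by apply: jointly_measurable_integral => // w r; exact: sqnormv_ge0.
have mpsiE : measurable_fun setT (EFin \o psi) by exact/measurable_EFinP.
pose ZS w r := Z w r - simple_eval S w r.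
have mZ := mi Z jZ; have mS := mi (simple_eval S) jS; have mZS := mi ZS jZS.
have split w : (\int[mu]_(r in `[s, u]) (sqnormv (Z w r))%:E <=
    2%:E * \int[mu]_(r in `[s, u]) (sqnormv (simple_eval S w r))%:E +
    2%:E * \int[mu]_(r in `[s, u]) (sqnormv (ZS w r))%:E)%E.
  have sec (X : Omega -> R -> 'rV[R]_d) :
      jointly_measurable T (fun w r => sqnormv (X w r)) ->
      measurable_fun `[s, u]%classic (fun r => (sqnormv (X w r))%:E).
    by move=> jX; apply/measurable_EFinP; exact: (jointly_measurable_section s0 uT w jX).
  have sS := sec _ jS; have sZS := sec ZS jZS; have sZ := sec Z jZ.
  rewrite -!ge0_integralZl//; last 2 first.
  - by move=> r _; rewrite lee_fin sqnormv_ge0.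
  - by move=> r _; rewrite lee_fin sqnormv_ge0.
  rewrite -ge0_integralD//; last 4 first.
  - by move=> r _; rewrite -EFinM lee_fin mulr_ge0 ?sqnormv_ge0.
  - exact: measurable_funeM.
  - by move=> r _; rewrite -EFinM lee_fin mulr_ge0 ?sqnormv_ge0.
  - exact: measurable_funeM.
  apply: ge0_le_integral => //.
  - by move=> r _; rewrite lee_fin sqnormv_ge0.
  - by apply: emeasurable_funD; exact: measurable_funeM.
  move=> r _; rewrite -!EFinM -EFinD lee_fin.
  by rewrite -[in leLHS](subrK (simple_eval S w r) (Z w r)) addrC sqnormvD_le.
have psiE0 w : (0 <= (psi w)%:E)%E by rewrite lee_fin.
pose iS w := (\int[mu]_(r in `[s, u]) (sqnormv (simple_eval S w r))%:E)%E.
pose iZS w := (\int[mu]_(r in `[s, u]) (sqnormv (ZS w r))%:E)%E.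
have iS0 w : (0 <= iS w)%E by exact: iE.
have iZS0 w : (0 <= iZS w)%E by exact: (iE ZS).
have mpS : measurable_fun setT (fun w => (psi w)%:E * iS w)%E by exact: emeasurable_funM.
have mpZS : measurable_fun setT (fun w => (psi w)%:E * iZS w)%E by exact: emeasurable_funM.
apply: (@le_trans _ _ (\int[P]_w (2%:E * ((psi w)%:E * iS w) +
    2%:E * ((psi w)%:E * iZS w)))%E).
  apply: ge0_le_integral => //.
  - by move=> w _; apply: mule_ge0.
  - exact: emeasurable_funM.
  - by apply: emeasurable_funD; exact: measurable_funeM.
  move=> w _; apply: (le_trans (lee_wpmul2l (psiE0 w) (split w))).
  rewrite ge0_muleDr ?mule_ge0//.
  by rewrite muleCA [X in (_ + X <= _)%E]muleCA.
rewrite ge0_integralD//; last 4 first.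
- by move=> w _; rewrite !mule_ge0// lee_fin.
- exact: measurable_funeM.
- by move=> w _; rewrite !mule_ge0// lee_fin.
- exact: measurable_funeM.
rewrite !ge0_integralZl//; last 2 first.
- by move=> w _; rewrite mule_ge0.
- by move=> w _; rewrite mule_ge0.
(* [psi] is at most M, and the integral over [s, u] is at most that over [0, T], whose expectation
   is the energy of the approximation error. *)
have hZS : (\int[P]_w ((psi w)%:E * iZS w) <= (M * e)%:E)%E.
  apply: (@le_trans _ _ (M%:E * energy P T ZS)%E); last first.
    by rewrite EFinM lee_wpmul2l// lee_fin.
  have miT : measurable_fun setT
      (fun w => \int[mu]_(r in `[0%R, T]) (sqnormv (ZS w r))%:E)%E.
    by apply: jointly_measurable_integral => // w r; exact: sqnormv_ge0.
  have iT0 w : (0 <= \int[mu]_(r in `[0%R, T]) (sqnormv (ZS w r))%:E)%E.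
    by apply: integral_ge0 => r _; rewrite lee_fin sqnormv_ge0.
  have -> : (M%:E * energy P T ZS = \int[P]_w (M%:E *
      \int[mu]_(r in `[0%R, T]) (sqnormv (ZS w r))%:E))%E.
    by rewrite ge0_integralZl.
  apply: ge0_le_integral => //.
  - by move=> w _; rewrite mule_ge0.
  - exact: measurable_funeM.
  move=> w _; apply: lee_pmul => //.
    by rewrite lee_fin (le_trans (ler_norm _)).
  apply: ge0_subset_integral => //.
  - apply/measurable_EFinP; exact: (jointly_measurable_section (lexx 0) (lexx T) w jZS).
  - by move=> r _; rewrite lee_fin sqnormv_ge0.
  - move=> r /=; rewrite !in_itv/= => /andP[sr ru].
    by rewrite (le_trans s0 sr) (le_trans ru uT).
apply: (le_trans (leeD (lee_wpmul2l _ iso) (lee_wpmul2l _ hZS))); rewrite ?lee_fin//.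
have ix : P.-integrable setT (EFin \o (fun w => psi w * x w ^+ 2)).
  by apply: (integrable_mul_bounded mpsi' psiM); exact: x2.2.
have iJ : P.-integrable setT (EFin \o (fun w => psi w * dJ w ^+ 2)).
  by apply: (integrable_mul_bounded mpsi' psiM); exact: J2.2.
have hx : \int[P]_w (psi w * x w ^+ 2) <= M * e.
  apply: (@le_trans _ _ (\int[P]_w (M * x w ^+ 2))).
    apply: le_Rintegral => //; first exact: (integrableZl measurableT _ x2.2).
    by move=> w _; rewrite ler_wpM2r ?sqr_ge0// (le_trans (ler_norm _)).
  by rewrite RintegralZl ?ler_wpM2l//; exact: x2.2.
have hJ : \int[P]_w (psi w * dJ w ^+ 2) <=
    2 * \int[P]_w (psi w * (I w u - I w s) ^+ 2) + 2 * \int[P]_w (psi w * x w ^+ 2).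
  have i1 := integrableZl measurableT 2 idI.
  have i2 := integrableZl measurableT 2 ix.
  rewrite -!RintegralZl// -RintegralD//.
  apply: le_Rintegral => //; first exact: (integrableD measurableT i1 i2).
  move=> w _.
  have h : dJ w ^+ 2 <= 2 * (I w u - I w s) ^+ 2 + 2 * x w ^+ 2.
    by rewrite E -/(dJ w); have := sqr_ge0 (dJ w + 2 * x w); rewrite !sqrrD; lra.
  by have := ler_wpM2l (psi0 w) h; lra.
by lra.
Qed.

End ito_isometry.

(** * Pathwise estimates *)

Section uniform_partition.
Context {R : realType}.
Variables (s T : R) (n : nat).
Hypothesis sT : s <= T.

(** There are [n.+1] equal steps, so the mesh is defined for every n. *)
Definition unif_part (i : nat) : R := s + i%:R * ((T - s) / n.+1%:R).

Lemma unif_part0 : unif_part 0 = s.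
Proof. by rewrite /unif_part mul0r addr0. Qed.

Lemma unif_part_last : unif_part n.+1 = T.
Proof. by rewrite /unif_part mulrC divfK ?pnatr_eq0// addrC subrK. Qed.

Lemma unif_part_step i : unif_part i.+1 - unif_part i = (T - s) / n.+1%:R.
Proof. by rewrite /unif_part -[i.+1%:R]natr1; ring. Qed.

Lemma unif_part_le i : unif_part i <= unif_part i.+1.
Proof. by rewrite -subr_ge0 unif_part_step divr_ge0// subr_ge0. Qed.

Lemma unif_part_mono i j : (i <= j)%N -> unif_part i <= unif_part j.
Proof.
move=> ij; rewrite /unif_part lerD2l ler_wpM2r ?ler_nat//.
by rewrite divr_ge0// subr_ge0.
Qed.

Lemma unif_part_ge i : s <= unif_part i.
Proof. by rewrite -[leLHS]unif_part0 unif_part_mono. Qed.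

Lemma unif_part_leT i : (i <= n.+1)%N -> unif_part i <= T.
Proof. by move=> ij; rewrite -[leRHS]unif_part_last unif_part_mono. Qed.

End uniform_partition.

Section path_integral.
Context {R : realType}.
Local Notation mu := (@lebesgue_measure R).
Variables (T : R) (f : R -> R).
Hypothesis intf : mu.-integrable `[0, T]%classic (EFin \o f).

Let sub_itv a b : 0 <= a -> b <= T -> `[a, b]%classic `<=` `[0, T]%classic.
Proof.
move=> a0 bT r /=; rewrite !in_itv/= => /andP[ar rb].
by rewrite (le_trans a0)//= (le_trans rb).
Qed.

Lemma path_integrable a b : 0 <= a -> b <= T ->
  mu.-integrable `[a, b]%classic (EFin \o f).
Proof. by move=> a0 bT; apply: integrableS intf => //; exact: sub_itv. Qed.

Lemma path_integral_cat a c b : 0 <= a -> a <= c -> c <= b -> b <= T ->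
  \int[mu]_(r in `[a, b]) f r =
  \int[mu]_(r in `[a, c]) f r + \int[mu]_(r in `[c, b]) f r.
Proof.
move=> a0 ac cb bT.
have i1 := path_integrable a0 bT.
have c0 : 0 <= c by exact: le_trans ac.
have := @Rintegral_itvB _ f (BLeft a) (BRight b) c i1.
rewrite !bnd_simp => /(_ ac cb).
rewrite Rintegral_itv_obnd_cbnd; last first.
  apply: integrableS (path_integrable c0 bT) => // r /=.
  by rewrite !in_itv/= => /andP[/ltW -> ->].
by move=> <-; rewrite addrC subrK.
Qed.

Lemma path_integral_norm_le a b : 0 <= a -> b <= T ->
  `|\int[mu]_(r in `[a, b]) f r| <= \int[mu]_(r in `[a, b]) `|f r|.
Proof.
move=> a0 bT; apply: le_normr_Rintegral => //; exact: path_integrable.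
Qed.

Lemma path_integral_part s n k : 0 <= s -> s <= T -> (k <= n.+1)%N ->
  \sum_(i < k) \int[mu]_(r in `[unif_part s T n i, unif_part s T n i.+1]) f r =
  \int[mu]_(r in `[s, unif_part s T n k]) f r.
Proof.
move=> s0 sT; elim: k => [_|k IH kn].
  by rewrite big_ord0 unif_part0 set_itv1 Rintegral_set1.
rewrite big_ord_recr/= IH ?(ltnW kn)// [RHS](@path_integral_cat _ (unif_part s T n k))//.
- exact: unif_part_ge.
- exact: unif_part_le.
- exact: unif_part_leT.
Qed.

End path_integral.

Section path_variation.
Context {R : realType}.
Local Notation mu := (@lebesgue_measure R).
Variables (T : R) (f : R -> R).
Hypothesis intf : mu.-integrable `[0, T]%classic (EFin \o f).
Variable s : R.
Hypotheses (s0 : 0 <= s) (sT : s <= T).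

Let intnf : mu.-integrable `[0, T]%classic (EFin \o (fun r => `|f r|)).
Proof. exact: integrable_norm. Qed.

Local Notation t n := (unif_part s T n).
Let V n i := \int[mu]_(r in `[t n i, t n i.+1]) `|f r|.
Let H := \int[mu]_(r in `[0, T]) `|f r|.

Let V0 n i : 0 <= V n i. Proof. exact: Rintegral_ge0. Qed.

Let H0 : 0 <= H. Proof. exact: Rintegral_ge0. Qed.

Let sumV n : \sum_(i < n.+1) V n i <= H.
Proof.
rewrite (path_integral_part intnf s0 sT (leqnn _)) unif_part_last /H.
rewrite (@path_integral_cat _ _ _ intnf 0 s T)// lerDr.
exact: Rintegral_ge0.
Qed.

Let sqr_le n i : (i < n.+1)%N ->
  (\int[mu]_(r in `[t n i, t n i.+1]) f r) ^+ 2 <= V n i ^+ 2.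
Proof.
move=> i_n; rewrite -real_normK ?num_real// lerXn2r ?nnegrE//.
apply: (path_integral_norm_le intf); first exact: le_trans (unif_part_ge _ sT _).
exact: unif_part_leT.
Qed.

(** Each step integral of |f| is at most the total H, so the sum of squares is at most H times their
    sum. This is the domination for the limit under the expectation. *)
Lemma path_square_variation_le n :
  \sum_(i < n.+1) (\int[mu]_(r in `[t n i, t n i.+1]) f r) ^+ 2 <= H ^+ 2.
Proof.
apply: (@le_trans _ _ (\sum_(i < n.+1) V n i * H)).
  apply: ler_sum => i _; apply: (le_trans (sqr_le (ltn_ord i))).
  rewrite expr2 ler_wpM2l//; apply: le_trans (sumV n).
  by rewrite (bigD1 i)//= lerDl sumr_ge0.
by rewrite -mulr_suml expr2 ler_wpM2r.
Qed.

(** By absolute continuity of the integral, a small mesh makes every step integral of |f| at most e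
    / (H + 1); the sum of squares is then at most H e / (H + 1). *)
Lemma path_square_variation_cvg0 (e : R) : 0 < e -> \forall n \near \oo,
  \sum_(i < n.+1) (\int[mu]_(r in `[t n i, t n i.+1]) f r) ^+ 2 <= e.
Proof.
move=> e0; have H1 : 0 < H + 1 by rewrite ltr_wpDl.
have intfT : mu.-integrable setT (EFin \o (f \_ `[0, T]%classic)).
  by rewrite -restrict_EFin -integrable_mkcond.
have [dl [dl0 small]] := integral_normr_continuous intfT (divr_gt0 e0 H1).
have [N _ hN] : \forall n \near \oo, (T - s) / n.+1%:R < dl.
  have Ts1 : 0 < T - s + 1 by rewrite ltr_wpDl// subr_ge0.
  have := near_infty_natSinv_lt (PosNum (divr_gt0 dl0 Ts1)).
  apply: filterS => n /=; rewrite ltr_pdivlMr// => /(le_lt_trans _); apply.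
  by rewrite mulrC ler_wpM2l ?invr_ge0// lerDl.
exists N => // n /hN/= h.
apply: (@le_trans _ _ (\sum_(i < n.+1) V n i * (e / (H + 1)))); last first.
  rewrite -mulr_suml; apply: (@le_trans _ _ (H * (e / (H + 1)))).
    by rewrite ler_wpM2r// divr_ge0// ltW.
  by rewrite mulrCA ger_pMr// ler_pdivrMr// mul1r lerDl.
apply: ler_sum => i _; apply: (le_trans (sqr_le (ltn_ord i))).
rewrite expr2 ler_wpM2l// ltW//.
have sub : `[t n i, t n i.+1]%classic `<=` `[0, T]%classic.
  move=> r /=; rewrite !in_itv/= => /andP[r1 r2].
  rewrite (le_trans s0 (le_trans (unif_part_ge _ sT i) r1))/=.
  by rewrite (le_trans r2)// unif_part_leT.
have := small `[t n i, t n i.+1]%classic (measurable_itv _).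
rewrite (eq_Rintegral mu (g := fun r => `|f r|)); last first.
  by move=> r; rewrite inE => /sub r0T; rewrite patchE mem_set.
apply; rewrite /= lebesgue_measure_itv/=; case: ifP => _; last by rewrite lte_fin.
by rewrite lte_fin unif_part_step.
Qed.

End path_variation.

(** * Estimates along one path, with y, J, z, zB standing for Y, I, |Z|^2, |ZB|^2 *)

Section path_estimate.
Context {R : realType}.
Local Notation mu := (@lebesgue_measure R).
Variables (T : R) (f z zB y J : R -> R) (M c kap : R).
Hypotheses (T0 : 0 < T) (M0 : 0 <= M) (c0 : 0 <= c) (kap0 : 0 < kap).
Hypothesis intf : mu.-integrable `[0, T]%classic (EFin \o f).
Hypothesis intz : mu.-integrable `[0, T]%classic (EFin \o z).
Hypothesis mzB : measurable_fun `[0, T]%classic zB.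
Hypotheses (z0 : forall r, 0 <= z r) (zB0 : forall r, 0 <= zB r).
Let m r := c * Num.sqrt (1 + z r).
Hypothesis f_ge : forall r, 0 <= r <= T -> kap * zB r - m r <= f r.
Hypothesis f_int : forall a b, 0 <= a -> a <= b -> b <= T ->
  \int[mu]_(r in `[a, b]) f r = y a - y b + (J b - J a).
Hypothesis yM : forall t, 0 <= t <= T -> `|y t| <= M.

Let sqrt_sqr r : Num.sqrt (1 + z r) ^+ 2 = 1 + z r.
Proof. by rewrite sqr_sqrtr// addr_ge0. Qed.

Let m0 r : 0 <= m r. Proof. by rewrite mulr_ge0// sqrtr_ge0. Qed.

Let sqrt_ge1 r : 1 <= Num.sqrt (1 + z r).
Proof. by rewrite -[leLHS]sqrtr1 ler_wsqrtr// lerDl. Qed.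

Let m_le r : m r <= c * (1 + z r).
Proof.
rewrite ler_wpM2l// -[leRHS]sqrt_sqr expr2 ler_peMr//; exact: sqrtr_ge0.
Qed.

Let int_cst (k : R) : mu.-integrable `[0, T]%classic (EFin \o (fun=> k)).
Proof.
apply/integrableP; split; first exact: measurable_cst.
rewrite integral_cst//= lebesgue_measure_itv/= lte_fin T0 -EFinM; exact: ltry.
Qed.

Let intD (g h : R -> R) : mu.-integrable `[0, T]%classic (EFin \o g) ->
  mu.-integrable `[0, T]%classic (EFin \o h) ->
  mu.-integrable `[0, T]%classic (EFin \o (fun r => g r + h r)).
Proof. by move=> hg hh; have := integrableD _ hg hh; apply; exact: measurable_itv. Qed.

Let intZ (k : R) (g : R -> R) : mu.-integrable `[0, T]%classic (EFin \o g) ->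
  mu.-integrable `[0, T]%classic (EFin \o (fun r => k * g r)).
Proof. by move=> hg; have := integrableZl _ k hg; apply; exact: measurable_itv. Qed.

Let int1z (k : R) : mu.-integrable `[0, T]%classic (EFin \o (fun r => k * (1 + z r))).
Proof. by apply: intZ; apply: intD. Qed.

Let mz : measurable_fun `[0, T]%classic z.
Proof. by apply/measurable_EFinP; exact: measurable_int intz. Qed.

Let mm : measurable_fun `[0, T]%classic m.
Proof.
apply: measurable_funM => //.
apply: (@measurableT_comp _ _ _ _ _ _ (@Num.sqrt R)); last exact: measurable_funD.
by apply: continuous_measurable_fun; exact: sqrt_continuous.
Qed.

Let intm : mu.-integrable `[0, T]%classic (EFin \o m).
Proof.
apply: le_integrable (int1z c) => //; first exact/measurable_EFinP.
move=> r _; rewrite /= lee_fin ger0_norm// ger0_norm ?m_le//.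
by rewrite mulr_ge0// addr_ge0.
Qed.

Let le_int (g h : R -> R) a b : 0 <= a -> b <= T ->
  mu.-integrable `[0, T]%classic (EFin \o g) ->
  mu.-integrable `[0, T]%classic (EFin \o h) ->
  (forall r, 0 <= r <= T -> g r <= h r) ->
  \int[mu]_(r in `[a, b]) g r <= \int[mu]_(r in `[a, b]) h r.
Proof.
move=> a0 bT hg hh gh; apply: le_Rintegral => //;
  [exact: (path_integrable hg)|exact: (path_integrable hh)|].
move=> r /=; rewrite in_itv/= => /andP[ar rb]; apply: gh.
by rewrite (le_trans a0 ar) (le_trans rb bT).
Qed.

Let intDE (g h : R -> R) a b : 0 <= a -> b <= T ->
  mu.-integrable `[0, T]%classic (EFin \o g) ->
  mu.-integrable `[0, T]%classic (EFin \o h) ->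
  \int[mu]_(r in `[a, b]) (g r + h r) =
  \int[mu]_(r in `[a, b]) g r + \int[mu]_(r in `[a, b]) h r.
Proof.
move=> a0 bT hg hh.
by rewrite RintegralD//; [exact: (path_integrable hg)|exact: (path_integrable hh)].
Qed.

Let intZE (k : R) (g : R -> R) a b : 0 <= a -> b <= T ->
  mu.-integrable `[0, T]%classic (EFin \o g) ->
  \int[mu]_(r in `[a, b]) (k * g r) = k * \int[mu]_(r in `[a, b]) g r.
Proof. by move=> a0 bT hg; rewrite RintegralZl//; exact: (path_integrable hg). Qed.

Let int_cstE (k : R) a b : a <= b -> \int[mu]_(r in `[a, b]) k = k * (b - a).
Proof.
move=> ab; rewrite Rintegral_cst//= lebesgue_measure_itv/= lte_fin.
by case: ltP => // ba; rewrite (le_anti (introT andP (conj ab ba))) subrr.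
Qed.

Lemma path_driver_ge a b : 0 <= a -> a <= b -> b <= T ->
  - (\int[mu]_(r in `[a, b]) m r) <= y a - y b + (J b - J a).
Proof.
move=> a0 ab bT; rewrite -f_int// -mulN1r -intZE//.
apply: le_int => //; first exact: intZ.
move=> r r0T; have := f_ge r0T; have := mulr_ge0 (ltW kap0) (zB0 r); lra.
Qed.

(* With U = y - M, the constants come from
   4 M m <= (1 + z) / 128 + 512 M^2 c^2 and D^2 / 2 <= (D - G)^2 + G^2. *)
Lemma path_energy_inequality s n : 0 <= s -> s <= T ->
  2^-1 * \sum_(i < n.+1) (J (unif_part s T n i.+1) - J (unif_part s T n i)) ^+ 2 +
  2 * \sum_(i < n.+1) (y (unif_part s T n i) - M) *
    (J (unif_part s T n i.+1) - J (unif_part s T n i)) <=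
  4 * M ^+ 2 + (128^-1 + 512 * M ^+ 2 * c ^+ 2) * T +
  128^-1 * \int[mu]_(r in `[s, T]) z r +
  \sum_(i < n.+1) (\int[mu]_(r in `[unif_part s T n i, unif_part s T n i.+1]) f r) ^+ 2.
Proof.
move=> s0 sT; set t := unif_part s T n.
have t0 i : 0 <= t i by exact: le_trans (unif_part_ge n sT i).
have tt i : t i <= t i.+1 by exact: unif_part_le.
have tT i : (i <= n.+1)%N -> t i <= T by exact: unif_part_leT.
pose G i := \int[mu]_(r in `[t i, t i.+1]) f r.
pose mi i := \int[mu]_(r in `[t i, t i.+1]) m r.
pose U i := y (t i) - M.
have step (i : 'I_n.+1) :
    2^-1 * (J (t i.+1) - J (t i)) ^+ 2 + 2 * (U i * (J (t i.+1) - J (t i))) <=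
    (U i.+1 ^+ 2 - U i ^+ 2) + 4 * M * mi i + G i ^+ 2.
  have GE : G i = U i - U i.+1 + (J (t i.+1) - J (t i)).
    by rewrite /G (f_int (t0 i) (tt i) (tT _ (ltn_ord i))) /U; lra.
  have Gm : - mi i <= G i.
    rewrite /G (f_int (t0 i) (tt i) (tT _ (ltn_ord i))).
    exact: (path_driver_ge (t0 i) (tt i) (tT _ (ltn_ord i))).
  have mi0 : 0 <= mi i by apply: Rintegral_ge0.
  have : `|y (t i)| <= M by apply: yM; rewrite t0 tT// ltnW.
  rewrite ler_norml => /andP[y1 y2].
  have U1 : - (2 * M) <= U i by rewrite /U; lra.
  have U2 : U i <= 0 by rewrite /U; lra.
  (* Since U <= 0, the bound G >= -m becomes U G <= -U m, and [p2] bounds the latter by 2 M m. *)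
  have p1 : 0 <= - U i * (G i + mi i) by rewrite mulr_ge0 ?oppr_ge0//; lra.
  have p2 : 0 <= (2 * M + U i) * mi i by rewrite mulr_ge0//; lra.
  set D := J _ - J _ in GE *.
  have -> : U i.+1 = U i + D - G i by lra.
  by have := sqr_ge0 (D - 2 * G i); rewrite !expr2 in p1 p2 *; lra.
have : \sum_(i < n.+1) (2^-1 * (J (t i.+1) - J (t i)) ^+ 2 +
      2 * (U i * (J (t i.+1) - J (t i)))) <=
    \sum_(i < n.+1) ((U i.+1 ^+ 2 - U i ^+ 2) + 4 * M * mi i + G i ^+ 2).
  by apply: ler_sum => i _; exact: step.
rewrite [leRHS]big_split/= [X in _ <= X + _]big_split/= [leLHS]big_split/= -!mulr_sumr => main.
apply: (le_trans main); rewrite lerD2r.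
have -> : \sum_(i < n.+1) (U i.+1 ^+ 2 - U i ^+ 2) = U n.+1 ^+ 2 - U 0%N ^+ 2.
  by rewrite -(big_mkord xpredT (fun i => U i.+1 ^+ 2 - U i ^+ 2)) telescope_sumr.
have -> : \sum_(i < n.+1) mi i = \int[mu]_(r in `[s, T]) m r.
  by rewrite (path_integral_part intm s0 sT (leqnn _)) unif_part_last.
have UT : U n.+1 ^+ 2 - U 0%N ^+ 2 <= 4 * M ^+ 2.
  have : `|y (t n.+1)| <= M by apply: yM; rewrite t0 tT.
  rewrite ler_norml => /andP[y1 y2].
  have : 0 <= (2 * M + U n.+1) * (2 * M - U n.+1).
    by rewrite mulr_ge0 /U//; lra.
  by have := sqr_ge0 (U 0%N); rewrite !expr2; lra.
have : 4 * M * \int[mu]_(r in `[s, T]) m r <=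
    \int[mu]_(r in `[s, T]) (128^-1 * (1 + z r) + 512 * M ^+ 2 * c ^+ 2).
  rewrite -intZE//; apply: le_int => //; [exact: intZ|by apply: intD|].
  move=> r _; rewrite -sqrt_sqr /m; set x := Num.sqrt _.
  (* The right-hand side minus the left-hand side is (x - 256 M c)^2 / 128. *)
  by have := sqr_ge0 (x - 256 * M * c); rewrite !expr2; lra.
rewrite (intDE s0 (lexx T) (int1z _) (int_cst _)).
rewrite (intZE _ s0 (lexx T) (intD (int_cst 1) intz)).
rewrite (intDE s0 (lexx T) (int_cst 1) intz) !int_cstE//.
have : (128^-1 + 512 * M ^+ 2 * c ^+ 2) * (T - s) <= (128^-1 + 512 * M ^+ 2 * c ^+ 2) * T.
  apply: ler_wpM2l; last by rewrite gerBl.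
  have := sqr_ge0 (M * c); rewrite exprMn; lra.
by lra.
Qed.

(** From f >= -m one gets |f| <= f + 2 m, so with g = int f and A = int m the left-hand side is at
    most (g + 2 A)^2 <= 2 g^2 + 8 A^2. The bound is integrable in w and dominates the sums of
    squares over all partitions. *)
Lemma path_total_variation_le :
  (\int[mu]_(r in `[0, T]) `|f r|) ^+ 2 <=
  2 * (y 0 - y T + (J T - J 0)) ^+ 2 +
  8 * T * c ^+ 2 * (T + \int[mu]_(r in `[0, T]) z r).
Proof.
set A := \int[mu]_(r in `[0, T]) m r.
have A0 : 0 <= A by exact: Rintegral_ge0.
have h1 : \int[mu]_(r in `[0, T]) `|f r| <= (y 0 - y T + (J T - J 0)) + 2 * A.
  rewrite -(f_int (lexx 0) (ltW T0) (lexx T)) -(intZE 2 (lexx 0) (lexx T) intm).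
  rewrite -(intDE (lexx 0) (lexx T) intf (intZ 2 intm)).
  apply: le_int => //; [exact: integrable_norm|exact: (intD intf (intZ 2 intm))|].
  move=> r r0T; have := f_ge r0T; have := mulr_ge0 (ltW kap0) (zB0 r).
  have := m0 r; have [f0|f0] : 0 <= f r \/ f r < 0 by case: (leP 0 (f r)); [left|right].
    by rewrite ger0_norm//; lra.
  by rewrite ltr0_norm//; lra.
(* Cauchy-Schwarz, obtained by integrating 2 (A / T) m <= (A / T)^2 + m^2, where A / T is the mean
   of m. *)
have h2 : A ^+ 2 <= T * (c ^+ 2 * (T + \int[mu]_(r in `[0, T]) z r)).
  have : 2 * (A / T) * A <=
      \int[mu]_(r in `[0, T]) ((A / T) ^+ 2 + c ^+ 2 * (1 + z r)).
    rewrite -intZE//; apply: le_int => //; [exact: intZ|by apply: intD|].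
    move=> r _; rewrite -sqrt_sqr -exprMn -/(m r).
    by have := sqr_ge0 (A / T - m r); rewrite !expr2; lra.
  rewrite (intDE (lexx 0) (lexx T) (int_cst _) (int1z _)).
  rewrite (intZE _ (lexx 0) (lexx T) (intD (int_cst 1) intz)).
  rewrite (intDE (lexx 0) (lexx T) (int_cst 1) intz) !(int_cstE _ (ltW T0)) subr0 mul1r => h.
  rewrite mulrC -ler_pdivrMr//.
  have -> : A ^+ 2 / T = 2 * (A / T) * A - (A / T) ^+ 2 * T.
    by field; rewrite gt_eqF.
  lra.
have h0 : 0 <= \int[mu]_(r in `[0, T]) `|f r| by exact: Rintegral_ge0.
set F := \int[mu]_(r in `[0, T]) `|f r| in h0 h1 *.
set g := y 0 - y T + (J T - J 0) in h1 *.
have : F ^+ 2 <= (g + 2 * A) ^+ 2 by rewrite lerXn2r// nnegrE//; lra.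
by have := sqr_ge0 (g - 2 * A); rewrite !expr2 in h2 *; lra.
Qed.

(** Integration of kap zB <= f + m with m <= c (1 + z); the equation gives the integral of f, and y
    contributes at most 2 M. The same inequality shows that zB is integrable. *)
Lemma path_minimizer_energy s : 0 <= s -> s <= T ->
  mu.-integrable `[s, T]%classic (EFin \o zB) /\
  kap * \int[mu]_(r in `[s, T]) zB r <=
  2 * M + c * T + (J T - J s) + c * \int[mu]_(r in `[s, T]) z r.
Proof.
move=> s0 sT.
have intzB : mu.-integrable `[0, T]%classic (EFin \o zB).
  have h : mu.-integrable `[0, T]%classic (EFin \o (fun r => kap^-1 * (f r + m r))).
    by apply: intZ; exact: intD.
  apply: le_integrable h => //; first exact/measurable_EFinP.
  move=> r /=; rewrite in_itv/= => r0T; rewrite lee_fin ger0_norm//.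
  apply: le_trans (ler_norm _).
  by rewrite mulrC ler_pdivlMr// mulrC; have := f_ge r0T; lra.
split; first exact: (path_integrable intzB).
have : kap * \int[mu]_(r in `[s, T]) zB r <=
    \int[mu]_(r in `[s, T]) (f r + c * (1 + z r)).
  rewrite -intZE//; apply: le_int => //; [exact: intZ|by apply: intD|].
  by move=> r r0T; have := f_ge r0T; have := m_le r; lra.
rewrite (intDE s0 (lexx T) intf (int1z _)).
rewrite (intZE _ s0 (lexx T) (intD (int_cst 1) intz)).
rewrite (intDE s0 (lexx T) (int_cst 1) intz) f_int// int_cstE// mul1r.
have : `|y s| <= M by apply: yM; rewrite s0.
have : `|y T| <= M by apply: yM; rewrite (le_trans s0 sT) lexx.
rewrite !ler_norml => /andP[? ?] /andP[? ?].
have : c * (T - s) <= c * T by rewrite ler_wpM2l// gerBl.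
by lra.
Qed.

End path_estimate.

(** * The a priori estimate for the BSDE *)

Section ae_integral.
Context {dsp : measure_display} {Omega : measurableType dsp} {R : realType}.
Variable P : probability Omega R.

Lemma le_Rintegral_ae (f1 f2 : Omega -> R) :
  P.-integrable setT (EFin \o f1) -> P.-integrable setT (EFin \o f2) ->
  {ae P, forall w, f1 w <= f2 w} -> \int[P]_w f1 w <= \int[P]_w f2 w.
Proof.
move=> i1 i2 f12; rewrite -subr_ge0 -RintegralB//.
have i3 : P.-integrable setT (EFin \o (fun w => f2 w - f1 w)).
  exact: (integrableB measurableT i2 i1).
rewrite /Rintegral (_ : (\int[P]_w (f2 w - f1 w)%:E)%E = (\int[P]_w (`|f2 w - f1 w|)%:E)%E).
  by rewrite fine_ge0// integral_ge0.
apply: ae_eq_integral => //.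
- exact: measurable_int i3.
- exact: measurable_int (integrable_norm i3).
- by apply: filterS f12 => w h _; rewrite ger0_norm// subr_ge0.
Qed.

Lemma integrable_ae_le (f g : Omega -> R) : measurable_fun setT f ->
  P.-integrable setT (EFin \o g) -> {ae P, forall w, `|f w| <= g w} ->
  P.-integrable setT (EFin \o f).
Proof.
move=> mf ig fg; apply/integrableP; split; first exact/measurable_EFinP.
have mg : measurable_fun setT g by apply/measurable_EFinP; exact: measurable_int ig.
have /integrableP[_] := integrable_norm ig; apply: le_lt_trans.
have mf' : measurable_fun setT (fun w => `|f w|) by exact: measurableT_comp.
have mg' : measurable_fun setT (fun w => `|g w|) by exact: measurableT_comp.
(* Replacing |f| by its minimum with |g| turns an almost sure domination into one that holds
   everywhere. *)
have -> : (\int[P]_w `|(EFin \o f) w| = \int[P]_w (Num.min `|f w| `|g w|)%:E)%E.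
  apply: ae_eq_integral => //.
  - by apply/measurable_EFinP.
  - by apply/measurable_EFinP; exact: measurable_minr.
  - apply: filterS fg => w h _ /=; rewrite min_l//.
    by apply: le_trans h _; exact: ler_norm.
apply: ge0_le_integral => //.
- by apply/measurable_EFinP; exact: measurable_minr.
- by apply/measurable_EFinP; apply: measurableT_comp.
- by move=> w _; rewrite /= normr_id lee_fin ge_min lexx orbT.
Qed.

End ae_integral.

Section square_integral.
Context {R : realType} {dsp : measure_display} {Omega : measurableType dsp}.
Variables (P : probability Omega R) (T : R) (d : nat).
Variable W : Omega -> R -> 'rV[R]_d.
Hypotheses (T0 : 0 <= T) (W_bm : brownian_motion P T W).
Local Notation F := (completed_filtration P W).
Local Notation mu := (@lebesgue_measure R).
Variables (Z : Omega -> R -> 'rV[R]_d).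
Hypotheses (pZ : progressive_vec T F Z) (Zen : (energy P T Z < +oo)%E).

(** Real valued: an infinite integral is sent to 0, which by finiteness of the energy happens only
    on a null set. *)
Definition sqint a b w := \int[mu]_(r in `[a, b]) sqnormv (Z w r).

Let jZ := progressive_vec_sqnormv_measurable T0 W_bm pZ.

Let sq0 w r : 0 <= sqnormv (Z w r). Proof. exact: sqnormv_ge0. Qed.

Let int0 a b w : (0 <= \int[mu]_(r in `[a, b]) (sqnormv (Z w r))%:E)%E.
Proof. by apply: integral_ge0 => r _; rewrite lee_fin. Qed.

Lemma sqnormv_path_integrable :
  {ae P, forall w, mu.-integrable `[0, T]%classic (EFin \o (fun r => sqnormv (Z w r)))}.
Proof.
have mi := jointly_measurable_integral (lexx 0) (lexx T) sq0 jZ.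
have : P.-integrable setT (fun w => \int[mu]_(r in `[0%R, T]) (sqnormv (Z w r))%:E)%E.
  apply/integrableP; split => //.
  by under eq_integral do rewrite gee0_abs//.
move/(integrable_ae measurableT); apply: filterS => w /(_ I) h.
apply/integrableP; split.
  by apply/measurable_EFinP; exact: (jointly_measurable_section (lexx 0) (lexx T) w jZ).
under eq_integral do rewrite /= ger0_norm//.
by rewrite -ge0_fin_numE.
Qed.

Lemma sqint_ge0 a b w : 0 <= sqint a b w. Proof. exact: Rintegral_ge0. Qed.

Variables a b : R.
Hypotheses (a0 : 0 <= a) (bT : b <= T).

Lemma sqint_EFin : {ae P, forall w,
  (\int[mu]_(r in `[a, b]) (sqnormv (Z w r))%:E)%E = (sqint a b w)%:E}.
Proof.
apply: filterS sqnormv_path_integrable => w h; rewrite fineK//.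
by apply: integrable_fin_num => //; exact: (path_integrable h).
Qed.

Let mi := jointly_measurable_integral a0 bT sq0 jZ.

Lemma sqint_measurable : measurable_fun setT (sqint a b).
Proof. by apply: (measurableT_comp _ mi); exact: fine_measurable. Qed.

Lemma sqint_integrable : P.-integrable setT (EFin \o sqint a b).
Proof.
apply/integrableP; split; first by apply/measurable_EFinP; exact: sqint_measurable.
apply: le_lt_trans Zen; rewrite /energy.
apply: (@le_trans _ _ (\int[P]_w \int[mu]_(r in `[a, b]) (sqnormv (Z w r))%:E)%E).
  rewrite le_eqVlt; apply/orP; left; apply/eqP; apply: ae_eq_integral => //.
  - by apply/measurable_EFinP; apply: measurableT_comp => //; exact: sqint_measurable.
  - apply: filterS sqint_EFin => w -> _.
    by rewrite /= ger0_norm// sqint_ge0.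
- apply: ge0_le_integral => //.
  + exact: (jointly_measurable_integral (lexx 0) (lexx T) sq0 jZ).
  + move=> w _; apply: ge0_subset_integral => //.
    * by apply/measurable_EFinP; exact: (jointly_measurable_section (lexx 0) (lexx T) w jZ).
    * by move=> r _; rewrite lee_fin.
    * move=> r /=; rewrite !in_itv/= => /andP[ar rb].
      by rewrite (le_trans a0 ar) (le_trans rb bT).
Qed.

End square_integral.

Section bsde_estimate.
Context {R : realType} {dsp : measure_display} {Omega : measurableType dsp}.
Variables (P : probability Omega R) (T : R) (d : nat).
Variable W : Omega -> R -> 'rV[R]_d.
Hypotheses (T0 : 0 < T) (W_bm : brownian_motion P T W).
Local Notation F := (completed_filtration P W).
Local Notation mu := (@lebesgue_measure R).
Variables (Z ZB : Omega -> R -> 'rV[R]_d) (Y I : Omega -> R -> R) (M c kap : R).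
Hypotheses (M0 : 0 <= M) (c0 : 0 <= c) (kap0 : 0 < kap).
Hypotheses (pY : progressive T F Y) (pZ : progressive_vec T F Z).
Hypotheses (pZB : progressive_vec T F ZB) (Zen : (energy P T Z < +oo)%E).
Hypothesis hI : ito_integral P T W Z I.

(** [f] is a real version of the driver along the path w. Its lower bound holds at every time, and
    the equation is recorded only through integrals of f, which do not see the null set of times
    where f was changed. *)
Definition bsde_path w (f : R -> R) :=
  [/\ mu.-integrable `[0, T]%classic (EFin \o f),
    forall r, 0 <= r <= T ->
      kap * sqnormv (ZB w r) - c * Num.sqrt (1 + sqnormv (Z w r)) <= f r,
    forall a b, 0 <= a -> a <= b -> b <= T ->
      \int[mu]_(r in `[a, b]) f r = Y w a - Y w b + (I w b - I w a) &
    forall t, 0 <= t <= T -> `|Y w t| <= M].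

Hypothesis paths : {ae P, forall w, exists f, bsde_path w f}.

Let T0' : 0 <= T := ltW T0.

(* Y is only almost surely bounded; truncating it makes every random variable
   below bounded without changing any of them almost surely. *)
Let y w t := Num.max (- M) (Num.min M (Y w t)).

Let yM w t : `|y w t| <= M.
Proof.
by rewrite ler_norml /y le_max lexx/= ge_max ge_min lexx andbT lerNl (le_trans _ M0)// oppr_le0.
Qed.

Let yE w t : `|Y w t| <= M -> y w t = Y w t.
Proof. by rewrite ler_norml /y => /andP[h1 h2]; rewrite min_r// max_r. Qed.

Let y_meas t : 0 <= t <= T -> measurable_wrt (F t) (y ^~ t).
Proof.
move=> t01; have mY : measurable_wrt (F t) (Y ^~ t).
  have h : measurable_fun (setT `*` `[0, t]%classic)
    (fun p : (g_sigma_algebraType (F t) * measurableTypeR R)%type => Y p.1 p.2) by exact: pY.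
  apply: (@measurable_comp _ _ _ _ _ _ (setT `*` `[0, t]%classic)
    (fun p : g_sigma_algebraType (F t) * measurableTypeR R => Y p.1 p.2) _ (fun w => (w, t))) => //.
  - by apply: measurableX => //; exact: measurable_itv.
  - by move=> _ [w _ <-]; split => //=; rewrite in_itv/= lexx andbT; case/andP: t01.
apply: measurable_maxr; first exact: measurable_cst.
by apply: measurable_minr => //; exact: measurable_cst.
Qed.

Let meas (g : Omega -> R) t : t <= T -> measurable_wrt (F t) g -> measurable_fun setT g.
Proof. by move=> tT; apply: measurable_wrt_measurable; exact: (filtration_measurable W_bm). Qed.

Let y_meas' t : 0 <= t <= T -> measurable_fun setT (y ^~ t).
Proof. by move=> t01; apply: (meas _ (y_meas t01)); case/andP: t01. Qed.

Let y2 t : 0 <= t <= T -> sqintegrable P (y ^~ t).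
Proof. move=> t01; exact: (sqintegrable_bounded P (y_meas' t01) (fun w => yM w t)). Qed.

Let dI2 a b : 0 <= a -> a <= b -> b <= T -> sqintegrable P (fun w => I w b - I w a).
Proof. by move=> a0 ab bT; exact: (ito_sqintegrable W_bm hI). Qed.

(** Almost surely the integral of the driver over [a, b], but built from [y] and [I], so that
    measurability and square integrability in w are available. *)
Let G a b w := y w a - y w b + (I w b - I w a).

Let G2 a b : 0 <= a -> a <= b -> b <= T -> sqintegrable P (G a b).
Proof.
move=> a0 ab bT; apply: sqintegrableD; last exact: dI2.
by apply: sqintegrableB; apply: y2; rewrite ?a0 ?bT ?(le_trans ab bT) ?(le_trans a0 ab).
Qed.

Let GE w f a b : bsde_path w f -> 0 <= a -> a <= b -> b <= T ->
  G a b w = \int[mu]_(r in `[a, b]) f r.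
Proof.
move=> [_ _ fE YM] a0 ab bT; rewrite fE// /G !yE//; apply: YM.
  by rewrite bT (le_trans a0 ab).
by rewrite a0 (le_trans ab bT).
Qed.

Let zpath := sqnormv_path_integrable T0' W_bm pZ Zen.

Let ito_iso (psi : Omega -> R) (K : R) a b : 0 <= a -> a <= b -> b <= T ->
  measurable_wrt (F a) psi -> (forall w, 0 <= psi w) -> (forall w, `|psi w| <= K) ->
  \int[P]_w (psi w * sqint Z a b w) <= 32 * \int[P]_w (psi w * (I w b - I w a) ^+ 2).
Proof.
move=> a0 ab bT mpsi psi0 psiK.
have mpsi' := meas (le_trans ab bT) mpsi.
have iQ := sqint_integrable T0' W_bm pZ Zen a0 bT.
have ipQ := integrable_mul_bounded mpsi' psiK iQ.
have := ito_isometry_ge T0' W_bm pZ hI a0 ab bT mpsi psiK psi0.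
rewrite -lee_fin; apply: le_trans.
rewrite fineK; last exact: integrable_fin_num.
rewrite le_eqVlt; apply/orP; left; apply/eqP; apply: ae_eq_integral => //.
- exact: measurable_int ipQ.
- apply: emeasurable_funM; first exact/measurable_EFinP.
  apply: (jointly_measurable_integral a0 bT) => //.
    by move=> w r; exact: sqnormv_ge0.
  exact: (progressive_vec_sqnormv_measurable T0' W_bm pZ).
- by apply: filterS (sqint_EFin T0' W_bm pZ Zen a0 bT) => w -> _.
Qed.

Section from_time.
Variable s : R.
Hypotheses (s0 : 0 <= s) (sT : s <= T).
Local Notation t n := (unif_part s T n).

Let t0 n i : 0 <= t n i. Proof. exact: le_trans (unif_part_ge n sT i). Qed.
Let tt n i : t n i <= t n i.+1. Proof. exact: unif_part_le. Qed.
Let tT n i : (i <= n.+1)%N -> t n i <= T. Proof. exact: unif_part_leT. Qed.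

Let V n w := \sum_(i < n.+1) G (t n i) (t n i.+1) w ^+ 2.

Let V_integrable n : P.-integrable setT (EFin \o V n).
Proof.
have [] // := @Rintegral_sum _ _ _ P _ (index_enum 'I_n.+1)
  (fun i w => G (t n i) (t n i.+1) w ^+ 2).
by move=> i; have [] := G2 (t0 n i) (tt n i) (tT (ltn_ord i)).
Qed.

(** Dominated convergence: along almost every path the sums tend to 0 and stay below the squared
    integral of |f|, itself at most the integrable [D]. *)
Let V_cvg0 (e : R) : 0 < e -> \forall n \near \oo, \int[P]_w V n w <= e.
Proof.
move=> e0.
pose D w := 2 * G 0 T w ^+ 2 + 8 * T * c ^+ 2 * (T + sqint Z 0 T w).
have iD : P.-integrable setT (EFin \o D).
  apply: (integrableD measurableT (f := fun w => (2 * G 0 T w ^+ 2)%:E)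
    (g := fun w => (8 * T * c ^+ 2 * (T + sqint Z 0 T w))%:E)).
    exact: (integrableZl measurableT 2 (G2 (lexx 0) T0' (lexx T)).2).
  apply: (integrableZl measurableT (8 * T * c ^+ 2) (f := fun w => (T + sqint Z 0 T w)%:E)).
  apply: (integrableD measurableT (f := fun=> T%:E) (g := fun w => (sqint Z 0 T w)%:E)).
    exact: finite_measure_integrable_cst.
  exact: (sqint_integrable T0' W_bm pZ Zen (lexx 0) (lexx T)).
have VE w f n : bsde_path w f -> V n w =
    \sum_(i < n.+1) (\int[mu]_(r in `[t n i, t n i.+1]) f r) ^+ 2.
  by move=> wf; apply: eq_bigr => i _; rewrite (GE wf)// tT.
have V0 n w : 0 <= V n w by apply: sumr_ge0 => i _; exact: sqr_ge0.
have conv : {ae P, forall w, setT w -> (V n w)%:E @[n --> \oo] --> 0%E}.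
  apply: filterS paths => w [f wf] _; apply/fine_cvgP; split; first exact: nearW.
  apply/cvgrPdist_le => e1 e1_gt0; have [fi _ _ _] := wf.
  have := path_square_variation_cvg0 fi s0 sT e1_gt0.
  apply: filterS => n; rewrite sub0r normrN /= ger0_norm// (VE _ _ _ wf).
  exact.
have dom : {ae P, forall w n, setT w -> (`|(V n w)%:E| <= (EFin \o D) w)%E}.
  apply: filterS2 paths zpath => w [f wf] zw n _; have [fi fg fE YM] := wf.
  rewrite /= lee_fin ger0_norm// (VE _ _ _ wf).
  apply: (le_trans (path_square_variation_le fi s0 sT n)).
  rewrite /D (GE wf)// fE//.
  apply: (path_total_variation_le (zB := fun r => sqnormv (ZB w r)) T0 c0 kap0 fi zw) => //.
  - by move=> r; exact: sqnormv_ge0.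
  - by move=> r; exact: sqnormv_ge0.
have mV n : measurable_fun setT (fun w => (V n w)%:E).
  exact: measurable_int (V_integrable n).
have [_ _] := dominated_convergence measurableT mV (measurable_cst _) conv iD dom.
rewrite integral0 => /(cvge0_near e0); apply: filterS => n h.
by rewrite -lee_fin fineK ?ltW//; exact: (integrable_fin_num measurableT (V_integrable n)).
Qed.

Variable psi : Omega -> R.
Hypotheses (mpsi : measurable_wrt (F s) psi).
Hypotheses (psi0 : forall w, 0 <= psi w) (psi1 : forall w, psi w <= 1).

Let psiN w : `|psi w| <= 1. Proof. by rewrite ger0_norm. Qed.

Let mpsi' := meas sT mpsi.

Let ipsi : P.-integrable setT (EFin \o psi).
Proof. exact: integrable_bounded psiN. Qed.

Let psi_mul (h : Omega -> R) : P.-integrable setT (EFin \o h) ->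
  P.-integrable setT (EFin \o (fun w => psi w * h w)).
Proof. exact: integrable_mul_bounded psiN. Qed.

Let K0 := 4 * M ^+ 2 + (128^-1 + 512 * M ^+ 2 * c ^+ 2) * T.

Let mpsi_t n i : measurable_wrt (F (t n i)) psi.
Proof. by apply: measurable_wrt_sub mpsi; apply: filtration_mono; exact: unif_part_ge. Qed.

(** The pathwise inequality is multiplied by psi and integrated: the discrete stochastic integral
    disappears, the squared increments of [I] dominate X / 32, and the term X / 128 is absorbed. *)
Lemma bsde_sqint_le :
  \int[P]_w (psi w * sqint Z s T w) <= 128 * K0 * \int[P]_w psi w.
Proof.
set X := \int[P]_w (psi w * sqint Z s T w).
suff small (e : R) : 0 < e -> X <= 128 * K0 * \int[P]_w psi w + 128 * e.
  apply/ler_addgt0Pr => e e0; have := small (e / 128) (divr_gt0 e0 _).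
  by rewrite mulrCA divff// mulr1; apply.
move=> e0; have [n _ hn] := V_cvg0 e0.
have Vn : \int[P]_w V n w <= e by exact: hn n (leqnn n).
pose dJ (i : nat) (w : Omega) : R := I w (t n i.+1) - I w (t n i).
pose U (i : nat) (w : Omega) : R := y w (t n i) - M.
have dJ2 (i : 'I_n.+1) : sqintegrable P (dJ i).
  exact: dI2 (t0 n i) (tt n i) (tT (ltn_ord i)).
have mU (i : 'I_n.+1) : measurable_wrt (F (t n i)) (U i).
  apply: measurable_funB; last exact: measurable_cst.
  by apply: y_meas; rewrite t0 tT// ltnW.
have U_le i w : `|U i w| <= 2 * M.
  by rewrite /U (le_trans (ler_normB _ _))// (ger0_norm M0); have := yM w (t n i); lra.
have mpU (i : 'I_n.+1) : measurable_wrt (F (t n i)) (fun w => psi w * U i w).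
  exact (measurable_funM (@mpsi_t n i) (mU i)).
have pU_le (i : 'I_n.+1) w : `|psi w * U i w| <= 2 * M.
  by rewrite normrM -[leRHS]mul1r ler_pM.
(* psi U_i is bounded and known at time t_i, so its product with the next increment of [I] has mean
   0. *)
have UJ (i : 'I_n.+1) : P.-integrable setT (EFin \o (fun w => psi w * U i w * dJ i w)) /\
    \int[P]_w (psi w * U i w * dJ i w) = 0.
  split.
    apply: (integrable_mul_bounded (meas (tT (ltnW (ltn_ord i))) (mpU i)) (pU_le i)).
    exact: sqintegrable_integrable.
  exact: (ito_mean W_bm hI (t0 n i) (tt n i) (tT (ltn_ord i)) (mpU i) (pU_le i)).
have iJ (i : 'I_n.+1) : P.-integrable setT (EFin \o (fun w => psi w * dJ i w ^+ 2)).
  by apply: psi_mul; exact: (dJ2 i).2.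
have iQ (i : 'I_n.+1) : P.-integrable setT
    (EFin \o (fun w => psi w * sqint Z (t n i) (t n i.+1) w)).
  by apply: psi_mul; exact: (sqint_integrable T0' W_bm pZ Zen (t0 n i) (tT (ltn_ord i))).
have iQs : P.-integrable setT (EFin \o (fun w => psi w * sqint Z s T w)).
  by apply: psi_mul; exact: (sqint_integrable T0' W_bm pZ Zen s0 (lexx T)).
have iQT : P.-integrable setT (EFin \o sqint Z s T).
  exact: (sqint_integrable T0' W_bm pZ Zen s0 (lexx T)).
have [SQi SQ] := Rintegral_sum (index_enum 'I_n.+1) iQ.
have [SJi SJ] := Rintegral_sum (index_enum 'I_n.+1) iJ.
have [SUi SU] := Rintegral_sum (index_enum 'I_n.+1) (fun i => (UJ i).1).
have XJ : X <= 32 * \int[P]_w (\sum_(i < n.+1) psi w * dJ i w ^+ 2).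
  apply: (@le_trans _ _ (\int[P]_w (\sum_(i < n.+1) psi w * sqint Z (t n i) (t n i.+1) w))).
    apply: le_Rintegral_ae => //; apply: filterS zpath => w zw.
    rewrite -mulr_sumr ler_wpM2l// le_eqVlt; apply/orP; left; apply/eqP.
    by rewrite /sqint (path_integral_part zw s0 sT (leqnn _)) unif_part_last.
  rewrite SQ SJ mulr_sumr; apply: ler_sum => i _.
  exact: ito_iso (t0 n i) (tt n i) (tT (ltn_ord i)) (@mpsi_t n i) psi0 psiN.
have i1 : P.-integrable setT (EFin \o (fun w => 2^-1 * \sum_(i < n.+1) psi w * dJ i w ^+ 2)).
  exact: (integrableZl measurableT _ SJi).
have i2 : P.-integrable setT (EFin \o (fun w => 2 * \sum_(i < n.+1) psi w * U i w * dJ i w)).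
  exact: (integrableZl measurableT _ SUi).
have i3 : P.-integrable setT (EFin \o (fun w => K0 * psi w)).
  exact: (integrableZl measurableT _ ipsi).
have i4 : P.-integrable setT (EFin \o (fun w => 128^-1 * (psi w * sqint Z s T w))).
  exact: (integrableZl measurableT _ iQs).
have i12 := integrableD measurableT i1 i2.
have i34 := integrableD measurableT i3 i4.
have i345 := integrableD measurableT i34 (V_integrable n).
have key : \int[P]_w (2^-1 * (\sum_(i < n.+1) psi w * dJ i w ^+ 2) +
      2 * (\sum_(i < n.+1) psi w * U i w * dJ i w)) <=
    \int[P]_w (K0 * psi w + 128^-1 * (psi w * sqint Z s T w) + V n w).
  apply: le_Rintegral_ae => //; apply: filterS2 paths zpath => w [f wf] zw.
  have [fi fg fE YM] := wf.
  have := path_energy_inequality (zB := fun r => sqnormv (ZB w r)) T0 c0 kap0 fi zw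
    _ _ fg fE YM n s0 sT.
  move=> /(_ (fun r => sqnormv_ge0 _) (fun r => sqnormv_ge0 _)).
  have -> : \sum_(i < n.+1) (\int[mu]_(r in `[t n i, t n i.+1]) f r) ^+ 2 = V n w.
    by apply: eq_bigr => i _; rewrite (GE wf)// tT.
  rewrite -/K0 => h.
  have Vw : 0 <= V n w by apply: sumr_ge0 => i _; exact: sqr_ge0.
  have := ler_wpM2l (psi0 w) h.
  have -> : \sum_(i < n.+1) psi w * dJ i w ^+ 2 = psi w * \sum_(i < n.+1) dJ i w ^+ 2.
    by rewrite mulr_sumr.
  have -> : \sum_(i < n.+1) psi w * U i w * dJ i w =
      psi w * \sum_(i < n.+1) (Y w (t n i) - M) * dJ i w.
    rewrite mulr_sumr; apply: eq_bigr => i _; rewrite mulrA /U yE//; apply: YM.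
    by rewrite t0 tT// ltnW.
  (* As psi <= 1, the error [V n] can be kept without the weight, in the form whose expectation is
     at most e. *)
  have : psi w * V n w <= V n w by rewrite ler_piMl.
  rewrite /sqint -/mu; lra.
move: key; rewrite RintegralD// RintegralD// RintegralD// !RintegralZl//.
rewrite SU big1 ?mulr0 ?addr0; last by move=> i _; exact: (UJ i).2.
(* With S the expectation of the weighted sum of squared increments, X <= 32 S and S / 2 <= K0 E psi
   + X / 128 + e; hence X <= 64 K0 E psi + X / 2 + 64 e, and X is a real number. *)
rewrite -/X => key; lra.
Qed.

Let QB_ae : {ae P, forall w,
  (\int[mu]_(r in `[s, T]) (sqnormv (ZB w r))%:E)%E = (sqint ZB s T w)%:E /\
  kap * sqint ZB s T w <= 2 * M + c * T + (I w T - I w s) + c * sqint Z s T w}.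
Proof.
have mjZB := progressive_vec_sqnormv_measurable T0' W_bm pZB.
apply: filterS2 paths zpath => w [f [fi fg fE YM]] zw.
have [iB h] := path_minimizer_energy T0 c0 kap0 fi zw
  (jointly_measurable_section (lexx 0) (lexx T) w mjZB)
  (fun r => sqnormv_ge0 _) (fun r => sqnormv_ge0 _) fg fE YM s0 sT.
split=> //; rewrite fineK//; exact: integrable_fin_num iB.
Qed.

Let bound_integrable : P.-integrable setT (EFin \o (fun w =>
  2 * M + c * T + (I w T - I w s) + c * sqint Z s T w)).
Proof.
have i1 := sqintegrable_integrable (dI2 s0 sT (lexx T)).
have i2 := integrableZl measurableT c (sqint_integrable T0' W_bm pZ Zen s0 (lexx T)).
have i3 := finite_measure_integrable_cst P (2 * M + c * T) measurableT.
have i31 : P.-integrable setT (EFin \o (fun w => 2 * M + c * T + (I w T - I w s))).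
  exact: (integrableD measurableT i3 i1).
exact: (integrableD measurableT i31 i2).
Qed.

Let QB_integrable : P.-integrable setT (EFin \o sqint ZB s T).
Proof.
apply: integrable_ae_le (integrableZl measurableT kap^-1 bound_integrable) _.
  exact: (sqint_measurable T0' W_bm pZB s0 (lexx T)).
apply: filterS QB_ae => w [_ h]; rewrite ger0_norm ?sqint_ge0//.
by rewrite mulrC ler_pdivlMr// mulrC.
Qed.

(** At s = 0 this is the finite energy of [ZB], obtained from the integrable upper bound of
    [QB_ae]. *)
Lemma bsde_minimizer_integrable :
  P.-integrable setT (fun w => \int[mu]_(r in `[s, T]) (sqnormv (ZB w r))%:E)%E.
Proof.
have mjZB := progressive_vec_sqnormv_measurable T0' W_bm pZB.
have mB : measurable_fun setT (fun w => \int[mu]_(r in `[s, T]) (sqnormv (ZB w r))%:E)%E.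
  by apply: (jointly_measurable_integral s0 (lexx T) _ mjZB) => w r; exact: sqnormv_ge0.
apply/integrableP; split => //.
have /integrableP[mQ] := QB_integrable; apply: le_lt_trans.
rewrite le_eqVlt; apply/orP; left; apply/eqP; apply: ae_eq_integral => //.
- exact: measurableT_comp.
- exact: measurableT_comp.
- by apply: filterS QB_ae => w [-> _] _.
Qed.

(** The pathwise bound is weighted by psi: the increment of [I] has mean 0 against psi, and the
    integral of |Z|^2 is controlled by [bsde_sqint_le]. *)
Lemma bsde_minimizer_le :
  (\int[P]_w ((psi w)%:E * \int[mu]_(r in `[s, T]) (sqnormv (ZB w r))%:E) <=
  ((2 * M + c * T + 128 * c * K0) / kap * \int[P]_w psi w)%:E)%E.
Proof.
have iB := psi_mul QB_integrable.
have -> : (\int[P]_w ((psi w)%:E * \int[mu]_(r in `[s, T]) (sqnormv (ZB w r))%:E) =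
    \int[P]_w (psi w * sqint ZB s T w)%:E)%E.
  apply: ae_eq_integral => //.
  - apply: emeasurable_funM; first exact/measurable_EFinP.
    exact: measurable_int bsde_minimizer_integrable.
  - exact: measurable_int iB.
  - by apply: filterS QB_ae => w [-> _] _.
rewrite -[leLHS]fineK; last exact: (integrable_fin_num measurableT iB).
rewrite lee_fin -/(Rintegral _ _ _) -mulrA mulrCA mulrC ler_pdivlMr//.
have dI1 := sqintegrable_integrable (dI2 s0 sT (lexx T)).
have iQ := sqint_integrable T0' W_bm pZ Zen s0 (lexx T).
have i1 := integrableZl measurableT (2 * M + c * T) ipsi.
have i2 := psi_mul dI1.
have i3 := integrableZl measurableT c (psi_mul iQ).
have i12 := integrableD measurableT i1 i2.
have key : \int[P]_w (kap * (psi w * sqint ZB s T w)) <=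
   \int[P]_w ((2 * M + c * T) * psi w + psi w * (I w T - I w s) + c * (psi w * sqint Z s T w)).
  apply: le_Rintegral_ae.
  - exact: (integrableZl measurableT _ iB).
  - exact: (integrableD measurableT i12 i3).
  - by apply: filterS QB_ae => w [_ h]; have := ler_wpM2l (psi0 w) h; lra.
move: key; rewrite RintegralD// RintegralD// !RintegralZl//; [|exact: psi_mul..].
rewrite (ito_mean W_bm hI s0 sT (lexx T) mpsi psiN) addr0 => key.
rewrite mulrC; apply: (le_trans key).
have := ler_wpM2l c0 bsde_sqint_le; lra.
Qed.

End from_time.
End bsde_estimate.

(** * Conditional expectations and the BMO property *)

Section cond_expectation_bounded.
Context {R : realType} {dsp : measure_display} {Omega : measurableType dsp}.
Variables (P : probability Omega R) (G : set (set Omega)) (X : Omega -> \bar R).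
Hypotheses (Gm : G `<=` measurable) (Gs : <<s G>> = G).
Hypothesis intX : P.-integrable setT X.

Let nu0 : set (g_sigma_algebraType G) -> \bar R := induced_charge intX.

Let G_measurable (A : set Omega) : <<s G>> A -> measurable A.
Proof. exact: (g_sigma_measurable Gm). Qed.

(** Radon-Nikodym derivative of the charge A |-> int_A X with respect to P, both restricted to [G].
    A finite version is retained for the comparison with a constant. *)
Lemma cond_expectation_exists :
  exists2 V : Omega -> \bar R, cond_expectation P G X V & forall w, V w \is a fin_num.
Proof.
have n1 : nu0 set0 = 0%E by exact: (charge0 (induced_charge intX)).
have n2 A : measurable A -> nu0 A \is a fin_num.
  by move=> mA; apply: (fin_num_measure (induced_charge intX)); exact: G_measurable.
have n3 : semi_sigma_additive nu0.
  move=> A mA tA mUA; apply: (@charge_semi_sigma_additive _ _ _ (induced_charge intX) A) => //.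
    by move=> i; apply: G_measurable; exact: mA.
  exact: G_measurable.
pose nu : {charge set (g_sigma_algebraType G) -> \bar R} :=
  HB.pack nu0 (isCharge.Build _ _ _ nu0 n1 n2 n3).
have mid : measurable_fun setT (idfun : Omega -> g_sigma_algebraType G).
  by move=> _ B mB; rewrite setTI; exact: G_measurable.
pose id' : {mfun Omega >-> g_sigma_algebraType G} := mfun_Sub (mem_set mid).
(* The law of the identity, read in the coarser sigma-algebra, is P restricted to it. *)
pose P' := distribution P id'.
have dom : nu `<< P'.
  apply/null_content_dominatesP => A mA PA0.
  apply: null_set_integral => //; first exact: G_measurable.
  exact: measurable_funTS (measurable_int _ intX).
pose V := Radon_Nikodym nu P'.
have Vfin w : V w \is a fin_num by exact: Radon_Nikodym_fin_num.
have intV' : P'.-integrable setT V by exact: Radon_Nikodym_integrable.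
have mV' : measurable_fun setT V by exact: measurable_int intV'.
have mV : measurable_fun setT (V : Omega -> \bar R).
  exact: (measurable_wrt_measurable Gm mV').
have intV : P.-integrable setT (V : Omega -> \bar R).
  apply/integrableP; split => //.
  have /integrableP[_] := intV'.
  rewrite ge0_integral_distribution//.
  exact: measurableT_comp.
exists V => //; split => // A GA.
have mA : measurable (A : set (g_sigma_algebraType G)) by exact: sub_sigma_algebra.
have := Radon_Nikodym_integral dom mA.
rewrite -/V /P' /distribution => nuA.
transitivity (nu A); last by [].
rewrite nuA integral_pushforward//.
by apply: integrableS intV => //; exact: G_measurable.
Qed.

(** On B = {V > C}, which lies in [G], the function V - C is positive while its integral is at most
    0 by the hypothesis on A = B; so B is null. *)
Lemma cond_expectation_bounded (C : R) :
  (forall A, G A -> (\int[P]_(w in A) X w <= C%:E * P A)%E) ->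
  exists2 V : Omega -> \bar R, cond_expectation P G X V &
    {ae P, forall w, (V w <= C%:E)%E}.
Proof.
move=> XC; have [V cV Vfin] := cond_expectation_exists.
exists V => //; have [mV intV VX] := cV.
pose B := [set w | (C%:E < V w)%E].
have GB : G B.
  rewrite -Gs; have := mV measurableT _ (emeasurable_itv `]C%:E, +oo[).
  rewrite setTI (_ : V @^-1` _ = B)//; apply/seteqP; split=> w /=; rewrite in_itv/= andbT //.
have mB : measurable B by exact: Gm.
have iVB : P.-integrable B V by exact: integrableS intV.
have iC : P.-integrable B (cst C%:E) by exact: finite_measure_integrable_cst.
have iVC : P.-integrable B (V \- cst C%:E)%E by exact: integrableB.
have pos w : B w -> (0 <= V w - C%:E)%E.
  by move=> h; rewrite leeBrDr// add0e ltW.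
have : (\int[P]_(w in B) `|(V \- cst C%:E) w| = 0)%E.
  transitivity (\int[P]_(w in B) (V \- cst C%:E) w)%E.
    by apply: eq_integral => w; rewrite inE => Bw; rewrite gee0_abs// pos.
  apply/eqP; rewrite eq_le integral_ge0 ?andbT; last by move=> w; exact: pos.
  rewrite integralB// integral_cst// VX// sube_le0; exact: XC.
move/(ae_eq_integral_abs P mB (measurable_int _ iVC)).
apply: filterS => w h; rewrite leNgt; apply/negP => Vw.
have hw := h Vw; move: hw Vw (Vfin w) => /=; case: (V w) => [v| |]// [E].
by rewrite lte_fin => vC _; move: vC; rewrite -subr_gt0 E ltxx.
Qed.

End cond_expectation_bounded.

(** * Exceptional times along paths and real versions of the driver *)

Section sections.
Context {R : realType} {dsp : measure_display} {Omega : measurableType dsp}.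
Variables (P : probability Omega R) (T : R).
Local Notation mu := (@lebesgue_measure R).

(** By Tonelli's theorem the measures of the sections of a null set integrate to 0, so almost all
    sections are null. *)
Lemma ae_dPdt_section (Q : Omega -> R -> Prop) : ae_dPdt P T Q ->
  {ae P, forall w, {ae mu, forall r, 0 <= r <= T -> Q w r}}.
Proof.
move=> [N [mN N0 QN]].
have mx : measurable_fun setT (fun w => mu (xsection N w)) by exact: measurable_fun_xsection.
have : (\int[P]_w `|mu (xsection N w)| = 0)%E.
  by rewrite -[RHS]N0; apply: eq_integral => w _; rewrite gee0_abs.
move/(ae_eq_integral_abs P measurableT mx); apply: filterS => w /(_ I) /= h.
exists (xsection N w); split => //; first exact: measurable_xsection.
move=> r /= hr; rewrite /xsection/= inE; apply: QN => /= h'; apply: hr.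
exact: h'.
Qed.

Lemma path_real_version (g : R -> \bar R) (l : R -> R) :
  mu.-integrable `[0, T]%classic g -> measurable_fun `[0, T]%classic l ->
  {ae mu, forall r, 0 <= r <= T -> ((l r)%:E <= g r)%E} ->
  exists f : R -> R, [/\ mu.-integrable `[0, T]%classic (EFin \o f),
    forall r, l r <= f r &
    forall a, 0 <= a -> (\int[mu]_(r in `[a, T]) g r =
      (\int[mu]_(r in `[a, T]) f r)%:E)%E].
Proof.
move=> ig ml lg.
have FF : Filter (nbhs (almost_everywhere mu)) by exact: ae_filter_ringOfSetsType.
have mg := measurable_int _ ig.
(* The maximum forces the lower bound at every time, and changes g only where g is infinite or the
   bound fails, both on null sets of times. *)
pose f r := Num.max (fine (g r)) (l r).
have mf : measurable_fun `[0, T]%classic f.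
  by apply: measurable_maxr => //; exact: (measurableT_comp _ mg).
have gf : {ae mu, forall r, `[0, T]%classic r -> g r = (f r)%:E}.
  have gfin : {ae mu, forall r, `[0, T]%classic r -> g r \is a fin_num}.
    by apply: integrable_ae ig; exact: measurable_itv.
  apply: filterS2 lg gfin => r h1 h2 r0T.
  have := h2 r0T; have := h1; rewrite /f.
  move: r0T; rewrite /= in_itv/= => r0T /(_ r0T).
  by case: (g r) => [x| |]//=; rewrite lee_fin => h _; rewrite max_l.
have fi : mu.-integrable `[0, T]%classic (EFin \o f).
  apply/integrableP; split; first exact/measurable_EFinP.
  have /integrableP[_] := ig; apply: le_lt_trans.
  rewrite le_eqVlt; apply/orP; left; apply/eqP; apply: ae_eq_integral => //.
  - by apply: measurableT_comp => //; exact/measurable_EFinP.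
  - exact: measurableT_comp.
  - by apply: filterS gf => r h r0T; rewrite (h r0T).
exists f; split => //; first by move=> r; rewrite /f le_max lexx orbT.
move=> a a0.
have sub : `[a, T]%classic `<=` `[0, T]%classic.
  by move=> r /=; rewrite !in_itv/= => /andP[ar ->]; rewrite (le_trans a0 ar).
rewrite fineK; last exact: (integrable_fin_num _ (path_integrable fi a0 (lexx T))).
apply: ae_eq_integral => //.
- exact: measurable_funS mg.
- by apply/measurable_EFinP; exact: measurable_funS mf.
- by apply: filterS gf => r h /sub; exact: h.
Qed.

End sections.

(** * The inf-convolution at a fixed (w, t) *)

Section pointwise.
Context {R : realType} {d : nat}.
Variables (f g : 'rV[R]_d -> \bar R) (C K : R).
Hypotheses (C0 : 0 < C) (K0 : 0 <= K).

(* The condition of [convex_coefficient] at a fixed (w, t). *)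
Definition convex_at (h : 'rV[R]_d -> \bar R) (L : R) :=
  [/\ convex_ext h,
    exists2 z : 'rV[R]_d, sqnormv z <= L & (h z <= L%:E)%E
  & exists (a : 'rV[R]_d) (b : R), [/\ sqnormv a <= L, `|b| <= L
      & forall z, ((dotv a z + b)%:E <= h z)%E]].

Hypothesis f_cvx : convex_at f K.
Hypothesis g_cvx : convex_at (fun z => (g z - (C / 2 * sqnormv z)%:E)%E) K.

Let h z := ereal_inf [set (f (z - x)%R + g x)%E | x in setT].

Lemma convex_at_ny (k : 'rV[R]_d -> \bar R) L : convex_at k L -> forall z, k z != -oo%E.
Proof.
move=> [_ _ [a [b [_ _ kb]]]] z; apply/negP => /eqP E.
by have := kb z; rewrite E.
Qed.

Let g_ge : exists a b, [/\ sqnormv a <= K, `|b| <= K &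
  forall z, ((C / 2 * sqnormv z + (dotv a z + b))%:E <= g z)%E].
Proof.
have [_ _ [a [b [aK bK gb]]]] := g_cvx; exists a, b; split => // z.
by have := gb z; rewrite leeBrDr// -EFinD addrC.
Qed.

Let g_ny z : g z != -oo%E.
Proof.
by apply/negP => /eqP E; have := convex_at_ny g_cvx z; rewrite E.
Qed.

(** The quadratic term is added back; its own convexity gap is l (1 - l) |x - y|^2 >= 0. *)
Let g_convex : convex_ext g.
Proof.
have [cg _ _] := g_cvx => x y l l01.
have l0 : 0 < l by case/andP: l01.
have l1 : 0 < 1 - l by rewrite subr_gt0; case/andP: l01.
have := cg x y l l01; have := g_ny x; have := g_ny y.
have sq : sqnormv (l *: x + (1 - l) *: y) <= l * sqnormv x + (1 - l) * sqnormv y.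
  have := mulr_ge0 (mulr_ge0 (ltW l0) (ltW l1)) (sqnormv_ge0 (x - y)).
  have e : sqnormv (l *: x + (1 - l) *: y) =
      l ^+ 2 * sqnormv x + 2 * ((1 - l) * (l * dotv x y)) + (1 - l) ^+ 2 * sqnormv y.
    by rewrite sqnormvD !sqnormvZ dotvZr (dotvC (l *: x)) dotvZr (dotvC y).
  by rewrite sqnormvB e; lra.
have C2 : 0 < C / 2 by rewrite divr_gt0.
have := ler_wpM2l (ltW C2) sq.
case: (g x) => [gx| |]//; case: (g y) => [gy| |]//; last 3 first.
- by move=> *; rewrite gt0_muley ?lte_fin// addey// leey.
- by move=> *; rewrite gt0_muley ?lte_fin// addye// leey.
- by move=> *; rewrite !gt0_muley ?lte_fin// leey.
move=> hs _ _.
have -> : (l%:E * (gx%:E - (C / 2 * sqnormv x)%:E) +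
    (1 - l)%:E * (gy%:E - (C / 2 * sqnormv y)%:E))%E =
  (l * (gx - C / 2 * sqnormv x) + (1 - l) * (gy - C / 2 * sqnormv y))%:E by [].
have -> : (l%:E * gx%:E + (1 - l)%:E * gy%:E)%E = (l * gx + (1 - l) * gy)%:E by [].
rewrite leeBlDr// -EFinD => /le_trans; apply; rewrite lee_fin; lra.
Qed.

(** 4 K bounds the squared norm of the sum of the two finite points, 2 K + C K the value there, and
    2 K + 2 K / C the intercept of the affine minorant. *)
Let Kp := 4 * K + 2 * K / C + C * K.

Let KC0 : 0 <= 2 * K / C. Proof. by rewrite divr_ge0 ?mulr_ge0// ltW. Qed.
Let CK0 : 0 <= C * K. Proof. by rewrite mulr_ge0// ltW. Qed.

Let g_point : exists2 z, sqnormv z <= K & (g z <= (K + C * K)%:E)%E.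
Proof.
have [_ [z zK gz] _] := g_cvx; exists z => //.
move: gz; rewrite leeBlDr// -EFinD => /le_trans; apply; rewrite lee_fin lerD2l.
have : C / 2 * sqnormv z <= C / 2 * K by rewrite ler_wpM2l// divr_ge0// ltW.
by have := K0; have := CK0; lra.
Qed.

Lemma convex_at_inf_conv : convex_at h Kp.
Proof.
have [cf [zf zfK fz] [a [b [aK bK fa]]]] := f_cvx.
have [a' [b' [a'K b'K ga]]] := g_ge.
have [zg zgK gz] := g_point.
have h_ge := ereal_inf_conv_affine_minorant C0 aK a'K fa ga.
have k0 := K0; have k1 := KC0; have k2 := CK0.
split.
- apply: convex_ext_inf_conv => //; first exact: convex_at_ny f_cvx.
  by move=> z; apply/negP => /eqP E; have := h_ge z; rewrite E.
- exists (zf + zg).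
    by have := sqnormvD_le zf zg; rewrite /Kp; lra.
  apply: (le_trans (ereal_inf_conv_le f g _ zg)); rewrite addrK.
  by apply: (le_trans (leeD fz gz)); rewrite -EFinD lee_fin /Kp; lra.
- exists a, (b + b' - 2 * K / C); split => //; first by rewrite /Kp; lra.
  move: bK b'K; rewrite !ler_norml /Kp => /andP[? ?] /andP[? ?].
  by apply/andP; split; lra.
Qed.

Lemma inf_conv_quadratic_growth k :
  (forall z, (`|g z| <= (k * (1 + sqnormv z))%:E)%E) \/
  (forall z, (`|f z| <= (k * (1 + sqnormv z))%:E)%E) ->
  forall z, (`|h z| <= ((2 * Kp + K + C * K + `|k| * (2 + 2 * K) + 1) * (1 + sqnormv z))%:E)%E.
Proof.
move=> fgk z.
have [_ [zf zfK fz] _] := f_cvx; have [zg zgK gz] := g_point.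
have [_ _ [a [b [aK bK ha]]]] := convex_at_inf_conv.
have k0 := K0; have k1 := KC0; have k2 := CK0.
have s0 := sqnormv_ge0 z; have nk := normr_ge0 k.
(* Here 1 + |z - x|^2 <= (2 + 2 K) (1 + |z|^2), and |k| is used because the sign of k is not
   given. *)
have kz x : sqnormv x <= K -> k * (1 + sqnormv (z - x)) <= `|k| * ((2 + 2 * K) * (1 + sqnormv z)).
  move=> xK; apply: (@le_trans _ _ (`|k| * (1 + sqnormv (z - x)))).
    by rewrite ler_wpM2r ?ler_norm// addr_ge0// sqnormv_ge0.
  rewrite ler_wpM2l//; have := sqnormvB_le z x; have := mulr_ge0 K0 s0; lra.
have hz_le : (h z <= (K + C * K + `|k| * ((2 + 2 * K) * (1 + sqnormv z)))%:E)%E.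
  case: fgk => [gk|fk].
  (* The competitor z - zf evaluates f at its finite point zf and leaves the growth to g. *)
  - have := ereal_inf_conv_le f g z (z - zf); rewrite subKr => /le_trans; apply.
    have gz' : (g (z - zf)%R <= (`|k| * ((2 + 2 * K) * (1 + sqnormv z)))%:E)%E.
      apply: (le_trans (lee_abs _)); apply: (le_trans (gk _)).
      by rewrite lee_fin kz.
    by apply: (le_trans (leeD fz gz')); rewrite -EFinD lee_fin; lra.
  (* Symmetrically, the competitor zg evaluates g at its finite point and leaves the growth to f. *)
  - have := ereal_inf_conv_le f g z zg => /le_trans; apply.
    have fz' : (f (z - zg)%R <= (`|k| * ((2 + 2 * K) * (1 + sqnormv z)))%:E)%E.
      apply: (le_trans (lee_abs _)); apply: (le_trans (fk _)).
      by rewrite lee_fin kz.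
    by apply: (le_trans (leeD fz' gz)); rewrite -EFinD lee_fin; lra.
have hz_ge := ha z.
have az : - dotv a z <= (Kp + sqnormv z) / 2.
  by have := dotv_young (- 1) a z; rewrite sqrrN expr1n; lra.
move: bK; rewrite ler_norml => /andP[b1 b2].
have e1 : 0 <= `|k| * ((2 + 2 * K) * (1 + sqnormv z)).
  by rewrite !mulr_ge0// addr_ge0// mulr_ge0.
have Kp0 : 0 <= Kp by rewrite /Kp; lra.
have p1 := mulr_ge0 Kp0 s0; have p2 := mulr_ge0 K0 s0; have p3 := mulr_ge0 k2 s0.
move: hz_le hz_ge; rewrite -/(h z).
case: (h z) => [y| |]//; rewrite !lee_fin => y1 y2.
by rewrite ler_norml; apply/andP; split; lra.
Qed.

Lemma minimizer_lower_bound z x :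
  ((C / 4 * sqnormv x - (3 * K + 1 + 4 * K / C) * Num.sqrt (1 + sqnormv z))%:E
     <= f (z - x)%R + g x)%E.
Proof.
have [_ _ [a [b [aK bK fa]]]] := f_cvx.
have [a' [b' [a'K b'K ga]]] := g_ge.
exact: split_quadratic_minorant aK a'K bK b'K fa ga.
Qed.

End pointwise.

Lemma convex_at_le {R : realType} {d : nat} (h : 'rV[R]_d -> \bar R) (K L : R) :
  K <= L -> convex_at h K -> convex_at h L.
Proof.
move=> KL [ch [z zK hz] [a [b [aK bK ha]]]]; split => //.
  by exists z; [exact: le_trans KL|apply: le_trans hz _; rewrite lee_fin].
by exists a, b; split => //; exact: le_trans KL.
Qed.

(** * The BMO property of the minimizer *)

Section bmo.
Context {R : realType} {dsp : measure_display} {Omega : measurableType dsp}.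
Variables (P : probability Omega R) (T : R) (d : nat).
Variable W : Omega -> R -> 'rV[R]_d.
Hypotheses (T0 : 0 < T) (W_bm : brownian_motion P T W).
Local Notation F := (completed_filtration P W).
Local Notation mu := (@lebesgue_measure R).

Lemma bsde_solution_BMO (g : Omega -> R -> 'rV[R]_d -> \bar R) (zeta : Omega -> R)
    (Y : Omega -> R -> R) (Z ZB : Omega -> R -> 'rV[R]_d) (c kap : R) :
  0 <= c -> 0 < kap ->
  bsde_solution P T W g zeta Y Z -> progressive_vec T F ZB ->
  ae_dPdt P T (fun w t =>
    ((kap * sqnormv (ZB w t) - c * Num.sqrt (1 + sqnormv (Z w t)))%:E
       <= g w t (Z w t))%E) ->
  BMO P T F ZB.
Proof.
move=> c0 kap0 [pY [M0 YM0] pZ Zen [I hI eqY]] pZB low.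
have T0' := ltW T0.
pose M := `|M0|.
have FF : Filter (nbhs (almost_everywhere P)) by exact: ae_filter_ringOfSetsType.
(* The extended-valued driver is replaced, path by path, by a real version satisfying the lower
   bound at all times; the equation at two times is then subtracted. *)
have paths : {ae P, forall w, exists f, bsde_path T Z ZB Y I M c kap w f}.
  have low' := ae_dPdt_section low.
  apply: filterS3 YM0 eqY low' => w YM [ig eqw] lw.
  pose l r := kap * sqnormv (ZB w r) - c * Num.sqrt (1 + sqnormv (Z w r)).
  have mZ := jointly_measurable_section (lexx 0) (lexx T) w
    (progressive_vec_sqnormv_measurable T0' W_bm pZ).
  have mZB := jointly_measurable_section (lexx 0) (lexx T) w
    (progressive_vec_sqnormv_measurable T0' W_bm pZB).
  have ml : measurable_fun `[0, T]%classic l.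
    apply: measurable_funB; apply: measurable_funM => //.
    apply: (@measurableT_comp _ _ _ _ _ _ (@Num.sqrt R)).
      by apply: continuous_measurable_fun; exact: sqrt_continuous.
    exact: measurable_funD.
  have [f [fi lf fE]] := path_real_version ig ml lw.
  exists f; split => //; first by move=> r _; exact: lf.
  - move=> a b a0 ab bT.
    have Ya : Y w a = zeta w + \int[mu]_(r in `[a, T]) f r - (I w T - I w a).
      have := eqw a; rewrite a0 (le_trans ab bT) fE//= => /(_ isT) [->]//.
    have b0 := le_trans a0 ab.
    have Yb : Y w b = zeta w + \int[mu]_(r in `[b, T]) f r - (I w T - I w b).
      by have := eqw b; rewrite b0 bT fE//= => /(_ isT) [->].
    by rewrite Ya Yb (path_integral_cat fi a0 ab bT (lexx T)); ring.
  - by move=> t t0T; apply: (le_trans (YM t t0T)); exact: ler_norm.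
have le := bsde_minimizer_le T0 W_bm (normr_ge0 M0) c0 kap0 pY pZ pZB Zen hI paths.
have int := bsde_minimizer_integrable T0 W_bm c0 kap0 pZ pZB Zen hI paths.
split => //.
  rewrite /energy; have /integrableP[_] := int 0 (lexx 0) T0'.
  apply: le_lt_trans; apply: ge0_le_integral => //.
  - by move=> w _; apply: integral_ge0 => r _; rewrite lee_fin sqnormv_ge0.
  - exact: measurable_int (int 0 (lexx 0) T0').
  - by apply: measurableT_comp => //; exact: measurable_int (int 0 (lexx 0) T0').
  - by move=> w _; exact: lee_abs.
set C := ((_ + _) / _) in le.
exists C => t /andP[t0 tT].
apply: (cond_expectation_bounded (filtration_measurable W_bm tT) (filtration_id P W t)
  (int t t0 tT)) => A FA.
have mA : measurable A by exact: (filtration_measurable W_bm tT).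
have eA : (C * \int[P]_w \1_A w)%:E = (C%:E * P A)%E.
  rewrite EFinM /Rintegral fineK integral_indic// setIT//; exact: fin_num_measure.
have A0 w : 0 <= (\1_A w : R) by [].
have A1 w : (\1_A w : R) <= 1 by rewrite indicE lern1 leq_b1.
(* The weight psi = 1_A with A in F_t gives the inequality over A that characterizes an upper bound
   of the conditional expectation. *)
have := le t t0 tT \1_A (measurable_wrt_indic FA) A0 A1.
rewrite eA; apply: le_trans.
rewrite le_eqVlt; apply/orP; left; apply/eqP.
rewrite integral_mkcond; apply: eq_integral => w _.
by rewrite patchE indicE; case: ifP => _; rewrite ?mul1e ?mul0e.
Qed.
End bmo.

Theorem theorem8p4 (R : realType) (dsp : measure_display)
    (Omega : measurableType dsp) (P : probability Omega R) (T : R) (d : nat)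
    (W : Omega -> R -> 'rV[R]_d) (gA gB : Omega -> R -> 'rV[R]_d -> \bar R)
    (T_gt0 : 0 < T) (W_bm : brownian_motion P T W)
    (gA_coef : coefficient T (completed_filtration P W) gA)
    (gB_coef : coefficient T (completed_filtration P W) gB)
    (gB_strong : strongly_convex P T gB)
    (gA_convex : convex_coefficient P T gA)
    (g_growth : quadratic_growth P T gB \/ quadratic_growth P T gA) :
  [/\ convex_coefficient P T (inf_conv gA gB),
      quadratic_growth P T (inf_conv gA gB)
    & forall (xi : Omega -> R) (Y : Omega -> R -> R)
        (Z ZB : Omega -> R -> 'rV[R]_d),
      Linfty P (completed_filtration P W T) xi ->
      bsde_maximal_solution P T W (inf_conv gA gB) (fun w => - xi w) Y Z ->
      progressive_vec T (completed_filtration P W) ZB ->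
      ae_dPdt P T (fun w t => forall x : 'rV[R]_d,
        (gA w t (Z w t - ZB w t)%R + gB w t (ZB w t)
           <= gA w t (Z w t - x)%R + gB w t x)%E) ->
      BMO P T (completed_filtration P W) ZB].
Proof.
have [C C0 [KB cB]] := gB_strong; have [KA cA] := gA_convex.
(* A single nonnegative constant serving both coefficients. *)
pose K := `|KA| + `|KB|.
have K0 : 0 <= K by rewrite addr_ge0.
have FF : Filter (nbhs (almost_everywhere (P \x @lebesgue_measure R)%E)).
  exact: ae_filter_ringOfSetsType.
have cAB : ae_dPdt P T (fun w t => convex_at (gA w t) K /\
    convex_at (fun z => (gB w t z - (C / 2 * sqnormv z)%:E)%E) K).
  apply: filterS2 cA cB => p hA hB pT; split.
  - apply: convex_at_le (hA pT).
    by rewrite (le_trans (ler_norm _))// lerDl.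
  - apply: convex_at_le (hB pT).
    by rewrite (le_trans (ler_norm _))// lerDr.
split.
- exists (4 * K + 2 * K / C + C * K); apply: filterS cAB => p h pT.
  by have [hA hB] := h pT; exact: convex_at_inf_conv.
- have [k gk] : exists k, ae_dPdt P T (fun w t =>
      (forall z, (`|gB w t z| <= (k * (1 + sqnormv z))%:E)%E) \/
      (forall z, (`|gA w t z| <= (k * (1 + sqnormv z))%:E)%E)).
    case: g_growth => -[k gk]; exists k; apply: filterS gk => p h pT.
    + by left; have [_] := h pT.
    + by right; have [_] := h pT.
  eexists; apply: filterS2 cAB gk => p h1 h2 pT.
  have [hA hB] := h1 pT.
  have hk := inf_conv_quadratic_growth C0 K0 hA hB (h2 pT).
  split; last exact: hk.
  have [ch _ _] := convex_at_inf_conv C0 K0 hA hB.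
  exact: convex_quadratic_growth_continuous ch hk.
- move=> xi Y Z ZB _ [sol _] pZB ZBmin.
  apply: (bsde_solution_BMO T_gt0 W_bm (c := 3 * K + 1 + 4 * K / C)
    (kap := C / 4) _ _ sol pZB).
  + by rewrite !addr_ge0// ?mulr_ge0// ltW// invr_gt0.
  + by rewrite divr_gt0.
  apply: filterS2 cAB ZBmin => p h1 h2 pT.
  have [hA hB] := h1 pT.
  apply: (le_trans (minimizer_lower_bound C0 K0 hA hB (Z p.1 p.2) (ZB p.1 p.2))).
  (* By minimality, the value at [ZB] is a lower bound of all competitors, hence at most the
     inf-convolution at Z. *)
  by apply: le_ereal_inf_tmp => _ [x _ <-]; exact: h2.
Qed.
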